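(* Let $d=2k+1$ with $k\in\mathbb N$, $k\ge2$, let $p>\frac{d+3}{d-1}$, and let $\mathfrak H:=H^{\frac{d+1}2}_{\rm rad}\times H^{\frac{d-1}2}_{\rm rad}(\mathbb B^d)$. There is a dense domain $\mathcal D(\mathcal L_0)\subset\mathfrak H$ such that the operator $\mathcal L_0:\mathcal D(\mathcal L_0)\subset\mathfrak H\to\mathfrak H$, $$\mathcal L_0(\psi_1,\psi_2)=\left(\psi_2-\xi\cdot\nabla\psi_1-\tfrac2{p-1}\psi_1,\ \Delta\psi_1-\xi\cdot\nabla\psi_2-\tfrac{p+1}{p-1}\psi_2\right),$$ is closable and its closure generates a strongly continuous one-parameter semigroup $\{\mathcal S_0(\tau):\tau\ge0\}$ of bounded operators on $\mathfrak H$.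
   Context: $\mathbb B^d$ is the open unit ball in $\mathbb R^d$ centered at $0$, $\xi\in\mathbb B^d$ is the space variable, and $H^k_{\rm rad}(\mathbb B^d):=\{u\in H^k(\mathbb B^d):u\text{ is radial}\}$ for $k\in\mathbb N_0$, with the norm of the Sobolev space $H^k(\mathbb B^d)$. *)

(* Defs.v *)
From HB Require Import structures.
From mathcomp Require Import all_boot all_order all_algebra generic_quotient ring_quotient.
From mathcomp Require Import all_classical all_reals all_analysis.
From mathcomp Require Import measurable_realfun ring lra.

Set Implicit Arguments.
Unset Strict Implicit.
Unset Printing Implicit Defensive.
Import Order.TTheory GRing.Theory Num.Theory.
Import numFieldNormedType.Exports.
Local Open Scope classical_set_scope.
Local Open Scope ring_scope.

Section measurable_row.
Variables (R : realType) (n : nat).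

Let coords : 'I_n -> 'rV[R]_n -> measurableTypeR R := fun i x => x ord0 i.

Let row_set0 : g_sigma_preimage coords set0.
Proof. exact: sigma_algebra0. Qed.

Let row_setC A : g_sigma_preimage coords A -> g_sigma_preimage coords (~` A).
Proof. exact: sigma_algebraC. Qed.

Let row_bigcup (F : _^nat) : (forall i, g_sigma_preimage coords (F i)) ->
  g_sigma_preimage coords (\bigcup_i (F i)).
Proof. exact: sigma_algebra_bigcup. Qed.

Fact row_display : measure_display. Proof. by []. Qed.

(* The product of the Borel sigma-algebras of the coordinates, which is the Borel
   sigma-algebra of R^n. *)
HB.instance Definition _ := @isMeasurable.Build row_display
  'rV[R]_n (g_sigma_preimage coords) row_set0 row_setC row_bigcup.

Lemma measurable_coord (i : 'I_n) :
  measurable_fun [set: 'rV[R]_n] (fun x : 'rV[R]_n => x ord0 i).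
Proof.
move=> _ Y mY; rewrite setTI; apply: sub_sigma_algebra => /=.
rewrite -bigcup_seq/=; exists i => /=; first by rewrite mem_index_enum.
by exists Y => //; rewrite setTI.
Qed.

Lemma measurable_rowP d (T : measurableType d) (f : T -> 'rV[R]_n) :
  (forall i, measurable_fun [set: T] (fun t => f t ord0 i)) ->
  measurable_fun [set: T] f.
Proof.
move=> mf.
suff : g_sigma_preimage (fun i => coords i \o f) `<=` measurable.
  by rewrite g_sigma_preimage_comp => prefS _ A mA; apply: prefS; exists A.
apply: smallest_sub; first exact: sigma_algebra_measurable.
move=> A; rewrite -bigcup_seq => -[i _] [B mB <-]; exact: mf.
Qed.

End measurable_row.

Section lebesgue_rV.
Variable R : realType.

Definition rv_cons n (x : measurableTypeR R * 'rV[R]_n) : 'rV[R]_n.+1 :=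
  row_mx (const_mx x.1 : 'rV[R]_1) x.2.

Lemma measurable_rv_cons n : measurable_fun setT (@rv_cons n).
Proof.
apply: measurable_rowP => /= i.
case: (@split_ordP 1 n i) => j ->.
- rewrite (_ : (fun _ => _) = fst); first exact: measurable_fst.
  by apply/funext => x; apply: etrans (row_mxEl _ _ _ _) _; rewrite mxE.
- rewrite (_ : (fun _ => _) = (fun x : 'rV[R]_n => x ord0 j) \o snd).
    exact: (measurableT_comp (measurable_coord j) measurable_snd).
  by apply/funext => x; apply: etrans (row_mxEr _ _ _ _) _.
Qed.

Definition lebesgue_step n (mu : {sigma_finite_measure set 'rV[R]_n -> \bar R})
    : set 'rV[R]_n.+1 -> \bar R :=
  pushforward (@lebesgue_measure R \x mu)%E (@rv_cons n).

Section lebesgue_step.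
Variables (n : nat) (mu : {sigma_finite_measure set 'rV[R]_n -> \bar R}).

Let lebesgue_step0 : lebesgue_step mu set0 = 0%E.
Proof. by rewrite /lebesgue_step /pushforward preimage_set0 measure0. Qed.

Let lebesgue_step_ge0 A : (0 <= lebesgue_step mu A)%E.
Proof. exact: (measure_ge0 (@lebesgue_measure R \x mu)%E). Qed.

Let lebesgue_step_sigma_additive : semi_sigma_additive (lebesgue_step mu).
Proof.
move=> F mF tF mUF; rewrite /lebesgue_step /pushforward preimage_bigcup.
have mpre A : measurable A -> measurable (@rv_cons n @^-1` A).
  by move=> mA; rewrite -[X in measurable X]setTI; exact: measurable_rv_cons.
apply: (measure_semi_sigma_additive (s := (@lebesgue_measure R \x mu)%E)).
- by move=> k; exact: mpre.
- apply/trivIsetP => /= i j _ _ ij; rewrite -preimage_setI.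
  by move/trivIsetP : tF => /(_ _ _ _ _ ij) ->//; rewrite preimage_set0.
- by rewrite -preimage_bigcup; exact: mpre.
Qed.

HB.instance Definition _ := isMeasure.Build _ _ _ (lebesgue_step mu)
  lebesgue_step0 lebesgue_step_ge0 lebesgue_step_sigma_additive.

Let lebesgue_step_sigma_finite : sigma_finite setT (lebesgue_step mu).
Proof.
have /sigma_finiteP[F [TF ndF Foo]] := sigma_finiteT (@lebesgue_measure R).
have /sigma_finiteP[G [TG ndG Goo]] := sigma_finiteT mu.
pose h (x : 'rV[R]_(1 + n)) : measurableTypeR R * 'rV[R]_n :=
  (x ord0 ord0, rsubmx x).
have mh : measurable_fun setT h.
  apply: measurable_fun_pair; first exact: measurable_coord.
  apply: measurable_rowP => i; rewrite (_ : (fun _ => _) =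
    (fun x : 'rV_(1 + n) => x ord0 (rshift 1 i))).
    exact: measurable_coord.
  by apply/funext => x /=; rewrite mxE.
have hK x : h (rv_cons x) = x.
  case: x => a x; rewrite /h /rv_cons row_mxKr; congr pair.
  by rewrite mxE; case: splitP => j //= _; rewrite mxE.
exists (fun k => h @^-1` (F k `*` G k)).
  rewrite -preimage_bigcup (_ : \bigcup_k _ = setT) ?preimage_setT//.
  rewrite -setXTT TF TG predeqE => -[x y]; split => [[k _ [] ? ?]|].
    by split; exists k.
  move=> [/= [i _ Fix] [j _ Gjy]]; exists (maxn i j) => //; split.
  - by move: x Fix; exact/subsetPset/ndF/leq_maxl.
  - by move: y Gjy; exact/subsetPset/ndG/leq_maxr.
move=> k; have [mFk Fk] := Foo k; have [mGk Gk] := Goo k; split.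
  by rewrite -[X in measurable X]setTI; apply: mh => //; exact: measurableX.
rewrite /lebesgue_step /pushforward (_ : _ @^-1` _ = F k `*` G k); last first.
  by apply/funext => x; exact: (congr1 (F k `*` G k) (hK x)).
by rewrite product_measure1E// lte_mul_pinfty// ge0_fin_numE.
Qed.

HB.instance Definition _ := Measure_isSigmaFinite.Build _ _ _ (lebesgue_step mu)
  lebesgue_step_sigma_finite.

End lebesgue_step.

(* The image of the product measure on R * R^n under (a, x) |-> (a, x). *)
Fixpoint lebesgue_rV n : {sigma_finite_measure set 'rV[R]_n -> \bar R} :=
  match n with
  | 0 => \d_(0 : 'rV[R]_0)
  | n'.+1 => lebesgue_step (lebesgue_rV n')
  end.

End lebesgue_rV.

Section continuous_measurable.
Variables (R : realType) (n : nat).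

Let grid (k : nat) (z : 'rV[int]_n) : 'rV[R]_n :=
  \row_i ((z ord0 i)%:~R / k.+1%:R).

Let cell (k : nat) (x : 'rV[R]_n) : 'rV[int]_n :=
  \row_i Num.floor (x ord0 i * k.+1%:R).

Let grid_cvg (x : 'rV[R]_n) : (fun k => grid k (cell k x)) @ \oo --> x.
Proof.
apply/cvgrPdist_le => /= e e0; near=> k.
rewrite [leLHS]mx_normrE; apply: bigmax_le; first exact: ltW.
move=> [i j] _ /=; rewrite !mxE (ord1 i).
set y := x ord0 j.
have k0 : 0 < k.+1%:R :> R by rewrite ltr0n.
rewrite -[X in `|X - _|](mulfK (lt0r_neq0 k0)) -mulrBl normrM.
rewrite [X in _ * X]gtr0_norm ?invr_gt0//.
apply: (@le_trans _ _ (1 * k.+1%:R^-1)).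
  rewrite ler_pM2r ?invr_gt0//.
  have /andP[fl fu] := floor_itv (y * k.+1%:R).
  by rewrite ger0_norm ?subr_ge0// lerBlDl ltW// (lt_le_trans fu)// intrD.
rewrite mul1r ltW//; near: k; exact: (near_infty_natSinv_lt (PosNum e0)).
Unshelve. all: by end_near. Qed.

Lemma continuous_measurable_rV (f : 'rV[R]_n -> R) :
  continuous f -> measurable_fun [set: 'rV[R]_n] f.
Proof.
move=> cf.
apply: (@measurable_fun_cvg _ _ _ _ (fun k x => f (grid k (cell k x)))).
  move=> k _ Y mY; rewrite setTI.
  rewrite (_ : _ @^-1` Y = \bigcup_(z in [set z | Y (f (grid k z))])
      [set x | cell k x = z]); last first.
    apply/seteqP; split => [x Yx|x [z Yz] /= xz]; first by exists (cell k x).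
    by rewrite xz.
  rewrite bigcup_mkcond; apply: countable_bigcupT_measurable => [//|z].
  case: ifPn => // _.
  rewrite (_ : [set x | _] = \bigcap_(i in [set: 'I_n])
     ((fun x : 'rV[R]_n => x ord0 i * k.+1%:R) @^-1`
        `[(z ord0 i)%:~R, (z ord0 i + 1)%:~R[)).
    apply: fin_bigcap_measurable => // i _.
    rewrite -[X in measurable X]setTI.
    suff : measurable_fun setT (fun x : 'rV[R]_n => x ord0 i * k.+1%:R).
      by apply => //; exact: measurable_itv.
    by apply: measurable_funM => //; exact: measurable_coord.
  apply/seteqP; split => x /=.
    by move=> <- i _ /=; rewrite in_itv/= mxE; exact: floor_itv.
  move=> xz; apply/rowP => i; rewrite mxE; apply: floor_def.
  by have /= := xz i Logic.I; rewrite in_itv.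
by move=> x _; apply: (@cvg_comp _ _ _ _ f _ (nbhs x)); [exact: grid_cvg|exact: cf].
Qed.

End continuous_measurable.

Section ball.
Variables (R : realType) (d : nat).

(* The norm `|x| that the library puts on 'rV[R]_d is the sup norm. *)
Definition enorm (x : 'rV[R]_d) : R := Num.sqrt (\sum_(i < d) x ord0 i ^+ 2).

Definition eball : set 'rV[R]_d := [set x | enorm x < 1].

Lemma measurable_eball : measurable eball.
Proof.
have -> : eball = (fun x : 'rV[R]_d => \sum_(i < d) x ord0 i ^+ 2) @^-1` `]-oo, 1[.
  apply/funext => x; rewrite /eball /enorm /preimage /mkset in_itv/=.
  by rewrite -[X in _ < X]sqrtr1 ltr_sqrt.
rewrite -[X in measurable X]setTI.
have mf : measurable_fun setT (fun x : 'rV[R]_d => \sum_(i < d) x ord0 i ^+ 2).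
  by apply: measurable_sum => i; apply: measurable_funX; exact: measurable_coord.
by apply: mf => //; exact: measurable_itv.
Qed.

Definition ball_measure : {measure set 'rV[R]_d -> \bar R} :=
  mrestr (lebesgue_rV R d) measurable_eball.

End ball.

Section ball_measure_lemmas.
Variable R : realType.

Let box n : set 'rV[R]_n := [set x | forall i, `[-1, 1]%classic (x ord0 i)].

Let measurable_box n : measurable (@box n).
Proof.
rewrite (_ : @box n = \bigcap_(i in [set: 'I_n])
    ((fun x : 'rV[R]_n => x ord0 i) @^-1` `[-1, 1])); last first.
  by apply/seteqP; split => x /= h i => [_|]; exact: h.
apply: fin_bigcap_measurable => // i _.
rewrite -[X in measurable X]setTI; exact: measurable_coord.
Qed.

Let lebesgue_box n : (lebesgue_rV R n (@box n) < +oo)%E.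
Proof.
elim: n => [|n IHn] /=; first by rewrite diracE ltry.
rewrite /lebesgue_step /pushforward.
rewrite (_ : _ @^-1` _ = `[-1, 1]%classic `*` @box n); last first.
  apply/seteqP; split=> [[a x] /= h|[a x] [/= ha hx]].
    split => [|i /=].
      have := h (lshift n (ord0 : 'I_1)).
      by rewrite /= [_ ord0 _](row_mxEl _ _ _ _) mxE.
    by have := h (rshift 1 i); rewrite /= [_ ord0 _](row_mxEr _ _ _ _).
  move=> /= i; case: (@split_ordP 1 n i) => j -> /=.
    by rewrite [_ ord0 _](row_mxEl _ _ _ _) mxE.
  by rewrite [_ ord0 _](row_mxEr _ _ _ _); exact: hx.
rewrite product_measure1E//; last exact: measurable_box.
have l2 := lebesgue_measure_itv (`[-1, 1]%R : interval R).
rewrite /= lte_fin ifT -?EFinB ?opprK in l2; last by lra.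
rewrite [X in (X * _)%E]l2.
by rewrite lte_mul_pinfty// lee_fin; lra.
Qed.

Variable d : nat.
Local Notation mu := (ball_measure R d).

Let eball_box : @eball R d `<=` @box d.
Proof.
move=> x xB i /=; rewrite in_itv/= -ler_norml -sqrtr_sqr.
apply/ltW/(le_lt_trans _ xB); rewrite /enorm ler_wsqrtr//.
by rewrite (bigD1 i)//= lerDl sumr_ge0// => j _; exact: sqr_ge0.
Qed.

Lemma ball_measure_fin : mu setT \is a fin_num.
Proof.
rewrite ge0_fin_numE// (le_lt_trans _ (lebesgue_box d))//.
rewrite /ball_measure/= /mrestr setTI le_measure// inE.
  exact: measurable_eball.
exact: measurable_box.
Qed.

Lemma ball_measure_ae : {ae mu, forall x, eball x}.
Proof.
exists (~` @eball R d); split => //.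
  by apply: measurableC; exact: measurable_eball.
by rewrite /ball_measure/= /mrestr setICl measure0.
Qed.

Lemma integrable_mul_continuous (u h : 'rV[R]_d -> R) :
  u \in Lfun mu 2%:E -> continuous h ->
  mu.-integrable setT (EFin \o (fun x => u x * h x)).
Proof.
move=> u2 ch.
have u1 := Lfun_subset12 ball_measure_fin u2.
have mu_ : measurable_fun setT u by move: u2; rewrite inE => /andP[/[1!inE]].
have mh := continuous_measurable_rV ch.
have cbox : compact (@box d).
  have := @rV_compact R d (fun=> `[-1, 1]%classic).
  by apply => i; exact: segment_compact.
have [M hM] : exists M, forall x, @box d x -> `|h x| <= M.
  have : compact (h @` @box d).
    by apply: continuous_compact => //; exact: continuous_subspaceT.
  move=> /compact_bounded[M [_ /(_ (M + 1))]].
  rewrite ltrDl ltr01 => /(_ isT) hM; exists (M + 1) => x Bx.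
  by apply: hM; exists x.
apply/integrableP; split.
  by apply/measurable_EFinP; exact: measurable_funM.
apply: (@le_lt_trans _ _ (\int[mu]_x (`|M| * `|u x|)%:E)%E).
  apply: ae_ge0_le_integral => //.
  - by apply: measurableT_comp => //; apply/measurable_EFinP; exact: measurable_funM.
  - by apply/measurable_EFinP; apply: measurable_funM => //; exact: measurableT_comp.
  - apply: filterS ball_measure_ae => x xB _ /=.
    rewrite lee_fin normrM mulrC ler_wpM2r// (le_trans (hM _ (eball_box xB)))//.
    exact: ler_norm.
under eq_integral do rewrite EFinM.
rewrite ge0_integralZl//; last 1 first.
  by apply/measurable_EFinP; exact: measurableT_comp.
by rewrite lte_mul_pinfty//; move/Lfun1_integrable/integrableP : u1 => [].
Qed.

End ball_measure_lemmas.

Section sobolev.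
Variables (R : realType) (d : nat).
Local Notation mu := (ball_measure R d).

(* [partials [:: i1; ...; ij] f] is the iterated partial derivative
   d_i1 (... (d_ij f)). *)
Definition partials (s : seq 'I_d) (f : 'rV[R]_d -> R) : 'rV[R]_d -> R :=
  foldr (fun i g => 'D_(delta_mx ord0 i) g) f s.

Definition mi_order (a : 'I_d -> nat) : nat := (\sum_(i < d) a i)%N.

(* The order in which the derivatives are taken is irrelevant on smooth
   functions. *)
Definition mpartial (a : 'I_d -> nat) : ('rV[R]_d -> R) -> 'rV[R]_d -> R :=
  partials (flatten [seq nseq (a i) i | i <- enum 'I_d]).

Definition smooth (f : 'rV[R]_d -> R) : Prop := forall s : seq 'I_d,
  continuous (partials s f) /\
  forall x i, derivable (partials s f) x (delta_mx ord0 i).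

Definition test_function (f : 'rV[R]_d -> R) : Prop := smooth f /\
  exists K : set 'rV[R]_d,
    [/\ compact K, K `<=` @eball R d & forall x, ~ K x -> f x = 0].

(* [mu] is carried by the open unit ball, so that these are integrals over the
   ball and [Lfun mu 2] is the set of representatives of L^2 of the ball. *)
Definition weak_deriv (a : 'I_d -> nat) (u v : 'rV[R]_d -> R) : Prop :=
  v \in Lfun mu 2%:E /\ forall f, test_function f ->
    \int[mu]_x (u x * mpartial a f x) =
    (-1) ^+ mi_order a * \int[mu]_x (v x * f x).

Definition radial (u : 'rV[R]_d -> R) : Prop :=
  exists f : R -> R, {ae mu, forall x, u x = f (enorm x)}.

Definition Hrad_pred (m : nat) : {pred 'rV[R]_d -> R} := [pred u |
  `[< [/\ u \in Lfun mu 2%:E, radial u &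
      forall a, (mi_order a <= m)%N -> exists v, weak_deriv a u v] >]].

(* [v] is a family of weak derivatives of [u] of order at most [m]. *)
Definition jet (m : nat) (u : 'rV[R]_d -> R)
    (v : ('I_d -> nat) -> 'rV[R]_d -> R) : Prop :=
  {ae mu, forall x, u x = v (fun=> 0%N) x} /\
  forall a, (mi_order a <= m)%N -> weak_deriv a u (v a).

Definition l2norm (u : 'rV[R]_d -> R) : R := fine ('N[mu]_2%:E[EFin \o u]).

Definition jet_norm (m : nat) (v : ('I_d -> nat) -> 'rV[R]_d -> R) : R :=
  Num.sqrt (\sum_(a : {ffun 'I_d -> 'I_m.+1} | (mi_order (fun i => a i) <= m)%N)
     l2norm (v (fun i => a i)) ^+ 2).

(* The weak derivatives of [u] are unique up to null sets, hence all the jets of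
   [u] have the same norm (sum_(|a| <= m) |D^a u|_(L^2)^2)^(1/2). The infimum
   makes the norm well defined, and the norm axioms provable, independently of
   this uniqueness. *)
Definition sobolev_norm m u : R := inf [set jet_norm m v | v in jet m u].

Lemma mpartial_continuous a f : test_function f -> continuous (mpartial a f).
Proof. by case=> sf _; have [] := sf (flatten [seq nseq (a i) i | i <- enum 'I_d]). Qed.

Lemma mpartial0 f : mpartial (fun=> 0%N) f = f.
Proof.
rewrite /mpartial (_ : flatten _ = [::])//.
by elim: (enum 'I_d).
Qed.

Lemma RintegralDl (u v h : 'rV[R]_d -> R) c : u \in Lfun mu 2%:E -> v \in Lfun mu 2%:E ->
  continuous h ->
  \int[mu]_x ((c *: u + v) x * h x) =
  c * \int[mu]_x (u x * h x) + \int[mu]_x (v x * h x).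
Proof.
move=> u2 v2 ch.
have iu := integrable_mul_continuous u2 ch.
have iv := integrable_mul_continuous v2 ch.
rewrite -RintegralZl// -RintegralD//; last exact: (integrableZl _ c iu).
by apply: eq_Rintegral => x _; rewrite /= mulrDl mulrA.
Qed.

Lemma ae_Rintegral (u v h : 'rV[R]_d -> R) : u \in Lfun mu 2%:E -> v \in Lfun mu 2%:E ->
  continuous h -> {ae mu, forall x, u x = v x} ->
  \int[mu]_x (u x * h x) = \int[mu]_x (v x * h x).
Proof.
move=> u2 v2 ch uv; rewrite /Rintegral; congr fine; apply: ae_eq_integral => //.
- by have /integrableP[] := integrable_mul_continuous u2 ch.
- by have /integrableP[] := integrable_mul_continuous v2 ch.
- by apply: filterS uv => x /= -> _.
Qed.

Lemma Lfun_lin (u v : 'rV[R]_d -> R) c : u \in Lfun mu 2%:E -> v \in Lfun mu 2%:E ->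
  c *: u + v \in Lfun mu 2%:E.
Proof. by move=> u2 v2; have [_] := Lfun_submod_closed mu (lee1n 2 : (1 <= 2%:E)%E); apply. Qed.

Lemma weak_deriv_lin a u u' v v' c :
  u \in Lfun mu 2%:E -> u' \in Lfun mu 2%:E ->
  weak_deriv a u v -> weak_deriv a u' v' ->
  weak_deriv a (c *: u + u') (c *: v + v').
Proof.
move=> u2 u2' [v2 uv] [v2' uv']; split; first exact: Lfun_lin.
move=> f tf; rewrite !RintegralDl//.
- by rewrite uv// uv'//; ring.
- by rewrite -(mpartial0 f); exact: mpartial_continuous.
- exact: mpartial_continuous.
Qed.

Lemma weak_deriv_ae a u u' v :
  u \in Lfun mu 2%:E -> u' \in Lfun mu 2%:E ->
  {ae mu, forall x, u x = u' x} -> weak_deriv a u v -> weak_deriv a u' v.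
Proof.
move=> u2 u2' uu' [v2 uv]; split => // f tf.
rewrite -uv//; apply: ae_Rintegral => //; first exact: mpartial_continuous.
by apply: filterS uu' => x ->.
Qed.

Lemma Lfun0 : (0 : 'rV[R]_d -> R) \in Lfun mu 2%:E.
Proof. by have [] := Lfun_submod_closed mu (lee1n 2 : (1 <= 2%:E)%E). Qed.

Lemma weak_deriv0 a : weak_deriv a 0 0.
Proof.
split=> [|f _]; first exact: Lfun0.
have E h : \int[mu]_x ((0 : 'rV[R]_d -> R) x * h x) = 0.
  under eq_Rintegral do rewrite mul0r.
  by rewrite Rintegral_cst// mul0r.
by rewrite !E mulr0.
Qed.

Lemma Hrad_submod_closed m : submod_closed (Hrad_pred m).
Proof.
split.
  apply/asboolP; split; first exact: Lfun0.
    by exists (cst 0); apply: filterS (ball_measure_ae R d) => x _.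
  by move=> a _; exists 0; exact: weak_deriv0.
move=> c u v /asboolP[u2 [f uf] uw] /asboolP[v2 [g vg] vw]; apply/asboolP; split.
- exact: Lfun_lin.
- exists (c *: f + g); apply: filterS2 uf vg => x uf vg.
  by rewrite -[LHS]/(c *: u x + v x) uf vg.
- move=> a am; have [u' uu'] := uw a am; have [v' vv'] := vw a am.
  by exists (c *: u' + v'); exact: weak_deriv_lin.
Qed.

Lemma l2norm_ge0 u : 0 <= l2norm u.
Proof. by rewrite fine_ge0// Lnorm_ge0. Qed.

Lemma l2normD u v : u \in Lfun mu 2%:E -> v \in Lfun mu 2%:E ->
  l2norm (u + v) <= l2norm u + l2norm v.
Proof.
move=> u2 v2.
exact: (ler_LnormD (Lfun_Sub (lee1n 2) u2) (Lfun_Sub (lee1n 2) v2)).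
Qed.

Lemma l2normZ c u : u \in Lfun mu 2%:E -> l2norm (c *: u) = `|c| * l2norm u.
Proof.
move=> u2; rewrite /l2norm.
have h := LnormZ (Lfun_Sub (lee1n 2) u2) c.
rewrite [X in fine X = _](_ : _ = `|c|%:E * 'N[mu]_2%:E[EFin \o u])%E; last exact: h.
rewrite fineM//= ge0_fin_numE ?Lnorm_ge0//.
by move: (u2); rewrite inE => /andP[_]; rewrite inE.
Qed.

Lemma l2norm_eq0 u : u \in Lfun mu 2%:E -> l2norm u = 0 ->
  {ae mu, forall x, u x = 0}.
Proof.
move=> u2 u0.
have := @fine_Lnormr_eq0 _ _ _ _ _ _ (Lfun_Sub (lee1n 2) u2) u0.
by apply: filterS => x /(_ Logic.I).
Qed.

Lemma l2norm_ae u v : u \in Lfun mu 2%:E -> v \in Lfun mu 2%:E ->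
  {ae mu, forall x, u x = v x} -> l2norm u = l2norm v.
Proof.
have mL w : w \in Lfun mu 2%:E ->
    measurable_fun setT (fun x => (`|(w x)%:E| `^ 2)%E).
  rewrite inE => /andP[/[1!inE] mw _].
  under eq_fun do rewrite abse_EFin poweR_EFin.
  apply/measurable_EFinP/(@measurableT_comp _ _ _ _ _ _ (@powR R ^~ 2)) => //.
  exact: measurableT_comp.
move=> u2 v2 uv; rewrite /l2norm unlock; congr (fine (_ `^ _)%E).
apply: ae_eq_integral => //; [exact: mL|exact: mL|].
by apply: filterS uv => x /= -> _.
Qed.

Lemma l2_minkowski (I : finType) (P : pred I) (a b : I -> R) :
  (forall i, 0 <= a i) -> (forall i, 0 <= b i) ->
  Num.sqrt (\sum_(i | P i) (a i + b i) ^+ 2) <=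
  Num.sqrt (\sum_(i | P i) a i ^+ 2) + Num.sqrt (\sum_(i | P i) b i ^+ 2).
Proof.
move=> a0 b0; set A := Num.sqrt (\sum_(i | P i) a i ^+ 2).
set B := Num.sqrt (\sum_(i | P i) b i ^+ 2).
have sa : \sum_(i | P i) a i ^+ 2 = A ^+ 2.
  by rewrite sqr_sqrtr// sumr_ge0// => i _; exact: sqr_ge0.
have sb : \sum_(i | P i) b i ^+ 2 = B ^+ 2.
  by rewrite sqr_sqrtr// sumr_ge0// => i _; exact: sqr_ge0.
have A0 : 0 <= A := sqrtr_ge0 _.
have B0 : 0 <= B := sqrtr_ge0 _.
have cs : \sum_(i | P i) a i * b i <= A * B.
  have [A_eq0|A_neq0] := eqVneq A 0.
    rewrite A_eq0 mul0r big1// => i Pi.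
    have /psumr_eq0P : \sum_(i | P i) a i ^+ 2 = 0 by rewrite sa A_eq0 expr0n.
    move=> /(_ (fun i _ => sqr_ge0 _) i Pi)/eqP.
    by rewrite sqrf_eq0 => /eqP ->; rewrite mul0r.
  have [B_eq0|B_neq0] := eqVneq B 0.
    rewrite B_eq0 mulr0 big1// => i Pi.
    have /psumr_eq0P : \sum_(i | P i) b i ^+ 2 = 0 by rewrite sb B_eq0 expr0n.
    move=> /(_ (fun i _ => sqr_ge0 _) i Pi)/eqP.
    by rewrite sqrf_eq0 => /eqP ->; rewrite mulr0.
  have AB0 : 0 < A * B by rewrite mulr_gt0// lt_neqAle eq_sym ?A_neq0 ?B_neq0.
  have : 0 <= \sum_(i | P i) (a i * B - b i * A) ^+ 2.
    by rewrite sumr_ge0// => i _; exact: sqr_ge0.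
  under eq_bigr => i _.
    rewrite (_ : _ ^+ 2 = B ^+ 2 * a i ^+ 2 + A ^+ 2 * b i ^+ 2
      - 2 * (A * B) * (a i * b i)); last by ring.
    over.
  rewrite sumrB big_split/= -!mulr_sumr sa sb.
  rewrite (_ : _ - _ = 2 * ((A * B) * (A * B - \sum_(i | P i) a i * b i))); last by ring.
  by rewrite pmulr_rge0// pmulr_rge0// subr_ge0.
rewrite -(@ler_pXn2r _ 2)// ?nnegrE ?addr_ge0 ?sqrtr_ge0//.
rewrite sqr_sqrtr; last by rewrite sumr_ge0// => i _; exact: sqr_ge0.
under eq_bigr do rewrite sqrrD.
rewrite !big_split/= sa sb sqrrD lerD2r lerD2l.
by rewrite mulr2n lerD.
Qed.

End sobolev.

Section sobolev_norm.
Variables (R : realType) (d m : nat).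
Local Notation mu := (ball_measure R d).
Local Notation H := (@Hrad_pred R d m).
Local Notation N := (@sobolev_norm R d m).
Implicit Types u : 'rV[R]_d -> R.

Let HL u : u \in H -> u \in Lfun mu 2%:E.
Proof. by move=> /asboolP[]. Qed.

Let jet_ex u : u \in H -> exists v, jet m u v.
Proof.
move=> /asboolP[u2 _ uw].
have /choice[v vP] : forall a, exists v, (mi_order a <= m)%N -> weak_deriv a u v.
  move=> a; have [/uw[v uv]|_] := boolP (mi_order a <= m)%N; first by exists v.
  by exists 0.
exists (fun a => if `[< a = fun=> 0%N >] then u else v a); split.
  by apply: filterS (ball_measure_ae R d) => x _; rewrite asboolT.
move=> a am; case: asboolP => [->|_]; last exact: vP.
split=> // f _; rewrite mpartial0 /mi_order big1// expr0 mul1r.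
exact: eq_Rintegral.
Qed.

Let jet_lin u u' v v' c : u \in H -> u' \in H -> jet m u v -> jet m u' v' ->
  jet m (c *: u + u') (fun a => c *: v a + v' a).
Proof.
move=> /HL u2 /HL u2' [uv vP] [uv' vP']; split.
  apply: filterS2 uv uv' => x ux ux'.
  by rewrite -[LHS]/(c *: u x + u' x) ux ux'.
by move=> a am; apply: weak_deriv_lin => //; [exact: vP|exact: vP'].
Qed.

Let jet_norm_ge0 (v : ('I_d -> nat) -> 'rV[R]_d -> R) : 0 <= jet_norm m v.
Proof. exact: sqrtr_ge0. Qed.

Let jets_lb u : lbound [set jet_norm m v | v in jet m u] 0.
Proof. by move=> _ [v _ <-]. Qed.

Let jets_nonempty u : u \in H -> [set jet_norm m v | v in jet m u] !=set0.
Proof. by move=> /jet_ex[v uv]; exists (jet_norm m v), v. Qed.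

Lemma sobolev_norm_ge0 u : u \in H -> 0 <= N u.
Proof. by move=> /jets_nonempty u0; apply: lb_le_inf. Qed.

Let norm_le u v : jet m u v -> N u <= jet_norm m v.
Proof. by move=> uv; apply: ge_inf; [exists 0|exists v]. Qed.

Lemma sobolev_normD u u' : u \in H -> u' \in H -> N (u + u') <= N u + N u'.
Proof.
move=> uH uH'; rewrite -lerBlDr; apply: lb_le_inf; first exact: jets_nonempty.
move=> _ [v uv <-]; rewrite lerBlDr -lerBlDl.
apply: lb_le_inf; first exact: jets_nonempty.
move=> _ [v' uv' <-]; rewrite lerBlDl.
have := jet_lin 1 uH uH' uv uv'; rewrite scale1r => /norm_le/le_trans; apply.
apply: le_trans (l2_minkowski _ (fun=> l2norm_ge0 _) (fun=> l2norm_ge0 _)).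
rewrite ler_sqrt ?sumr_ge0//; last by move=> i _; exact: sqr_ge0.
apply: ler_sum => a am; rewrite ler_pXn2r ?nnegrE ?addr_ge0 ?l2norm_ge0//.
rewrite scale1r; apply: l2normD; first by have [] := uv.2 _ am.
by have [] := uv'.2 _ am.
Qed.

Let norm0 : N 0 = 0.
Proof.
have j0 : jet m (0 : 'rV[R]_d -> R) (fun=> 0).
  by split=> [|a _]; [exact: filterS (ball_measure_ae R d) => x _|exact: weak_deriv0].
apply/eqP; rewrite eq_le sobolev_norm_ge0 ?andbT; last first.
  by have [] := @Hrad_submod_closed R d m.
apply: (le_trans (norm_le j0)); rewrite /jet_norm big1 ?sqrtr0// => a _.
rewrite (_ : l2norm _ = 0) ?expr0n//.
by have := l2normZ 0 (Lfun0 R d); rewrite scale0r normr0 mul0r.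
Qed.

Let HZ c u : u \in H -> c *: u \in H.
Proof.
move=> uH; have [H0 Hl] := @Hrad_submod_closed R d m.
by rewrite -[c *: u]addr0; apply: Hl.
Qed.

Let normZ_le c u : u \in H -> N (c *: u) <= `|c| * N u.
Proof.
move=> uH; have [->|c0] := eqVneq c 0; first by rewrite scale0r norm0 normr0 mul0r.
have nc : 0 < `|c| by rewrite normr_gt0.
rewrite mulrC -ler_pdivrMr//; apply: lb_le_inf; first exact: jets_nonempty.
move=> _ [v uv <-]; rewrite ler_pdivrMr//.
have H0 : 0 \in H by have [] := @Hrad_submod_closed R d m.
have j0 : jet m (0 : 'rV[R]_d -> R) (fun=> 0).
  by split=> [|a _]; [exact: filterS (ball_measure_ae R d) => x _|exact: weak_deriv0].
have := jet_lin c uH H0 uv j0; rewrite addr0 => /norm_le/le_trans; apply.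
have S0 : 0 <= \sum_(a : {ffun 'I_d -> 'I_m.+1} |
    (mi_order (fun i => a i) <= m)%N) l2norm (v (fun i => a i)) ^+ 2.
  by rewrite sumr_ge0// => i _; exact: sqr_ge0.
rewrite /jet_norm mulrC -[`|c|]sqrtr_sqr -sqrtrM ?sqr_ge0//.
rewrite ler_sqrt; last by apply: mulr_ge0 => //; exact: sqr_ge0.
rewrite mulr_sumr; apply: ler_sum => a am.
by rewrite addr0 l2normZ ?exprMn ?real_normK ?num_real//; have [] := uv.2 _ am.
Qed.

Lemma sobolev_normZ c u : u \in H -> N (c *: u) = `|c| * N u.
Proof.
move=> uH; have [->|c0] := eqVneq c 0; first by rewrite scale0r norm0 normr0 mul0r.
apply/eqP; rewrite eq_le normZ_le//= -ler_pdivlMl ?normr_gt0//.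
rewrite -normfV; apply: le_trans (normZ_le c^-1 (HZ c uH)).
by rewrite scalerA mulVf// scale1r.
Qed.

Lemma sobolev_norm_ae u u' : u \in H -> u' \in H ->
  {ae mu, forall x, u x = u' x} -> N u = N u'.
Proof.
move=> uH uH' uu'; congr inf; apply/seteqP; split => _ [v [uv vP] <-];
  exists v => //; split.
- by apply: filterS2 uv uu' => x -> ->.
- by move=> a am; apply: weak_deriv_ae uu' (vP a am); exact: HL.
- by apply: filterS2 uv uu' => x <- ->.
- move=> a am; apply: weak_deriv_ae (vP a am); [exact: HL|exact: HL|].
  by apply: filterS uu' => x ->.
Qed.

Lemma sobolev_norm_eq0 u : u \in H -> N u = 0 -> {ae mu, forall x, u x = 0}.
Proof.
move=> uH Nu0.
have : l2norm u <= 0.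
  rewrite -Nu0; apply: lb_le_inf; first exact: jets_nonempty.
  move=> _ [v [uv vP] <-].
  have z0 : (mi_order (fun _ : 'I_d => 0%N) <= m)%N by rewrite /mi_order big1.
  have -> : l2norm u = l2norm (v (fun=> 0%N)).
    by apply: l2norm_ae => //; [exact: HL|have [] := vP _ z0].
  rewrite /jet_norm (bigD1 [ffun=> ord0])/=; last first.
    by rewrite /mi_order big1// => i _; rewrite ffunE.
  rewrite -[leLHS]ger0_norm ?l2norm_ge0// -sqrtr_sqr.
  rewrite ler_sqrt; last by rewrite addr_ge0 ?sqr_ge0// sumr_ge0// => i _; exact: sqr_ge0.
  rewrite (_ : (fun i => _) = (fun _ : 'I_d => 0%N)).
    by rewrite lerDl sumr_ge0// => i _; exact: sqr_ge0.
  by apply/funext => i; rewrite ffunE.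
move=> u0; apply: l2norm_eq0; first exact: HL.
by apply/eqP; rewrite eq_le u0 l2norm_ge0.
Qed.

End sobolev_norm.

Section Hrad.
Variables (R : realType) (d m : nat).
Local Notation mu := (ball_measure R d).

HB.instance Definition _ := GRing.isSubmodClosed.Build R _
  (@Hrad_pred R d m) (@Hrad_submod_closed R d m).

Record hrad_fun := HradFun {
  hrad_val :> 'rV[R]_d -> R;
  hrad_valP : hrad_val \in @Hrad_pred R d m }.

HB.instance Definition _ := [isSub for hrad_val].
HB.instance Definition _ := [Choice of hrad_fun by <:].
HB.instance Definition _ := [SubChoice_isSubLmodule of hrad_fun by <:].

Definition ae_zero : {pred hrad_fun} :=
  [pred u : hrad_fun | `[< {ae mu, forall x, u x = 0} >]].

Lemma ae_zero_zmod_closed : zmod_closed ae_zero.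
Proof.
split.
  by apply/asboolP; apply: filterS (ball_measure_ae R d) => x _.
move=> u v /asboolP u0 /asboolP v0; apply/asboolP.
apply: filterS2 u0 v0 => x u0 v0.
by rewrite -[LHS]/(u x - v x) u0 v0 subrr.
Qed.

HB.instance Definition _ := GRing.isZmodClosed.Build _ ae_zero ae_zero_zmod_closed.

(* The elements of H^m_rad of the ball are classes of functions modulo equality
   almost everywhere on the ball. *)
Definition Hrad := Quotient.quot ae_zero.

HB.instance Definition _ := Choice.on Hrad.
HB.instance Definition _ := GRing.Zmodule.on Hrad.

Local Open Scope quotient_scope.

Lemma ae_reprP (u : hrad_fun) : {ae mu, forall x, repr (\pi_Hrad u) x = u x}.
Proof.
have : repr (\pi_Hrad u) - u \in ae_zero.
  by rewrite Quotient.idealrBE reprK.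
move=> /asboolP; apply: filterS => x.
by rewrite -[X in X = 0]/(repr (\pi_Hrad u) x - u x) => /eqP; rewrite subr_eq0 => /eqP.
Qed.

Lemma Hrad_eqP (u v : hrad_fun) :
  {ae mu, forall x, u x = v x} -> \pi_Hrad u = \pi_Hrad v.
Proof.
move=> uv; apply/eqP; rewrite -Quotient.idealrBE; apply/asboolP.
apply: filterS uv => x uv.
by rewrite -[LHS]/(u x - v x) uv subrr.
Qed.

Definition Hrad_scale (c : R) (u : Hrad) : Hrad := \pi_Hrad (c *: repr u).

Lemma Hrad_scale_pi c (u : hrad_fun) :
  Hrad_scale c (\pi_Hrad u) = \pi_Hrad (c *: u).
Proof.
apply: Hrad_eqP; apply: filterS (ae_reprP u) => x e.
by rewrite -[LHS]/(c * repr (\pi_Hrad u) x) e.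
Qed.

Let piD (u v : hrad_fun) : \pi_Hrad (u + v) = \pi_Hrad u + \pi_Hrad v.
Proof. by rewrite !piE. Qed.

Lemma Hrad_pi_ex (u : Hrad) : exists v : hrad_fun, u = \pi_Hrad v.
Proof. by exists (repr u); rewrite reprK. Qed.

Let scalerA' a b u : Hrad_scale a (Hrad_scale b u) = Hrad_scale (a * b) u.
Proof. by have [v ->] := Hrad_pi_ex u; rewrite !Hrad_scale_pi scalerA. Qed.

Let scale1r' : left_id 1 Hrad_scale.
Proof. by move=> u; have [v ->] := Hrad_pi_ex u; rewrite Hrad_scale_pi scale1r. Qed.

Let scalerDr' : right_distributive Hrad_scale +%R.
Proof.
move=> a u v; have [u' ->] := Hrad_pi_ex u; have [v' ->] := Hrad_pi_ex v.
by rewrite -piD !Hrad_scale_pi -piD scalerDr.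
Qed.

Let scalerDl' u : {morph Hrad_scale^~ u : a b / a + b}.
Proof.
move=> a b /=; have [v ->] := Hrad_pi_ex u.
by rewrite !Hrad_scale_pi -piD scalerDl.
Qed.

HB.instance Definition _ := GRing.Zmodule_isLmodule.Build R Hrad
  scalerA' scale1r' scalerDr' scalerDl'.

Definition Hrad_norm (u : Hrad) : R := sobolev_norm m (repr u).

Let norm_pi (u : hrad_fun) : Hrad_norm (\pi_Hrad u) = sobolev_norm m u.
Proof. exact: sobolev_norm_ae (hrad_valP _) (hrad_valP u) (ae_reprP u). Qed.

Let normD u v : Hrad_norm (u + v) <= Hrad_norm u + Hrad_norm v.
Proof.
have [u' ->] := Hrad_pi_ex u; have [v' ->] := Hrad_pi_ex v.
by rewrite -piD !norm_pi; apply: sobolev_normD; exact: hrad_valP.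
Qed.

Let normZ c u : Hrad_norm (c *: u) = `|c| * Hrad_norm u.
Proof.
have [v ->] := Hrad_pi_ex u; rewrite [c *: _]Hrad_scale_pi !norm_pi.
by apply: sobolev_normZ; exact: hrad_valP.
Qed.

Let norm_eq0 u : Hrad_norm u = 0 -> u = 0.
Proof.
move=> u0; rewrite -[u]reprK -[0]reprK; apply: Hrad_eqP.
have h0 := sobolev_norm_eq0 (hrad_valP (repr u)) u0.
have := ae_reprP 0; apply: filterS2 h0 => x -> /=.
rewrite (_ : \pi_Hrad 0 = 0); first by move=> ->.
by rewrite !piE.
Qed.

HB.instance Definition _ := @Lmodule_isNormed.Build R Hrad
  Hrad_norm normD normZ norm_eq0.

Definition Hrad_fun (u : Hrad) : 'rV[R]_d -> R := repr u.

End Hrad.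

Section wave_operator.
Variables (R : realType) (d : nat).
Local Notation mu := (ball_measure R d).
Implicit Types u : 'rV[R]_d -> R.

(* A weak derivative of [u]; it is determined up to null sets when [u] has one. *)
Definition wderiv (a : 'I_d -> nat) u : 'rV[R]_d -> R :=
  xget 0 [set v | weak_deriv a u v].

Definition xi_dot_grad u (xi : 'rV[R]_d) : R :=
  \sum_(i < d) xi ord0 i * wderiv (fun j => (j == i) : nat) u xi.

Definition laplacian u (xi : 'rV[R]_d) : R :=
  \sum_(i < d) wderiv (fun j => (j == i).*2) u xi.

(* The product norm is the maximum of the norms of the two components, which is
   equivalent to the Hilbert sum norm. *)
Definition energy_space : normedModType R :=
  (Hrad R d d.+1./2 * Hrad R d d.-1./2)%type.

(* [phi] is the value at [psi] of the differential expression
   (psi_1, psi_2) |->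
     (psi_2 - xi . grad psi_1 - 2 / (p - 1) psi_1,
      Laplacian psi_1 - xi . grad psi_2 - (p + 1) / (p - 1) psi_2). *)
Definition wave_expression (p : R) (psi phi : energy_space) : Prop :=
  let psi1 := Hrad_fun psi.1 in let psi2 := Hrad_fun psi.2 in
  {ae mu, forall xi, Hrad_fun phi.1 xi =
     psi2 xi - xi_dot_grad psi1 xi - 2 / (p - 1) * psi1 xi} /\
  {ae mu, forall xi, Hrad_fun phi.2 xi =
     laplacian psi1 xi - xi_dot_grad psi2 xi - (p + 1) / (p - 1) * psi2 xi}.

End wave_operator.

Section semigroups.
Variables (R : realType) (E : normedModType R).

Definition linear_operator (D : set E) (L : E -> E) : Prop :=
  D 0 /\ forall c x y, D x -> D y ->
    D (c *: x + y) /\ L (c *: x + y) = c *: L x + L y.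

Definition op_graph (D : set E) (L : E -> E) : set (E * E) :=
  [set z | D z.1 /\ z.2 = L z.1].

(* The closure of the graph is again the graph of an operator. *)
Definition closable (G : set (E * E)) : Prop := forall x y y',
  closure G (x, y) -> closure G (x, y') -> y = y'.

Definition bounded_operator (T : E -> E) : Prop :=
  linear T /\ exists M : R, forall x, `|T x| <= M * `|x|.

(* Only the values of [S] at nonnegative times matter. *)
Definition C0_semigroup (S : R -> E -> E) : Prop :=
  [/\ forall t, 0 <= t -> bounded_operator (S t),
      S 0 = id,
      forall s t, 0 <= s -> 0 <= t -> S (s + t) = S s \o S t &
      forall x, S t x @[t --> 0^'+] --> x].

(* The graph of the infinitesimal generator. *)
Definition generator (S : R -> E -> E) : set (E * E) :=
  [set z | t^-1 *: (S t z.1 - z.1) @[t --> 0^'+] --> z.2].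

End semigroups.

(* Main.v *)
Require Import Defs.
From HB Require Import structures.
From mathcomp Require Import all_boot all_order all_algebra.
From mathcomp Require Import all_classical all_reals all_analysis.
From mathcomp Require Import measurable_realfun zify ring lra.
Set Implicit Arguments.
Unset Strict Implicit.
Unset Printing Implicit Defensive.
Import Order.TTheory GRing.Theory Num.Theory.
Import numFieldNormedType.Exports.
Local Open Scope classical_set_scope.
Local Open Scope ring_scope.

(* The operator is diagonalised by polynomials. With c = 2 / (p - 1), for every n
   there is a pair of radial polynomials which is an eigenvector for the eigenvalue
   - (c + n), and these pairs span all pairs of radial polynomials; this span is the
   domain. On it the flow is explicit, sum_n a_n e_n |-> sum_n a_n e^(- (c + n) t) e_n,
   and the closure of the graph of this flow is a C_0-semigroup as soon as the space
   is complete, the span is dense and the flow is exponentially bounded; the closure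
   of the operator is then its generator.

   The bound is an energy estimate. A derivative of order j turns the operator with
   parameter c into the one with parameter c + j, and for each of these
   |grad f|^2 + g^2 is dissipated up to lower order terms: its time derivative is a
   divergence whose flux through the unit sphere is outgoing, which is seen by
   polynomial cut-offs. Summing over the derivatives of order at most k gives a norm
   equivalent to that of H^(k+1) x H^k.

   Density: for u in H^m_rad and l < 1, integrate u against a mollifier of radius
   1 - l centred at l x, which is a test function, so that derivatives in x fall on u;
   then replace the mollifier by Q(|y - l x|^2) with Q a polynomial close to its
   profile in C^m. The result is a polynomial in x, and it is radial because the
   Lebesgue measure and u are invariant under rotations. *)

(** * Semigroups generated by diagonal operators *)

(** The eigenvectors come from the free wave equation. The operator is that equation in the
    coordinates tau = - log (T - t), xi = x / (T - t), with the amplitude (T - t)^(-c) taken off; a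
    factor e^(- (c + n) tau) then means that the solution is homogeneous of degree n in (T - t, x),
    so that the eigenpairs are the radial homogeneous polynomial solutions. They also replace the
    resolvent equation, whose ordinary differential equation is singular on the sphere: on the span,
    mu - L_0 is inverted by dividing the n-th coefficient by mu + c + n, hence has dense range. What
    they do not provide is a bound on combinations of arbitrary length, since nothing makes them
    orthogonal; this is the role of the energy. The estimate is needed for polynomials only, where
    integration by parts rests on Fubini and the fundamental theorem of calculus. Oddness of d makes
    the Sobolev exponents the integers k + 1 and k, so that whole derivatives are summed; the bound
    on p enters through c >= 0, which puts the zero order terms of all the differentiated systems on
    the right side. *)

Lemma cvg_near_eq (T : Type) (U : topologicalType) (F : set_system T)
    (FF : Filter F) (f g : T -> U) (l : U) :
  (\forall x \near F, f x = g x) -> f @ F --> l -> g @ F --> l.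
Proof. by move=> fg; apply: cvg_trans; exact: near_eq_cvg. Qed.

Lemma telescope_step (V : zmodType) (A a x s h z : V) :
  A - x - (s + h) = (a - x - s) + ((A - a - z) + (z - h)).
Proof.
rewrite subrKA [RHS]addrC [A - a - h]addrAC -[a - x - s]addrA subrKA.
by rewrite [s + h]addrC opprD addrACA.
Qed.

Lemma telescope_shift (V : zmodType) (A a x p s : V) :
  A - x - s = (a - p - s) + (A - a - (x - p)).
Proof.
by rewrite opprB [RHS]addrACA [a - p + _]addrC subrKA [- s + _]addrC addrA subrKA.
Qed.

Section diagonal_semigroup.
Variables (R : realType) (E : normedModType R) (e : nat -> E) (lam : nat -> R).
Variables (M w : R).

(** A polynomial is here a finitely supported sequence of coefficients, with ['X^i] standing for
    [e i]. Several [p] may give the same vector. *)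
Definition lincomb (p : {poly R}) : E := \sum_(i < size p) p`_i *: e i.

Definition coef_mul (f : nat -> R) (p : {poly R}) : {poly R} :=
  \poly_(i < size p) (f i * p`_i).

Lemma coef_coef_mul f p i : (coef_mul f p)`_i = f i * p`_i.
Proof.
rewrite coef_poly; case: ltnP => // h.
by rewrite nth_default// mulr0.
Qed.

Lemma lincomb_widen (p : {poly R}) N : (size p <= N)%N -> lincomb p = \sum_(i < N) p`_i *: e i.
Proof.
move=> pN; rewrite /lincomb (big_ord_widen _ (fun i => p`_i *: e i) pN).
rewrite big_mkcond; apply: eq_bigr => i _; case: ltnP => // h.
by rewrite nth_default// scale0r.
Qed.

Lemma lincombP a p q : lincomb (a *: p + q) = a *: lincomb p + lincomb q.
Proof.
set N := maxn (size (a *: p + q)) (maxn (size p) (size q)).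
rewrite !(@lincomb_widen _ N) ?leq_max ?leqnn ?orbT//.
rewrite scaler_sumr -big_split; apply: eq_bigr => i _ /=.
by rewrite coefD coefZ scalerDl scalerA.
Qed.

Lemma lincomb0 : lincomb 0 = 0.
Proof. by rewrite /lincomb size_poly0 big_ord0. Qed.

Lemma lincombB p q : lincomb (p - q) = lincomb p - lincomb q.
Proof. by rewrite addrC -scaleN1r lincombP scaleN1r addrC. Qed.

Lemma coef_mulP f a p q :
  coef_mul f (a *: p + q) = a *: coef_mul f p + coef_mul f q.
Proof.
apply/polyP => i; rewrite coefD coefZ !coef_coef_mul coefD coefZ.
by rewrite mulrDr mulrCA.
Qed.

Lemma coef_mulB f p q : coef_mul f (p - q) = coef_mul f p - coef_mul f q.
Proof. by rewrite addrC -scaleN1r coef_mulP scaleN1r addrC. Qed.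

Lemma coef_mulA f g p : coef_mul f (coef_mul g p) = coef_mul (fun i => f i * g i) p.
Proof. by apply/polyP => i; rewrite !coef_coef_mul mulrA. Qed.

Definition evol t (p : {poly R}) := coef_mul (fun i => expR (lam i * t)) p.

Lemma evolD s t p : evol (s + t) p = evol s (evol t p).
Proof.
rewrite /evol coef_mulA; congr coef_mul; apply/funext => i.
by rewrite -expRD mulrDr.
Qed.

Lemma evol0 p : evol 0 p = p.
Proof. by apply/polyP => i; rewrite coef_coef_mul mulr0 expR0 mul1r. Qed.

Hypothesis complete : forall u : nat -> E,
  (forall eps : R, 0 < eps -> exists N, forall m n, (N <= m)%N -> (N <= n)%N ->
     `|u m - u n| <= eps) -> exists l : E, u @ \oo --> l.
Hypothesis evol_bound : forall (t : R) p, 0 <= t ->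
  `|lincomb (evol t p)| <= M * expR (w * t) * `|lincomb p|.
Hypothesis lincomb_dense : forall x (eps : R), 0 < eps -> exists p, `|x - lincomb p| < eps.
Hypothesis M_ge1 : 1 <= M.
Hypothesis w_ge0 : 0 <= w.
Hypothesis lam_le : forall n, lam n <= w.

Let M_gt0 : 0 < M. Proof. exact: lt_le_trans M_ge1. Qed.

(** A relation, so that nothing has to be known beforehand about equal combinations having equal
    images: [flow_bound], applied to a difference, makes it single-valued. *)
Definition flow (t : R) x y := forall eps : R, 0 < eps -> exists p,
  `|x - lincomb p| < eps /\ `|y - lincomb (evol t p)| < eps.

Let K (t : R) := M * expR (w * t).

Let K_gt0 t : 0 < K t. Proof. by rewrite mulr_gt0 ?expR_gt0. Qed.

Lemma flow_bound (t : R) x y : 0 <= t -> flow t x y -> `|y| <= K t * `|x|.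
Proof.
move=> t0 xy; apply/ler_addgt0Pr => d d0.
have K1 : 0 < K t + 1 by rewrite ltr_wpDr.
have eps0 : 0 < d / (K t + 1) by rewrite divr_gt0.
have dE : d = (K t + 1) * (d / (K t + 1)) by rewrite mulrC divfK// gt_eqF.
move: (d / _) eps0 dE => h h0 -> {d d0}.
have [p [xp yp]] := xy _ h0.
have pb : `|lincomb p| <= `|x| + h.
  by rewrite -[lincomb p](subrKC x) (le_trans (ler_normD _ _))// lerD2l distrC ltW.
have := evol_bound p t0; rewrite -/(K t) => eb.
have : `|y| <= `|y - lincomb (evol t p)| + `|lincomb (evol t p)|.
  by rewrite -{1}[y](subrK (lincomb (evol t p))) ler_normD.
have : K t * `|lincomb p| <= K t * (`|x| + h) by rewrite ler_wpM2l// ltW.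
nra.
Qed.

Lemma flow_lin (t : R) a x y x' y' : flow t x y -> flow t x' y' ->
  flow t (a *: x + x') (a *: y + y').
Proof.
move=> xy xy' eps eps0.
have a0 : 0 < `|a| + 1 by rewrite ltr_wpDl.
have h0 : 0 < eps / (`|a| + 1) by rewrite divr_gt0.
have hE : eps = (`|a| + 1) * (eps / (`|a| + 1)) by rewrite mulrC divfK// gt_eqF.
move: (eps / _) h0 hE => h h0 -> {eps eps0}.
have [p [xp yp]] := xy _ h0; have [q [xq yq]] := xy' _ h0.
have aux (u v u' v' : E) : `|u - v| < h -> `|u' - v'| < h ->
    `|(a *: u + u') - (a *: v + v')| < (`|a| + 1) * h.
  move=> uv uv'; rewrite opprD addrACA -scalerBr.
  apply: (le_lt_trans (ler_normD _ _)); rewrite normrZ mulrDl mul1r.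
  by apply: ler_ltD => //; rewrite ler_wpM2l// ltW.
exists (a *: p + q); rewrite /evol coef_mulP !lincombP; split; exact: aux.
Qed.

Lemma flow_uniq (t : R) x y y' : 0 <= t -> flow t x y -> flow t x y' -> y = y'.
Proof.
move=> t0 xy xy'.
have := flow_bound t0 (flow_lin (-1) xy xy').
rewrite !scaleN1r addNr normr0 mulr0 normr_le0 addrC subr_eq0 => /eqP.
by move=> ->.
Qed.

Lemma flow_ex (t : R) x : 0 <= t -> exists y, flow t x y.
Proof.
move=> t0.
have /choice[p xp] : forall n : nat, exists p, `|x - lincomb p| < n.+1%:R^-1.
  by move=> n; apply: lincomb_dense.
have K0 := K_gt0 t.
have pE m n : `|lincomb (evol t (p m)) - lincomb (evol t (p n))| <=
    K t * (m.+1%:R^-1 + n.+1%:R^-1).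
  rewrite -lincombB /evol -coef_mulB; apply: (le_trans (evol_bound _ t0)).
  rewrite -/(K t) ler_wpM2l ?(ltW K0)// lincombB.
  rewrite -[lincomb (p m)](subrK x) -addrA (le_trans (ler_normD _ _))//.
  by rewrite lerD// ltW// distrC.
have inv_small (d : R) : 0 < d -> exists N, forall n, (N <= n)%N -> n.+1%:R^-1 <= d :> R.
  move=> d0; have [N _ hN] := near_infty_natSinv_lt (PosNum d0).
  by exists N => n Nn; apply/ltW/hN.
have [|y uy] := complete (u := fun n => lincomb (evol t (p n))).
  move=> eps eps0; have h0 : 0 < eps / (2 * K t) by rewrite divr_gt0// mulr_gt0.
  have [N hN] := inv_small _ h0; exists N => m n Nm Nn.
  apply: (le_trans (pE m n)).
  have -> : eps = K t * (eps / (2 * K t) + eps / (2 * K t)) by field; rewrite gt_eqF.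
  by rewrite ler_wpM2l ?(ltW K0)// lerD// hN.
exists y => eps eps0.
move/cvgrPdist_lt : uy => /(_ _ eps0)[N' _ hN'].
have [N2 hN2] := inv_small _ eps0.
exists (p (maxn N' N2)); split; last by apply: hN'; rewrite /= leq_maxl.
by apply: (lt_le_trans (xp _)); exact: hN2 (leq_maxr _ _).
Qed.

Definition semigroup (t : R) x := xget 0 (flow t x).
Local Notation S := semigroup.

Lemma semigroup_flow (t : R) x : 0 <= t -> flow t x (S t x).
Proof. by move=> t0; exact: (xgetPex 0 (flow_ex x t0)). Qed.

Lemma semigroupE (t : R) x y : 0 <= t -> flow t x y -> S t x = y.
Proof. by move=> t0; apply: flow_uniq => //; exact: semigroup_flow. Qed.

Lemma semigroup_lin (t : R) a x y : 0 <= t -> S t (a *: x + y) = a *: S t x + S t y.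
Proof. by move=> t0; apply: semigroupE => //; apply: flow_lin; exact: semigroup_flow. Qed.

Lemma semigroupB (t : R) x y : 0 <= t -> S t (x - y) = S t x - S t y.
Proof. by move=> t0; rewrite addrC -scaleN1r semigroup_lin// scaleN1r addrC. Qed.

Lemma semigroup_bound (t : R) x : 0 <= t -> `|S t x| <= K t * `|x|.
Proof. by move=> t0; apply: flow_bound => //; exact: semigroup_flow. Qed.

Lemma semigroup_lincomb (t : R) p : 0 <= t -> S t (lincomb p) = lincomb (evol t p).
Proof.
by move=> t0; apply: semigroupE => // eps eps0; exists p; rewrite !subrr normr0.
Qed.

Lemma semigroup0 x : S 0 x = x.
Proof.
apply: semigroupE => // eps eps0; have [p xp] := lincomb_dense x eps0.
by exists p; rewrite evol0.
Qed.

Lemma semigroupD (s t : R) x : 0 <= s -> 0 <= t -> S (s + t) x = S s (S t x).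
Proof.
move=> s0 t0; apply: semigroupE; first exact: addr_ge0.
move=> eps eps0; have K0 := K_gt0 s.
have h0 : 0 < eps / (K s + 1) by rewrite divr_gt0// ltr_wpDr.
have [p [xp yp]] := semigroup_flow x t0 h0.
exists p; split.
  apply: (lt_le_trans xp); rewrite ler_pdivrMr ?ltr_wpDr//.
  by rewrite ler_peMr ?(ltW eps0)// lerDr ltW.
rewrite evolD -semigroup_lincomb// -semigroupB//.
apply: (le_lt_trans (semigroup_bound _ s0)).
apply: (@le_lt_trans _ _ (K s * (eps / (K s + 1)))).
  by rewrite ler_wpM2l ?ltW.
by rewrite mulrA ltr_pdivrMr ?ltr_wpDr// mulrC ltr_pM2l// ltrDl.
Qed.

Let evol_cvg (f : R -> nat -> R) (g : nat -> R) (F : set_system R) {FF : Filter F} p :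
  (forall i, f t i @[t --> F] --> g i) ->
  lincomb (coef_mul (f t) p) @[t --> F] --> lincomb (coef_mul g p).
Proof.
move=> fg; have lE h : lincomb (coef_mul h p) = \sum_(i < size p) (h i * p`_i) *: e i.
  rewrite (@lincomb_widen _ (size p)) ?size_poly//.
  by apply: eq_bigr => i _; rewrite coef_coef_mul.
rewrite lE; under eq_fun do rewrite lE.
by apply: cvg_big => [|i _]; [exact: add_continuous|apply: cvgZr_tmp; apply: cvgMr_tmp; exact: fg].
Qed.

Lemma semigroup_cvg x : S t x @[t --> 0^'+] --> x.
Proof.
apply/cvgrPdist_le => /= eps eps0; have K1 := K_gt0 1.
have h0 : 0 < eps / (K 1 + 2) by rewrite divr_gt0// addr_gt0.
have hE : eps = (K 1 + 2) * (eps / (K 1 + 2)).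
  by rewrite mulrC divfK// gt_eqF// addr_gt0.
move: (eps / _) h0 hE => h h0 -> {eps eps0}.
have [p xp] := lincomb_dense x h0.
have /cvgrPdist_lt/(_ _ h0) near_p :
    lincomb (evol t p) @[t --> 0^'+] --> lincomb p.
  rewrite -[in X in _ --> X](evol0 p); apply: evol_cvg => i.
  apply: cvg_at_right_filter; rewrite mulr0.
  have cf : {for 0, continuous (fun t : R => expR (lam i * t))}.
    apply: (@continuous_comp _ _ _ (fun t => lam i * t) expR).
      exact: mulrl_continuous.
    exact: continuous_expR.
  by move: cf; rewrite /prop_for /continuous_at mulr0.
near=> t.
have t0 : 0 <= t by [].
have -> : x - S t x = (x - lincomb p) + (lincomb p - lincomb (evol t p))
    - S t (x - lincomb p).
  by rewrite semigroupB// semigroup_lincomb// addrA subrK opprB addrA subrK.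
apply: (le_trans (ler_normB _ _)).
have h1 : `|(x - lincomb p) + (lincomb p - lincomb (evol t p))| <= h + h.
  by apply: (le_trans (ler_normD _ _)); apply: lerD; apply/ltW => //; near: t.
have h2 : `|S t (x - lincomb p)| <= K 1 * h.
  apply: (le_trans (semigroup_bound _ t0)); apply: ler_pM => //.
  - exact/ltW/K_gt0.
  - rewrite /K ler_wpM2l ?(ltW M_gt0)// ler_expR ler_wpM2l//.
    by near: t; exact: nbhs_right_le.
  - exact: ltW.
by rewrite mulrDl addrC [2 * h]mulr_natl; exact: lerD.
Unshelve. all: by end_near. Qed.

(** A discrete form of [T t x - x = \int_0^t T s z ds], which spares the integration of
    vector-valued functions: [0, t] is cut into k steps of length h, and each step contributes
    [T (j h) (T h x - x)], which is [h T (j h) z] up to [h * C * eps]. [T] is a parameter because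
    [generator_shift_bound] uses a rescaled semigroup. *)
Lemma telescope_bound (T : R -> E -> E) (C B t : R) (x z v : E) :
  0 < t -> 0 <= C ->
  (forall s : R, 0 <= s -> s <= t -> forall y, `|T s y| <= C * `|y|) ->
  (forall (s : R) y y', 0 <= s -> T s (y - y') = T s y - T s y') ->
  (forall (r s : R) y, 0 <= r -> 0 <= s -> T (r + s) y = T r (T s y)) ->
  (forall (s : R) c y, 0 <= s -> T s (c *: y) = c *: T s y) -> T 0 x = x ->
  h^-1 *: (T h x - x) @[h --> 0^'+] --> z ->
  (forall s : R, 0 <= s -> s <= t -> `|T s z - v| <= B) ->
  `|T t x - x - t *: v| <= t * B.
Proof.
move=> t0 C0 Tb TB TD TZ T0 xz zv.
apply/ler_addgt0Pr => d d0.
have eps0 : 0 < d / (t * (C + 1)) by rewrite divr_gt0// mulr_gt0// ltr_wpDl.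
set eps := d / _ in eps0.
have [k [h0 [k0 [hk hz]]]] : exists k : nat, 0 < t / k%:R :> R /\ (0 < k%:R :> R) /\
   t = t / k%:R * k%:R /\ `|(t / k%:R)^-1 *: (T (t / k%:R) x - x) - z| <= eps.
  move/cvgrPdist_le : xz => /(_ _ eps0) [/= r r0 hr].
  have [N _ hN] := near_infty_natSinv_lt (PosNum (divr_gt0 r0 t0)).
  have h0 : 0 < t / N.+1%:R by rewrite divr_gt0.
  exists N.+1; split => //; split => //; split; first by rewrite divfK.
  rewrite distrC; apply: hr => //=; rewrite sub0r normrN gtr0_norm//.
  by rewrite mulrC -ltr_pdivlMr//; apply: hN => /=.
move: h0 hk hz; set h := t / _ => h0 hk hz.
have step : `|T h x - x - h *: z| <= h * eps.
  have -> : T h x - x - h *: z = h *: (h^-1 *: (T h x - x) - z).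
    by rewrite scalerBr scalerA divff ?scale1r ?gt_eqF.
  by rewrite normrZ gtr0_norm// ler_pM2l.
have ind j : (j <= k)%N ->
    `|T (j%:R * h) x - x - (j%:R * h) *: v| <= j%:R * h * (C * eps + B).
  elim: j => [_|j IH jk]; first by rewrite !mul0r T0 scale0r !subrr normr0.
  have jh : 0 <= j%:R * h by rewrite mulr_ge0// ltW.
  have jht : j%:R * h <= t.
    by rewrite hk mulrC ler_pM2l// ler_nat ltnW.
  have -> : T (j.+1%:R * h) x - x - (j.+1%:R * h) *: v =
      (T (j%:R * h) x - x - (j%:R * h) *: v) +
      (T (j%:R * h) (T h x - x - h *: z) + h *: (T (j%:R * h) z - v)).
    rewrite !TB// TZ// -addn1 natrD mulrDl mul1r TD// ?(ltW h0)//.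
    rewrite scalerBr scalerDl.
    exact: telescope_step.
  apply: (le_trans (ler_normD _ _)); rewrite -addn1 natrD !mulrDl !mul1r.
  apply: lerD; first exact: IH (ltnW jk).
  apply: (le_trans (ler_normD _ _)); rewrite mulrDr lerD//.
    apply: (le_trans (Tb _ jh jht _)); rewrite mulrCA.
    by rewrite ler_wpM2l.
  by rewrite normrZ gtr0_norm// ler_pM2l// zv.
have := ind k (leqnn _); rewrite mulrC -hk => /le_trans; apply.
rewrite mulrDr addrC lerD2l.
have -> : d = t * ((C + 1) * eps).
  by rewrite /eps; field; rewrite !gt_eqF//= ltr_wpDl.
rewrite ler_pM2l// ler_wpM2r// ?(ltW eps0)//.
by rewrite lerDl.
Qed.

Local Notation G := (generator S).

Lemma generator_lin a x y x' y' : G (x, y) -> G (x', y') ->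
  G (a *: x + x', a *: y + y').
Proof.
move=> xy xy'; rewrite /generator /=.
apply: cvg_near_eq (cvgD (cvgZl_tmp (k := a) xy) xy').
near=> t; have t0 : 0 <= t by [].
rewrite -[LHS]/(a *: (t^-1 *: (S t x - x)) + t^-1 *: (S t x' - x')).
rewrite semigroup_lin// scalerA mulrC -scalerA -scalerDr; congr (_ *: _).
by rewrite scalerBr addrACA -opprD.
Unshelve. all: by end_near. Qed.

Lemma generator_uniq x y y' : G (x, y) -> G (x, y') -> y = y'.
Proof. by move=> /cvg_lim + /cvg_lim => /= <-// <-. Qed.

Let expRM_quot (a : R) : h^-1 * (expR (a * h) - 1) @[h --> 0^'+] --> a.
Proof.
have : is_derive (0 : R) 1 (fun h => expR (a * h)) a.
  apply: is_derive_eq.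
  by rewrite mulr0 expR0 mul1r [a%:A]mulr1.
case => /cvg_ex[l Dl] aE.
have la : l = a by rewrite -aE; apply/esym/cvg_lim.
move: Dl; rewrite {}la => /cvg_dnbhs_at_right; apply: cvg_near_eq; near=> t.
by rewrite /= mulr0 expR0 addr0 [t *: 1]mulr1.
Unshelve. all: by end_near. Qed.

Lemma generator_lincomb p : G (lincomb p, lincomb (coef_mul lam p)).
Proof.
rewrite /generator/=.
apply: (@cvg_near_eq _ _ _ _
    (fun t => lincomb (coef_mul (fun i => t^-1 * (expR (lam i * t) - 1)) p))); last first.
  by apply: evol_cvg => i; exact: expRM_quot.
near=> t; have t0 : 0 <= t by [].
rewrite semigroup_lincomb// -lincombB -[RHS]addr0 -lincomb0 -lincombP addr0.
congr lincomb; apply/polyP => i.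
rewrite coefZ coefB !coef_coef_mul; ring.
Unshelve. all: by end_near. Qed.

Definition diag_op x : E :=
  lincomb (coef_mul lam (xget 0 [set p | lincomb p = x])).

(** The preimage picked by [xget] does not matter: by [generator_lincomb] both values are the
    derivative at 0 of the same orbit. *)
Lemma diag_opE p : diag_op (lincomb p) = lincomb (coef_mul lam p).
Proof.
have /(xgetPex 0) /= qp : exists q, lincomb q = lincomb p by exists p.
rewrite /diag_op; set q := xget _ _ in qp *.
by have := @generator_lincomb q; rewrite qp => /generator_uniq; apply; exact: generator_lincomb.
Qed.

Local Notation L0 := (op_graph (range lincomb) diag_op).

Lemma closure_op_graphP x y : closure L0 (x, y) <->
  forall eps : R, 0 < eps -> exists p,
    `|x - lincomb p| < eps /\ `|y - lincomb (coef_mul lam p)| < eps.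
Proof.
split=> [xy eps eps0|xy].
  have [|[u v] [[/= [p _ pu] ->] [/= xu yv]]] := xy (ball (x, y) eps).
    exact: nbhsx_ballx.
  exists p; rewrite -diag_opE pu.
  by move: xu yv; rewrite -!ball_normE.
move=> B /nbhs_ballP[/= eps eps0 epsB].
have [p [xp yp]] := xy _ eps0.
exists (lincomb p, diag_op (lincomb p)); split.
  by split => //=; exists p.
by apply: epsB; split; rewrite /= -ball_normE//= diag_opE.
Qed.

(** The approximating [p] is chosen after [t], so that its error is negligible against [t * eps],
    while [telescope_bound] handles the increment of the orbit of [lincomb p]. *)
Lemma closure_sub_generator : closure L0 `<=` G.
Proof.
move=> [x y] /closure_op_graphP xy; rewrite /generator/=.
apply/cvgrPdist_le => /= eps eps0; have K1 := K_gt0 1.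
have /cvgrPdist_le/(_ _ eps0)[r /= r0 hr] := @semigroup_cvg y.
near=> t.
have t0 : 0 < t by [].
have t1 : t <= 1 by near: t; exact: nbhs_right_le.
have tr : t < r by near: t; exact: nbhs_right_lt.
suff : `|S t x - x - t *: y| <= t * eps.
  have -> : S t x - x - t *: y = t *: (t^-1 *: (S t x - x) - y).
    by rewrite scalerBr scalerA divff ?gt_eqF// scale1r.
  by rewrite distrC normrZ gtr0_norm// ler_pM2l.
have KK s : 0 <= s -> s <= t -> K s <= K 1.
  move=> s0 st; rewrite /K ler_pM2l// ler_expR ler_wpM2l//.
  exact: le_trans st t1.
apply/ler_addgt0Pr => d d0.
have D0 : 0 < t * K 1 + (K 1 + 1) by rewrite !addr_gt0// mulr_gt0.
have h0 : 0 < d / (t * K 1 + (K 1 + 1)) by rewrite divr_gt0.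
have hE : d = (t * K 1 + (K 1 + 1)) * (d / (t * K 1 + (K 1 + 1))).
  by rewrite mulrC divfK// gt_eqF.
move: (d / _) h0 hE => h h0 -> {d d0}.
have [p [xp yp]] := xy _ h0.
set z := lincomb (coef_mul lam p) in yp.
have tele : `|S t (lincomb p) - lincomb p - t *: y| <= t * (eps + K 1 * h).
  apply: (@telescope_bound S (K 1) _ t (lincomb p) z y) => //.
  - exact: ltW.
  - move=> s s0 st v; apply: (le_trans (semigroup_bound _ s0)).
    by rewrite ler_wpM2r// KK.
  - by move=> s u v s0; rewrite semigroupB.
  - by move=> s r' u s0 r'0; rewrite semigroupD.
  - move=> s c u s0; have := semigroup_lin c u 0 s0; rewrite addr0 => ->.
    by rewrite -[0](subrr 0) semigroupB// subrr addr0.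
  - exact: semigroup0.
  - exact: generator_lincomb.
  - move=> s s0 st; rewrite -[S s z](subrK (S s y)) -addrA addrC.
    apply: (le_trans (ler_normD _ _)); apply: lerD.
      have [->|sn0] := eqVneq s 0; first by rewrite semigroup0 subrr normr0 ltW.
      rewrite distrC; apply: hr => /=; last by rewrite lt_neqAle eq_sym sn0.
      by rewrite sub0r normrN ger0_norm// (le_lt_trans st).
    rewrite -semigroupB//; apply: (le_trans (semigroup_bound _ s0)).
    by apply: ler_pM => //; [exact/ltW/K_gt0|exact: KK|rewrite distrC ltW].
have -> : S t x - x - t *: y = (S t (lincomb p) - lincomb p - t *: y) +
    (S t (x - lincomb p) - (x - lincomb p)).
  rewrite semigroupB ?ltW//.
  exact: telescope_shift.
apply: (le_trans (ler_normD _ _)).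
have h2 : `|S t (x - lincomb p) - (x - lincomb p)| <= (K 1 + 1) * h.
  rewrite mulrDl mul1r; apply: (le_trans (ler_normB _ _)); apply: lerD; last exact: ltW.
  apply: (le_trans (semigroup_bound _ (ltW t0))).
  by apply: ler_pM => //; [exact/ltW/K_gt0|exact: KK (ltW t0) _|exact: ltW].
apply: (le_trans (lerD tele h2)).
by rewrite le_eqVlt; apply/orP; left; apply/eqP; ring.
Unshelve. all: by end_near. Qed.

(** The rescaled semigroup [T s = e^(- (w + 1) s) S s] has norm at most [M e^(- s)] and generator
    [G - (w + 1)]. At a time [t] where that norm is at most 1/2, [|x| <= 2 |T t x - x|], and the
    increment is at most [t M |y - (w + 1) x|]. *)
Lemma generator_shift_bound : exists C : R, 0 < C /\
  forall x y, G (x, y) -> `|x| <= C * `|(w + 1) *: x - y|.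
Proof.
set mu := w + 1.
have [t t0 Mt] : exists2 t : R, 0 < t & M * expR (- t) <= 2^-1.
  (* [e^(2 M) >= 1 + 2 M], hence [M e^(- 2 M) <= 1/2]. *)
  exists (2 * M); first by rewrite mulr_gt0.
  rewrite expRN ler_pdivrMr ?expR_gt0// mulrC ler_pdivlMr//.
  rewrite mulrC; apply: le_trans (expR_ge1Dx _).
  by rewrite lerDr.
exists (2 * (t * M)); split; first by rewrite !mulr_gt0.
move=> x y xy.
pose T s x := expR (- (mu * s)) *: S s x.
have Tb s u : 0 <= s -> `|T s u| <= M * expR (- s) * `|u|.
  move=> s0; rewrite /T normrZ gtr0_norm ?expR_gt0//.
  apply: le_trans (ler_wpM2l (expR_ge0 _) (semigroup_bound _ s0)) _.
  rewrite mulrA ler_wpM2r// /K mulrCA -expRD ler_wpM2l ?(ltW M_gt0)//.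
  by rewrite /mu mulrDl mul1r opprD addrAC addNr add0r.
have tele : `|T t x - x - t *: 0| <= t * (M * `|y - mu *: x|).
  apply: (@telescope_bound T M _ t x (y - mu *: x) 0) => //.
  - exact: ltW.
  - move=> s s0 st u; apply: (le_trans (Tb _ _ s0)); rewrite ler_wpM2r//.
    by rewrite ler_piMr ?(ltW M_gt0)// -expR0 ler_expR oppr_le0.
  - by move=> s u v s0; rewrite /T semigroupB// scalerBr.
  - move=> r s u r0 s0; rewrite /T semigroupD//.
    have := semigroup_lin (expR (- (mu * s))) (S s u) 0 r0.
    rewrite !addr0 => ->.
    rewrite -[in S r 0](subrr 0) semigroupB// subrr addr0 scalerA -expRD.
    by rewrite mulrDr opprD.
  - move=> s c u s0; have := semigroup_lin c u 0 s0; rewrite addr0 /T => ->.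
    by rewrite -[0](subrr 0) semigroupB// subrr addr0 !scalerA mulrC.
  - by rewrite /T mulr0 oppr0 expR0 scale1r semigroup0.
  - have c1 : expR (- (mu * h)) @[h --> 0^'+] --> (1 : R).
      have : {for 0, continuous (fun h : R => expR (- mu * h))}.
        apply: (@continuous_comp _ _ _ (fun t => - mu * t) expR).
          exact: mulrl_continuous.
        exact: continuous_expR.
      rewrite /prop_for /continuous_at mulr0 expR0 => /cvg_at_right_filter.
      by under eq_fun do rewrite mulNr.
    have -> : y - mu *: x = 1 *: y + (- mu) *: x by rewrite scale1r scaleNr.
    apply: cvg_near_eq (cvgD (cvgZ c1 xy) (cvgZr_tmp (a := x) (@expRM_quot (- mu)))).
    near=> h.
    rewrite -[LHS]/(expR (- (mu * h)) *: (h^-1 *: (S h x - x)) +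
      (h^-1 * (expR (- mu * h) - 1)) *: x).
    rewrite /T scalerA mulrC -!scalerA -scalerDr; congr (_ *: _).
    by rewrite scalerBr mulNr scalerBl scale1r addrA subrK.
  - move=> s s0 st; rewrite subr0; apply: (le_trans (Tb _ _ s0)).
    rewrite ler_wpM2r// ler_piMr ?(ltW M_gt0)// -expR0 ler_expR oppr_le0//.
rewrite scaler0 subr0 in tele.
have := Tb t x (ltW t0).
have : M * expR (- t) * `|x| <= 2^-1 * `|x| by rewrite ler_wpM2r.
have : `|x| <= `|T t x| + `|T t x - x|.
  by rewrite -{1}[x](subKr (T t x)) ler_normB.
rewrite distrC in tele; rewrite [`|_ - x|]distrC; rewrite [`|mu *: x - y|]distrC.
lra.
Unshelve. all: by end_near. Qed.

(** The span is a core. For [mu = w + 1] the operator [mu - L0] maps the span onto itself, since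
    [mu - lam i] is nonzero. So [mu x - y] is approximated by some [lincomb q], [q] is pulled back
    to [p], and the bound on the inverse of [mu - G] controls [x - lincomb p]. *)
Lemma generator_sub_closure : G `<=` closure L0.
Proof.
move=> [x y] xy; apply/closure_op_graphP => eps eps0.
have [C [C0 hC]] := generator_shift_bound.
set mu := w + 1 in hC.
have mu0 : 0 < mu by rewrite ltr_wpDl.
pose h := eps / (mu * C + C + 1).
have D0 : 0 < mu * C + C + 1 by rewrite !addr_gt0 ?mulr_gt0.
have h0 : 0 < h by rewrite divr_gt0.
have hE : eps = (mu * C + C + 1) * h by rewrite /h mulrC divfK// gt_eqF.
have [q zq] := lincomb_dense (mu *: x - y) h0.
pose p := coef_mul (fun i => (mu - lam i)^-1) q.
have mu_lam i : mu - lam i != 0.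
  by rewrite gt_eqF// subr_gt0 (le_lt_trans (lam_le i))// ltrDl.
have qE : lincomb q = mu *: lincomb p - lincomb (coef_mul lam p).
  rewrite -[mu *: _]addr0 -lincomb0 -lincombP -lincombB addr0; congr lincomb.
  apply/polyP => i; rewrite coefB coefZ !coef_coef_mul; field.
  exact: mu_lam.
have xp_gen : G (x - lincomb p, y - lincomb (coef_mul lam p)).
  have := @generator_lin (-1) _ _ _ _ (@generator_lincomb p) xy.
  by rewrite !scaleN1r ![- _ + _]addrC.
have zE : mu *: (x - lincomb p) - (y - lincomb (coef_mul lam p)) =
    mu *: x - y - lincomb q.
  by rewrite qE scalerBr !opprB addrACA [RHS]addrACA [- y + _]addrC.
have xp : `|x - lincomb p| < C * h.
  by apply: (le_lt_trans (hC _ _ xp_gen)); rewrite zE ltr_pM2l.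
exists p; split.
  apply: (lt_le_trans xp); rewrite hE ler_pM2r// -addrA addrCA lerDl.
  by rewrite addr_ge0// mulr_ge0// ltW.
have -> : y - lincomb (coef_mul lam p) =
    mu *: (x - lincomb p) - (mu *: x - y - lincomb q).
  by rewrite -zE subKr.
apply: (le_lt_trans (ler_normB _ _)); rewrite normrZ gtr0_norm//.
have : mu * `|x - lincomb p| < mu * (C * h) by rewrite ltr_pM2l.
have := mulr_gt0 C0 h0; rewrite hE => Ch xmu; lra.
Qed.

Theorem diag_semigroup_generation :
  [/\ linear_operator (range lincomb) diag_op, closable L0, C0_semigroup S &
      generator S = closure L0].
Proof.
have GE : G = closure L0.
  by apply/seteqP; split; [exact: generator_sub_closure|exact: closure_sub_generator].
split => //.
- split; first by exists 0 => //; exact: lincomb0.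
  move=> c _ _ [p _ <-] [q _ <-]; split.
    by exists (c *: p + q) => //; exact: lincombP.
  by rewrite -lincombP !diag_opE coef_mulP lincombP.
- by move=> x y y'; rewrite -GE; exact: generator_uniq.
- split.
  + move=> t t0; split; first by move=> a x y; rewrite semigroup_lin.
    by exists (K t) => x; exact: semigroup_bound.
  + by apply/funext => x; exact: semigroup0.
  + by move=> s t s0 t0; apply/funext => x; exact: semigroupD.
  + exact: semigroup_cvg.
Qed.

End diagonal_semigroup.

(** * Integration on R^n *)

(** A directional derivative only sees the restriction to a line. This moves derivatives between
    R^n, its slices and the real line. *)
Lemma is_derive_along (R : numFieldType) (U V W : normedModType R) (f : U -> W)
    (F : V -> W) (x u : U) (X v : V) (d : W) :
  (forall t, F (t *: v + X) = f (t *: u + x)) -> is_derive X v F d -> is_derive x u f d.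
Proof.
move=> fF; have q0 : F X = f x by have := fF 0; rewrite !scale0r !add0r.
have qE : (fun h => h^-1 *: ((F \o shift X) (h *: v) - F X)) =
    (fun h => h^-1 *: ((f \o shift x) (h *: u) - f x)).
  by apply/funext => h; rewrite q0 /= fF.
by case=> + <-; rewrite /derivable qE => fd; apply: DeriveDef => //; rewrite /derive -qE.
Qed.

Section lebesgue_line.
Variable R : realType.
Local Notation leb := (@lebesgue_measure R).
Local Open Scope ereal_scope.

Let affine (a s : R) : measurableTypeR R -> measurableTypeR R := fun x => (a + s * x)%R.

Let measurable_affine a s : measurable_fun setT (affine a s).
Proof. by apply: measurable_funD => //; exact: measurable_funM. Qed.

Let affine_image a s : {measure set (measurableTypeR R) -> \bar R} :=
  measure_function_pushforward__canonical__measure_function_Measure leb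
    (measurable_affine a s).

Let lebesgue_affine a (s : R) (s0 : (0 <= s)%R) A : (0 < s)%R -> measurable A ->
  mscale (NngNum s0) (affine_image a s) A = leb A.
Proof.
move=> s_gt0 mA; apply/esym.
apply: (@lebesgue_measure_unique _ (mscale (NngNum s0) (affine_image a s))) mA.
move=> _ [[u v]] _ <-.
rewrite -[RHS]/(s%:E * leb (affine a s @^-1` `]u, v])).
rewrite (_ : _ @^-1` _ = `](u - a) / s, (v - a) / s]%classic)%R; last first.
  by apply/seteqP; split => x /=; rewrite /affine !in_itv/=
    ltr_pdivrMr// ler_pdivlMr// mulrC ltrBlDl lerBrDl.
rewrite !lebesgue_measure_itv/= !lte_fin.
rewrite ltr_pM2r ?invr_gt0// ltrD2r; case: ltP => _; last by rewrite mule0.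
by rewrite -!EFinB -EFinM -mulrBl mulrC divfK ?gt_eqF// opprB addrA subrK.
Qed.

Lemma ge0_integral_affine1 (f : R -> \bar R) (a s : R) : (0 < s)%R ->
  measurable_fun [set: measurableTypeR R] f -> (forall x, 0 <= f x) ->
  \int[leb]_x f x = s%:E * \int[leb]_x f (a + s * x)%R.
Proof.
move=> s0 mf f0.
have := @ge0_integral_pushforward _ _ _ _ R (affine a s)
  (measurable_affine a s) leb setT f measurableT mf (fun x _ => f0 x).
rewrite preimage_setT => <-.
rewrite -(@ge0_integral_mscale _ _ _ _ _ measurableT (NngNum (ltW s0)))//.
by apply: eq_measure_integral => A mA _; exact/esym/lebesgue_affine.
Qed.

End lebesgue_line.

Section rV_integration.
Variable R : realType.
Local Notation leb := (@lebesgue_measure R).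
Local Notation lam n := (lebesgue_rV R n).
Local Open Scope ereal_scope.

Lemma rv_cons_lshift n (a : R) (x : 'rV[R]_n) (j : 'I_1) :
  rv_cons (a, x) ord0 (lshift n j) = a.
Proof. by rewrite [_ ord0 _](row_mxEl _ _ _ _) mxE. Qed.

Lemma rv_cons_rshift n (a : R) (x : 'rV[R]_n) (j : 'I_n) :
  rv_cons (a, x) ord0 (rshift 1 j) = x ord0 j.
Proof. by rewrite [_ ord0 _](row_mxEr _ _ _ _). Qed.

Lemma rv_cons_ext n (v w : 'rV[R]_n.+1) :
  v ord0 (lshift n (ord0 : 'I_1)) = w ord0 (lshift n (ord0 : 'I_1)) ->
  (forall j, v ord0 (rshift 1 j) = w ord0 (rshift 1 j)) -> v = w.
Proof.
move=> vw0 vw; apply/rowP => i; case: (@split_ordP 1 n i) => j ->.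
  by rewrite (ord1 j).
exact: vw.
Qed.

Lemma rv_cons_eta n (x : 'rV[R]_n.+1) :
  exists a y, x = rv_cons (a, y).
Proof.
exists (x ord0 (lshift n (ord0 : 'I_1))), (\row_j x ord0 (rshift 1 j)).
by apply: rv_cons_ext => [|j]; rewrite ?rv_cons_lshift ?rv_cons_rshift// mxE.
Qed.

Lemma rv_consD n (a b : R) (x y : 'rV[R]_n) :
  rv_cons (a + b, x + y)%R = (rv_cons (a, x) + rv_cons (b, y))%R.
Proof.
by apply: rv_cons_ext => [|j]; rewrite [RHS]mxE ?rv_cons_lshift ?rv_cons_rshift// mxE.
Qed.

Lemma rv_consZ n (c a : R) (x : 'rV[R]_n) :
  rv_cons (c * a, c *: x)%R = (c *: rv_cons (a, x))%R.
Proof.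
by apply: rv_cons_ext => [|j]; rewrite [RHS]mxE ?rv_cons_lshift ?rv_cons_rshift// mxE.
Qed.

Lemma rv_cons_delta0 n (j : 'I_1) :
  rv_cons (1%R, 0%R : 'rV[R]_n) = delta_mx ord0 (lshift n j).
Proof.
apply: rv_cons_ext => [|l]; rewrite [RHS]mxE eqxx/= ?rv_cons_lshift ?rv_cons_rshift.
  by rewrite (ord1 j) eqxx.
by rewrite mxE ?eq_rlshift.
Qed.

Lemma rv_cons_delta n (j : 'I_n) :
  rv_cons (0%R, delta_mx ord0 j : 'rV[R]_n) = delta_mx ord0 (rshift 1 j).
Proof.
apply: rv_cons_ext => [|l]; rewrite [RHS]mxE eqxx/= ?rv_cons_lshift ?rv_cons_rshift.
  by rewrite ?eq_lrshift.
by rewrite mxE eqxx/= (inj_eq (@rshift_inj _ _)).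
Qed.

Lemma integral_rVS n (f : 'rV[R]_n.+1 -> \bar R) :
  measurable_fun setT f -> (forall x, 0 <= f x) ->
  \int[lam n.+1]_x f x = \int[leb]_a \int[lam n]_x f (rv_cons (a, x)).
Proof.
move=> mf f0.
have := @ge0_integral_pushforward _ _ _ _ R (@rv_cons R n)
  (@measurable_rv_cons R n) (leb \x lam n) setT f measurableT mf (fun x _ => f0 x).
rewrite preimage_setT [RHS](fubini_tonelli1 (f \o @rv_cons R n)) => [|//|x /=]; last exact: f0.
  by [].
by apply: measurableT_comp => //; exact: measurable_rv_cons.
Qed.

Lemma integral_rVS_sym n (f : 'rV[R]_n.+1 -> \bar R) :
  measurable_fun setT f -> (forall x, 0 <= f x) ->
  \int[lam n.+1]_x f x = \int[lam n]_x \int[leb]_a f (rv_cons (a, x)).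
Proof.
move=> mf f0; rewrite integral_rVS//.
apply: (fubini_tonelli (f \o @rv_cons R n)) => [|x /=]; last exact: f0.
by apply: measurableT_comp => //; exact: measurable_rv_cons.
Qed.

Lemma measurable_rv_cons1 n (a : R) :
  measurable_fun setT (fun x : 'rV[R]_n => rv_cons (a, x)).
Proof. exact: measurableT_comp (@measurable_rv_cons R n) (measurable_pair1 _). Qed.

Lemma measurable_rv_cons2 n (x : 'rV[R]_n) :
  measurable_fun setT (fun a : measurableTypeR R => rv_cons (a, x)).
Proof. exact: measurableT_comp (@measurable_rv_cons R n) (measurable_pair2 _). Qed.

Lemma ge0_integral_affine n (f : 'rV[R]_n -> \bar R) (z : 'rV[R]_n) (s : R) :
  (0 < s)%R -> measurable_fun setT f -> (forall x, 0 <= f x) ->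
  \int[lam n]_x f x = (s ^+ n)%:E * \int[lam n]_x f (z + s *: x)%R.
Proof.
move=> s0; elim: n f z => [|n IH] f z mf f0.
  rewrite expr0 mul1e; apply: eq_integral => x _; congr f.
  by apply/rowP; case.
have maff : measurable_fun setT (fun x : 'rV[R]_n.+1 => (z + s *: x)%R).
  apply: measurable_rowP => i; under eq_fun do rewrite !mxE.
  by apply: measurable_funD => //; apply: measurable_funM => //; exact: measurable_coord.
rewrite [in RHS]integral_rVS//; last exact: measurableT_comp.
have [b [y zE]] := rv_cons_eta z.
have -> : \int[leb]_a \int[lam n]_x f (z + s *: rv_cons (a, x))%R =
    \int[leb]_a \int[lam n]_x f (rv_cons (b + s * a, y + s *: x))%R.
  by apply: eq_integral => a _; apply: eq_integral => x _; rewrite zE -rv_consZ -rv_consD.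
rewrite integral_rVS//.
pose g a := \int[lam n]_x f (rv_cons (a, x)).
have mg : measurable_fun [set: measurableTypeR R] g.
  apply: (@measurable_fun_fubini_tonelli_F _ _ _ _ R (lam n) (f \o @rv_cons R n)).
    by apply: measurableT_comp => //; exact: measurable_rv_cons.
  by move=> x /=; exact: f0.
have g0 a : 0 <= g a by apply: integral_ge0.
rewrite (ge0_integral_affine1 b s0 mg g0).
have gE a : g a = (s ^+ n)%:E * \int[lam n]_x f (rv_cons (a, y + s *: x)%R).
  rewrite /g (IH (fun x => f (rv_cons (a, x))) y)//.
  exact: measurableT_comp mf (measurable_rv_cons1 _).
under eq_integral do rewrite gE.
rewrite ge0_integralZl//; last 3 first.
- have -> : (fun a : measurableTypeR R => \int[lam n]_x f (rv_cons (b + s * a, y + s *: x)%R)) =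
     (fun a => ((s ^+ n)^-1)%:E * g (b + s * a)%R).
    apply/funext => a; rewrite gE muleA -EFinM mulVf ?mul1e//.
    by rewrite expf_neq0// gt_eqF.
  apply: measurable_funeM; apply: measurableT_comp => //.
  by apply: measurable_funD => //; exact: measurable_funM.
- by move=> a _; exact: integral_ge0.
- by rewrite lee_fin exprn_ge0// ltW.
by rewrite muleA -EFinM -exprS.
Qed.

(** A shear translates every line parallel to the i-th axis by a constant. When that axis is the
    first one, Fubini with the first variable innermost reduces to translation invariance on the
    line; otherwise the induction applies on each slice. *)
Lemma ge0_integral_shear n (f : 'rV[R]_n -> \bar R) (i : 'I_n) (g : 'rV[R]_n -> R) :
  measurable_fun setT f -> (forall x, 0 <= f x) -> measurable_fun setT g ->
  (forall x t, g (x + t *: delta_mx ord0 i)%R = g x) ->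
  \int[lam n]_x f (x + g x *: delta_mx ord0 i)%R = \int[lam n]_x f x.
Proof.
elim: n f i g => [f [//]|n IH f i g mf f0 mg gi].
have mshear : measurable_fun setT (fun x : 'rV[R]_n.+1 => (x + g x *: delta_mx ord0 i)%R).
  apply: measurable_rowP => j; under eq_fun do rewrite !mxE.
  by apply: measurable_funD; [exact: measurable_coord|exact: measurable_funM].
have mfs := measurableT_comp mf mshear.
case: (@split_ordP 1 n i) => j ij; rewrite {i}ij in gi mshear mfs *.
  rewrite (integral_rVS_sym mfs (fun x => f0 _)) (integral_rVS_sym mf f0).
  apply: eq_integral => x _.
  have gx a : g (rv_cons (a, x)) = g (rv_cons (0%R, x)).
    rewrite -[RHS](gi _ a); congr g.
    by rewrite -rv_cons_delta0 -rv_consZ -rv_consD add0r mulr1 scaler0 addr0.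
  rewrite [RHS](@ge0_integral_affine1 _ _ (g (rv_cons (0%R, x))) 1)//; last first.
    exact: measurableT_comp mf (measurable_rv_cons2 _).
  rewrite mul1e; apply: eq_integral => a _ /=; congr f.
  rewrite gx -rv_cons_delta0 -rv_consZ -rv_consD mul1r mulr1 scaler0 addr0.
  by rewrite addrC.
rewrite (integral_rVS mfs (fun x => f0 _)) (integral_rVS mf f0).
apply: eq_integral => a _ /=.
rewrite -[RHS](IH (fun x => f (rv_cons (a, x))) j (fun x => g (rv_cons (a, x))))//.
- apply: eq_integral => x _; congr f.
  by rewrite -rv_cons_delta -rv_consZ -rv_consD mulr0 addr0.
- exact: measurableT_comp mf (measurable_rv_cons1 _).
- exact: measurableT_comp mg (measurable_rv_cons1 _).
move=> x t; rewrite -[RHS](gi _ t); congr g.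
by rewrite -rv_cons_delta -rv_consZ -rv_consD mulr0 addr0.
Qed.

Lemma enorm_rv_cons n a (x : 'rV[R]_n) :
  (enorm (rv_cons (a, x)) ^+ 2 = a ^+ 2 + enorm x ^+ 2)%R.
Proof.
rewrite /enorm !sqr_sqrtr; try by apply: sumr_ge0 => i _; exact: sqr_ge0.
rewrite big_ord_recl; congr (_ + _)%R.
  by rewrite (_ : ord0 = lshift n (ord0 : 'I_1)) ?rv_cons_lshift//; exact/val_inj.
apply: eq_bigr => i _; rewrite (_ : lift _ _ = rshift 1 i) ?rv_cons_rshift//.
exact/val_inj.
Qed.

Lemma lebesgue_eball_fin n : lam n (@eball R n) < +oo.
Proof.
have := ball_measure_fin R n.
by rewrite /ball_measure/= /mrestr setTI ge0_fin_numE.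
Qed.

Lemma bounded_eball_integrable n (h : 'rV[R]_n -> R) (M : R) :
  measurable_fun setT h -> (forall x, `|h x| <= M)%R ->
  (forall x, ~ eball x -> h x = 0%R) -> (lam n).-integrable setT (EFin \o h).
Proof.
move=> mh hM h0; apply/integrableP; split; first exact/measurable_EFinP.
apply: (@le_lt_trans _ _ (\int[lam n]_(x in @eball R n) (cst M%:E) x)).
  rewrite [leRHS]integral_mkcond/=; apply: ge0_le_integral => //.
  - by apply/measurable_EFinP; exact: measurableT_comp.
  - apply/(measurable_restrictT _ _).1; [exact: measurable_eball|exact: measurable_cst].
  - move=> x _; rewrite /patch; case: ifPn => [_|]; first by rewrite lee_fin.
    by move=> /negP xB; rewrite h0 ?normr0// => /mem_set.
rewrite integral_cst; last exact: measurable_eball.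
have M0 : (0 <= M)%R by apply: le_trans (hM 0%R).
by rewrite lte_mul_pinfty//; exact: lebesgue_eball_fin.
Qed.

Lemma integral_derive_line (phi dphi : R -> R) :
  (forall a : R, is_derive a (1%R : R) phi (dphi a)) -> continuous dphi ->
  (forall a : R, (1 < `|a|)%R -> phi a = 0%R) ->
  \int[leb]_a (dphi a)%:E = 0.
Proof.
move=> phiD cdphi phi0.
have dphi0 a : (1 < `|a|)%R -> dphi a = 0%R.
  move=> a1; have := phiD a => -[_ <-].
  rewrite -(derive_cst (0%R : R) a (1%R : R)); apply: near_eq_derive => //.
  have : (fun x : R => `|x|)%R @ a --> `|a|%R by exact: norm_continuous.
  move=> /cvgr_gt/(_ 1%R a1); apply: filterS => y /phi0 ->//.
(* The endpoints are taken outside [-1, 1], where [phi0] applies to them. *)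
have -> : \int[leb]_a (dphi a)%:E = \int[leb]_(a in `[(-2)%R, 2%R]%classic) (dphi a)%:E.
  rewrite [RHS]integral_mkcond; apply: eq_integral => a _.
  rewrite /patch; case: ifPn => // /negP; rewrite inE/= in_itv/= => h.
  rewrite dphi0// ltNge; apply/negP; rewrite ler_norml => /andP[h1 h2].
  by apply: h; apply/andP; split; lra.
rewrite (@continuous_FTC2 _ dphi phi)//.
- by rewrite !phi0 ?subee// ?normrN ger0_norm//; lra.
- by lra.
- exact: continuous_subspaceT.
- split.
  + by move=> x _; case: (phiD x).
  + apply: cvg_at_right_filter; apply: differentiable_continuous.
    by apply/derivable1_diffP; case: (phiD (-2)%R).
  + apply: cvg_at_left_filter; apply: differentiable_continuous.
    by apply/derivable1_diffP; case: (phiD 2%R).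
- by move=> x _; rewrite derive1E; case: (phiD x) => _ ->.
Qed.

Lemma norm_rv_cons n (a : R) (x : 'rV[R]_n) :
  (`|rv_cons (a, x)| <= `|a| + `|x|)%R.
Proof.
rewrite [leLHS]mx_normrE; apply: bigmax_le; first exact: addr_ge0.
move=> [l i] _ /=; rewrite (ord1 l); case: (@split_ordP 1 n i) => j ->.
  by rewrite [rv_cons _ _ _]rv_cons_lshift lerDl.
rewrite [rv_cons _ _ _]rv_cons_rshift ler_wpDl//.
by rewrite [leRHS]mx_normrE (le_bigmax _ (fun ij => `|x ij.1 ij.2|%R) (ord0, j)).
Qed.

Lemma continuous_rv_cons1 n (a : R) : continuous (fun x : 'rV[R]_n => rv_cons (a, x)).
Proof.
move=> x; apply/(@cvgrPdist_lt _ _ _ _ (nbhs_filter x)) => e e0.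
have := nbhsx_ballx x e e0; apply: filterS => y; rewrite -ball_normE/= => xy.
have -> : (rv_cons (a, x) - rv_cons (a, y))%R = rv_cons (0%R, x - y)%R.
  by rewrite -scaleN1r -rv_consZ -rv_consD scaleN1r mulN1r subrr.
apply: (le_lt_trans (norm_rv_cons _ _)); by rewrite normr0 add0r.
Qed.

Lemma continuous_rv_cons2 n (x : 'rV[R]_n) : continuous (fun a : R => rv_cons (a, x)).
Proof.
move=> a; apply/(@cvgrPdist_lt _ _ _ _ (nbhs_filter a)) => e e0.
have := nbhsx_ballx a e e0; apply: filterS => b; rewrite -ball_normE/= => ab.
have -> : (rv_cons (a, x) - rv_cons (b, x))%R = rv_cons (a - b, 0%R)%R.
  by rewrite -scaleN1r -rv_consZ -rv_consD scaleN1r mulN1r subrr.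
apply: (le_lt_trans (norm_rv_cons _ _)); by rewrite normr0 addr0.
Qed.

(** Fubini with the i-th variable innermost. The slices of the ball lie in the ball of one dimension
    less, so that the hypotheses pass to them, and the bound on [dh] gives the integrability. *)
Lemma integral_derive_eball n (h dh : 'rV[R]_n -> R) (i : 'I_n) :
  (forall x, is_derive x (delta_mx ord0 i) h (dh x)) -> continuous dh ->
  (exists M : R, forall x, `|dh x| <= M)%R ->
  (forall x, ~ eball x -> h x = 0%R) -> (forall x, ~ eball x -> dh x = 0%R) ->
  \int[lam n]_x (dh x)%:E = 0.
Proof.
elim: n h dh i => [h dh [//]|n IH h dh i hD cdh [M dhM] h0 dh0].
have mdh := continuous_measurable_rV cdh.
have idh := bounded_eball_integrable mdh dhM dh0.
have mdhE : measurable_fun setT (EFin \o dh) by exact/measurable_EFinP.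
have mdc : measurable_fun setT ((EFin \o dh) \o @rv_cons R n).
  by apply: measurableT_comp => //; exact: measurable_rv_cons.
have icons : (leb \x lam n).-integrable setT ((EFin \o dh) \o @rv_cons R n).
  apply/integrableP; split => //.
  have [_] := integrableP _ _ _ idh; apply: le_lt_trans.
  have mabs : measurable_fun setT (abse \o (EFin \o dh)) by exact: measurableT_comp.
  have := @ge0_integral_pushforward _ _ _ _ R (@rv_cons R n)
    (@measurable_rv_cons R n) (leb \x lam n) setT (abse \o (EFin \o dh))
    measurableT mabs (fun x _ => abse_ge0 _).
  by rewrite preimage_setT => /esym E; rewrite [leLHS]E.
have := @integral_pushforward _ _ _ _ R (@rv_cons R n)
  (@measurable_rv_cons R n) (leb \x lam n) setT (EFin \o dh) mdhE.
rewrite preimage_setT => /(_ icons measurableT) ->.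
have eball_cons (a : R) (x : 'rV[R]_n) : eball (rv_cons (a, x)) -> eball x.
  rewrite /eball /= => h1; rewrite -(@ltr_pXn2r _ 2)// ?nnegrE ?sqrtr_ge0//.
  have : (enorm (rv_cons (a, x)) ^+ 2 < 1 ^+ 2)%R.
    by rewrite ltr_pXn2r// ?nnegrE ?sqrtr_ge0.
  by rewrite enorm_rv_cons; apply: le_lt_trans; rewrite lerDr sqr_ge0.
have eball_cons0 (a : R) (x : 'rV[R]_n) : eball (rv_cons (a, x)) -> (`|a| <= 1)%R.
  move=> h1; have : (enorm (rv_cons (a, x)) ^+ 2 < 1 ^+ 2)%R.
    by rewrite ltr_pXn2r// ?nnegrE ?sqrtr_ge0.
  rewrite enorm_rv_cons => h2; rewrite -(@ler_pXn2r _ 2)// ?nnegrE//.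
  by rewrite real_normK ?num_real// ltW// (le_lt_trans _ h2)// lerDl sqr_ge0.
case: (@split_ordP 1 n i) => j ij; rewrite {i}ij in hD.
  rewrite -integral21_prod_meas1//= integral0_eq// => x _.
  apply: (@integral_derive_line (fun a => h (rv_cons (a, x)))).
  - move=> a; apply: is_derive_along (hD (rv_cons (a, x))) => t.
    by rewrite -(rv_cons_delta0 n j) -rv_consZ -rv_consD scaler0 add0r.
  - move=> a; apply: (@continuous_comp _ _ _ (fun a => rv_cons (a, x)) dh); last exact: cdh.
    exact: continuous_rv_cons2.
  - move=> a a1; apply: h0 => /eball_cons0; rewrite leNgt => /negP; exact.
rewrite -integral12_prod_meas1//= integral0_eq// => a _.
apply: (IH (fun x => h (rv_cons (a, x))) _ j).
- move=> x; apply: is_derive_along (hD (rv_cons (a, x))) => t.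
  by rewrite -(rv_cons_delta j) -rv_consZ -rv_consD mulr0 add0r.
- move=> x; apply: (@continuous_comp _ _ _ (fun x => rv_cons (a, x)) dh); last exact: cdh.
  exact: continuous_rv_cons1.
- by exists M => x; exact: dhM.
- by move=> x xB; apply: h0 => /eball_cons.
- by move=> x xB; apply: dh0 => /eball_cons.
Qed.

End rV_integration.

(** * Integration on the ball and polynomial functions *)

Section ball_integral.
Variables (R : realType) (d : nat).
Local Notation mu := (ball_measure R d).
Local Notation lam := (lebesgue_rV R d).

Lemma integral_ball_measure (f : 'rV[R]_d -> \bar R) : measurable_fun setT f ->
  (\int[mu]_x f x = \int[lam]_(x in @eball R d) f x)%E.
Proof.
move=> mf; transitivity (\int[mu]_(x in @eball R d) f x)%E.
  rewrite [RHS]integral_mkcond; apply: ae_eq_integral => //.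
    apply/(measurable_restrictT _ _).1; first exact: measurable_eball.
    exact: measurable_funS mf.
  by apply: filterS (ball_measure_ae R d) => x xB _; rewrite /patch mem_set.
apply: eq_measure_integral => A mA AB.
by rewrite /ball_measure/= /mrestr; congr (lam _); apply: setIidl.
Qed.

Lemma eball_coord (x : 'rV[R]_d) i : eball x -> `|x ord0 i| <= 1.
Proof.
move=> xB; rewrite -sqrtr_sqr; apply/ltW/(le_lt_trans _ xB).
rewrite /enorm ler_wsqrtr// (bigD1 i)//= lerDl sumr_ge0// => j _.
exact: sqr_ge0.
Qed.

Lemma continuous_eball_bounded (h : 'rV[R]_d -> R) : continuous h ->
  exists M, forall x, eball x -> `|h x| <= M.
Proof.
move=> ch; pose box : set 'rV[R]_d := [set x | forall i, `[-1, 1]%classic (x ord0 i)].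
have cbox : compact box.
  have := @rV_compact R d (fun=> `[-1, 1]%classic).
  by apply => i; exact: segment_compact.
have : compact (h @` box).
  by apply: continuous_compact => //; exact: continuous_subspaceT.
move=> /compact_bounded[M [_ /(_ (M + 1))]].
rewrite ltrDl ltr01 => /(_ isT) hM; exists (M + 1) => x Bx.
apply: hM; exists x => // i /=; rewrite in_itv/= -ler_norml.
exact: eball_coord.
Qed.

Lemma integral_derive_ball (h dh : 'rV[R]_d -> R) (i : 'I_d) :
  (forall x, is_derive x (delta_mx ord0 i) h (dh x)) -> continuous dh ->
  (forall x, ~ eball x -> h x = 0) -> (forall x, ~ eball x -> dh x = 0) ->
  \int[mu]_x dh x = 0.
Proof.
move=> hD cdh h0 dh0; have mdh := continuous_measurable_rV cdh.
rewrite /Rintegral integral_ball_measure; last exact/measurable_EFinP.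
rewrite (_ : (\int[_]_(x in _) _)%E = (\int[lam]_x (dh x)%:E)%E).
  rewrite (integral_derive_eball hD cdh _ h0 dh0)//.
  have [M hM] := continuous_eball_bounded cdh.
  exists (Num.max M 0) => x; have [xB|xB] := pselect (eball x).
    by rewrite le_max hM.
  by rewrite dh0// normr0 le_max lexx orbT.
rewrite integral_mkcond; apply: eq_integral => x _.
by rewrite /patch; case: ifPn => // /negP; rewrite inE => /dh0 ->.
Qed.

Lemma bounded_L2 (f : 'rV[R]_d -> R) (M : R) : measurable_fun setT f ->
  (forall x, eball x -> `|f x| <= M) -> f \in Lfun mu 2%:E.
Proof.
move=> mf fM; rewrite inE; apply/andP; split; rewrite inE//=.
rewrite /finite_norm unlock /= ; apply: poweR_lty.
have mf2 : measurable_fun [set: 'rV[R]_d] (fun x => (`|(f x)%:E| `^ 2)%E).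
  under eq_fun do rewrite abse_EFin poweR_EFin.
  apply/measurable_EFinP/(@measurableT_comp _ _ _ _ _ _ (@powR R ^~ 2)) => //.
  exact: measurableT_comp.
apply: (@le_lt_trans _ _ (\int[mu]_x (cst (M ^+ 2)%:E x))%E).
  apply: ae_ge0_le_integral => //.
    by move=> x _; rewrite lee_fin sqr_ge0.
  apply: filterS (ball_measure_ae R d) => x xB _.
  rewrite lee_fin powR_mulrn//.
  by rewrite ler_pXn2r// ?nnegrE// ?fM// (le_trans _ (fM x xB)).
rewrite integral_cst// lte_mul_pinfty// ?lee_fin ?sqr_ge0//.
by rewrite -ge0_fin_numE//; exact: ball_measure_fin.
Qed.

Lemma L2_measurable (f : 'rV[R]_d -> R) : f \in Lfun mu 2%:E -> measurable_fun setT f.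
Proof. by rewrite inE => /andP[/[1!inE]]. Qed.

Lemma L2_mul_integrable (f g : 'rV[R]_d -> R) :
  f \in Lfun mu 2%:E -> g \in Lfun mu 2%:E ->
  mu.-integrable setT (EFin \o (fun x => f x * g x)).
Proof. by move=> f2 g2; apply/Lfun1_integrable; exact: Lfun2_mul_Lfun1. Qed.

Lemma continuous_L2 (f : 'rV[R]_d -> R) : continuous f -> f \in Lfun mu 2%:E.
Proof.
move=> cf; have [M fM] := continuous_eball_bounded cf.
exact: bounded_L2 (continuous_measurable_rV cf) fM.
Qed.

Lemma L2_integrable (f : 'rV[R]_d -> R) : f \in Lfun mu 2%:E ->
  mu.-integrable setT (EFin \o f).
Proof.
move=> f2; apply/Lfun1_integrable; apply: Lfun_subset12 f2.
exact: ball_measure_fin.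
Qed.

Lemma l2norm_sqr (f : 'rV[R]_d -> R) : f \in Lfun mu 2%:E ->
  l2norm f ^+ 2 = \int[mu]_x (f x ^+ 2).
Proof.
move=> f2; have mf := L2_measurable f2.
have pw : ('N[mu]_2%:E[EFin \o f] `^ 2 = \int[mu]_x (f x ^+ 2)%:E)%E.
  rewrite (@powR_Lnorm _ _ _ _ (EFin \o f) 2)//; apply: eq_integral => x _.
  by rewrite abse_EFin poweR_EFin powR_mulrn// real_normK ?num_real.
rewrite /l2norm /Rintegral -pw -powR_mulrn ?fine_ge0 ?Lnorm_ge0//.
move: f2; rewrite inE => /andP[_]; rewrite inE/= /finite_norm => fin.
by rewrite fine_poweR.
Qed.

Lemma le_Rintegral_ball (f g : 'rV[R]_d -> R) :
  mu.-integrable setT (EFin \o f) -> mu.-integrable setT (EFin \o g) ->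
  (forall x, eball x -> f x <= g x) -> \int[mu]_x f x <= \int[mu]_x g x.
Proof.
move=> fi gi fg; rewrite -subr_ge0 -RintegralB//.
have : {ae mu, forall x, `|g x - f x| = g x - f x}.
  apply: filterS (ball_measure_ae R d) => x xB; rewrite ger0_norm// subr_ge0.
  exact: fg.
move=> ae; rewrite (_ : \int[mu]_x _ = \int[mu]_x `|g x - f x|); last first.
  have gfi : mu.-integrable setT (EFin \o (g \- f)).
    by have := integrableB measurableT gi fi.
  congr fine; apply: ae_eq_integral => //.
  - by case/integrableP : gfi.
  - apply/measurable_EFinP; apply: measurableT_comp => //.
    by case/integrableP : gfi => /measurable_EFinP.
  - by apply: filterS ae => x /= -> _.
exact: Rintegral_ge0.
Qed.

Lemma eq_Rintegral_ball (f g : 'rV[R]_d -> R) :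
  mu.-integrable setT (EFin \o f) -> mu.-integrable setT (EFin \o g) ->
  (forall x, eball x -> f x = g x) -> \int[mu]_x f x = \int[mu]_x g x.
Proof.
move=> fi gi fg; apply/eqP; rewrite eq_le; apply/andP.
by split; apply: le_Rintegral_ball => // x /fg ->.
Qed.

End ball_integral.

Lemma continuousD_fun (R : realType) (T : topologicalType) (f g : T -> R) :
  continuous f -> continuous g -> continuous (fun x => f x + g x).
Proof. by move=> cf cg x; apply: cvgD; [exact: cf|exact: cg]. Qed.

Lemma continuousM_fun (R : realType) (T : topologicalType) (f g : T -> R) :
  continuous f -> continuous g -> continuous (fun x => f x * g x).
Proof. by move=> cf cg x; apply: cvgM; [exact: cf|exact: cg]. Qed.

Lemma continuous_cst_fun (R : realType) (T : topologicalType) (c : R) :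
  continuous (fun _ : T => c).
Proof. by move=> x; exact: cvg_cst. Qed.

Definition pd (R : realType) (d : nat) (i : 'I_d) (f : 'rV[R]_d -> R) : 'rV[R]_d -> R :=
  'D_(delta_mx ord0 i) f.

Section polynomial_functions.
Variables (R : realType) (d : nat).
Local Notation mu := (ball_measure R d).
Implicit Types f g : 'rV[R]_d -> R.

(** A closure instead of coefficients: derivability, continuity and the symmetry of second
    derivatives go by induction on the construction, without a normal form. *)
Inductive polyfn : ('rV[R]_d -> R) -> Prop :=
| polyfn_cst c : polyfn (fun=> c)
| polyfn_coord i : polyfn (fun x => x ord0 i)
| polyfnD f g : polyfn f -> polyfn g -> polyfn (fun x => f x + g x)
| polyfnM f g : polyfn f -> polyfn g -> polyfn (fun x => f x * g x).

Lemma polyfnN f : polyfn f -> polyfn (fun x => - f x).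
Proof.
move=> pf; have := polyfnM (polyfn_cst (-1)) pf.
by under eq_fun do rewrite mulN1r.
Qed.

Lemma polyfnB f g : polyfn f -> polyfn g -> polyfn (fun x => f x - g x).
Proof. by move=> pf pg; exact: polyfnD pf (polyfnN pg). Qed.

Lemma polyfnX f n : polyfn f -> polyfn (fun x => f x ^+ n).
Proof.
move=> pf; elim: n => [|n IH].
  by under eq_fun do rewrite expr0; exact: polyfn_cst.
by under eq_fun do rewrite exprS; exact: polyfnM.
Qed.

Lemma polyfn_sum (I : Type) (r : seq I) (P : pred I) (F : I -> 'rV[R]_d -> R) :
  (forall i, polyfn (F i)) -> polyfn (fun x => \sum_(i <- r | P i) F i x).
Proof.
move=> pF; elim: r => [|i r IH].
  by under eq_fun do rewrite big_nil; exact: polyfn_cst.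
under eq_fun do rewrite big_cons.
by case: (P i) => //; exact: polyfnD.
Qed.

Lemma is_derive_coord (x v : 'rV[R]_d) i :
  is_derive x v (fun x : 'rV[R]_d => x ord0 i) (v ord0 i).
Proof.
apply: (@is_derive_along _ _ _ _ _ (fun a : R => a + x ord0 i) x v 0 (v ord0 i)).
  by move=> t; rewrite !mxE addr0.
apply: is_derive_eq.
by rewrite addr0.
Qed.

Lemma polyfn_derivable f x v : polyfn f -> derivable f x v.
Proof.
elim=> [c|i|g h _ dg _ dh|g h _ dg _ dh].
- exact: derivable_cst.
- by case: (is_derive_coord x v i).
- exact: (derivableD dg dh).
- exact: (derivableM dg dh).
Qed.

Lemma pd_cst c i : pd i (fun _ : 'rV[R]_d => c) = fun=> 0.
Proof. by apply/funext => x; exact: derive_cst. Qed.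

Lemma pd_coord i j : pd i (fun x : 'rV[R]_d => x ord0 j) = fun=> (i == j)%:R.
Proof.
apply/funext => x; rewrite /pd; have [_ E] := is_derive_coord x (delta_mx ord0 i) j.
by rewrite [LHS]E mxE eqxx/= eq_sym.
Qed.

Lemma pdD f g i : polyfn f -> polyfn g ->
  pd i (fun x => f x + g x) = fun x => pd i f x + pd i g x.
Proof.
by move=> pf pg; apply/funext => x; apply: deriveD; exact: polyfn_derivable.
Qed.

Lemma pdM f g i : polyfn f -> polyfn g ->
  pd i (fun x => f x * g x) = fun x => pd i f x * g x + f x * pd i g x.
Proof.
move=> pf pg; apply/funext => x; rewrite addrC.
rewrite [LHS](deriveM (@polyfn_derivable _ _ _ pf) (@polyfn_derivable _ _ _ pg)).
by rewrite [g x *: _]mulrC.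
Qed.

Lemma pdB f g i : polyfn f -> polyfn g ->
  pd i (fun x => f x - g x) = fun x => pd i f x - pd i g x.
Proof.
by move=> pf pg; apply/funext => x; apply: deriveB; exact: polyfn_derivable.
Qed.

Lemma pdZ f c i : polyfn f -> pd i (fun x => c * f x) = fun x => c * pd i f x.
Proof.
move=> pf; rewrite (pdM i (polyfn_cst c) pf) pd_cst.
by apply/funext => x; rewrite mul0r add0r.
Qed.

Lemma polyfn_pd f i : polyfn f -> polyfn (pd i f).
Proof.
elim=> [c|j|g h pg IHg ph IHh|g h pg IHg ph IHh].
- by rewrite pd_cst; exact: polyfn_cst.
- by rewrite pd_coord; exact: polyfn_cst.
- by rewrite pdD//; exact: polyfnD.
- by rewrite pdM//; apply: polyfnD; exact: polyfnM.
Qed.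

Lemma pd_sum (I : Type) (r : seq I) (P : pred I) (F : I -> 'rV[R]_d -> R) i :
  (forall j, polyfn (F j)) ->
  pd i (fun x => \sum_(j <- r | P j) F j x) = fun x => \sum_(j <- r | P j) pd i (F j) x.
Proof.
move=> pF; elim: r => [|j r IH].
  rewrite (_ : (fun x => _) = fun=> 0); last by apply/funext => x; rewrite big_nil.
  by rewrite pd_cst; apply/funext => x; rewrite big_nil.
have [Pj|Pj] := boolP (P j); last first.
  rewrite (_ : (fun x => _) = fun x => \sum_(j <- r | P j) F j x).
    by rewrite IH; apply/funext => x; rewrite big_cons (negbTE Pj).
  by apply/funext => x; rewrite big_cons (negbTE Pj).
rewrite (_ : (fun x => _) = fun x => F j x + \sum_(j <- r | P j) F j x).
  rewrite (pdD i (pF j) (polyfn_sum r P pF)) IH.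
  by apply/funext => x; rewrite big_cons Pj.
by apply/funext => x; rewrite big_cons Pj.
Qed.

Lemma pdC f i j : polyfn f -> pd i (pd j f) = pd j (pd i f).
Proof.
elim=> [c|l|g h pg IHg ph IHh|g h pg IHg ph IHh].
- by rewrite pd_cst [pd i _]pd_cst pd_cst [RHS]pd_cst.
- by rewrite pd_coord [pd i _ in RHS]pd_coord pd_cst [RHS]pd_cst.
- have pjg := polyfn_pd j pg; have pjh := polyfn_pd j ph.
  have pig := polyfn_pd i pg; have pih := polyfn_pd i ph.
  by rewrite (pdD j pg ph) (pdD i pg ph) (pdD i pjg pjh) (pdD j pig pih) IHg IHh.
- have pjg := polyfn_pd j pg; have pjh := polyfn_pd j ph.
  have pig := polyfn_pd i pg; have pih := polyfn_pd i ph.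
  rewrite (pdM j pg ph) (pdM i pg ph).
  rewrite (pdD i (polyfnM pjg ph) (polyfnM pg pjh)) (pdM i pjg ph) (pdM i pg pjh).
  rewrite (pdD j (polyfnM pig ph) (polyfnM pg pih)) (pdM j pig ph) (pdM j pg pih).
  by rewrite IHg IHh; apply/funext => x; rewrite addrACA.
Qed.

Lemma polyfn_partials f s : polyfn f -> polyfn (partials s f).
Proof. by move=> pf; elim: s => //= i s; exact: polyfn_pd. Qed.

Lemma partials_cat (s t : seq 'I_d) f : partials (s ++ t) f = partials s (partials t f).
Proof. exact: foldr_cat. Qed.

Lemma pd_partials f i s : polyfn f -> partials s (pd i f) = pd i (partials s f).
Proof.
by move=> pf; elim: s => //= j s ->; rewrite pdC//; exact: polyfn_partials.
Qed.

Lemma polyfn_continuous f : polyfn f -> continuous f.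
Proof.
elim=> [c|i|g h _ cg _ ch|g h _ cg _ ch].
- exact: continuous_cst_fun.
- exact: coord_continuous.
- exact: continuousD_fun.
- exact: continuousM_fun.
Qed.

Lemma polyfn_L2 f : polyfn f -> f \in Lfun mu 2%:E.
Proof. by move=> /polyfn_continuous; exact: continuous_L2. Qed.

Lemma polyfn_integrable f : polyfn f -> mu.-integrable setT (EFin \o f).
Proof. by move=> /polyfn_L2/L2_integrable. Qed.

Lemma test_function_pd f i : test_function f -> test_function (pd i f).
Proof.
move=> [sf [K [cK KB f0]]]; split.
  move=> s; have -> : partials s (pd i f) = partials (s ++ [:: i]) f by rewrite partials_cat.
  exact: sf.
exists K; split=> // x Kx; rewrite -(derive_cst (0 : R) x (delta_mx ord0 i)).
apply: near_eq_derive; have : open (~` K).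
  by apply: closed_openC; apply: compact_closed => //; exact: norm_hausdorff.
rewrite openE => /(_ _ Kx); apply: filterS => y; exact: f0.
Qed.

Lemma polyfn_ibp q f i : polyfn q -> test_function f ->
  \int[mu]_x (q x * pd i f x) = - \int[mu]_x (pd i q x * f x).
Proof.
move=> pq tf; have [sf [K [_ KB f0]]] := tf.
have [_ [K' [_ KB' f0']]] := test_function_pd i tf.
have [cf df] := sf [::]; have [cdf _] := sf [:: i].
rewrite /= in cf df cdf.
have cq := polyfn_continuous pq; have cdq := polyfn_continuous (polyfn_pd i pq).
have int (u v : 'rV[R]_d -> R) : continuous u -> continuous v ->
    mu.-integrable setT (EFin \o (fun x => u x * v x)).
  by move=> cu cv; apply/L2_integrable/continuous_L2; exact: continuousM_fun.
apply/eqP; rewrite -addr_eq0 -RintegralD//; [|exact: int|exact: int].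
apply/eqP; apply: (@integral_derive_ball _ _ (fun x => q x * f x) _ i).
- move=> x; apply: DeriveDef; first exact: (derivableM (@polyfn_derivable _ _ _ pq) (df x i)).
  rewrite (deriveM (@polyfn_derivable _ _ _ pq) (df x i)); congr (_ + _).
  by rewrite [RHS]mulrC.
- by apply: continuousD_fun; exact: continuousM_fun.
- by move=> x xB; rewrite f0 ?mulr0// => /KB.
- by move=> x xB; rewrite f0 1?f0' ?mulr0 ?addr0// => [/KB'|/KB].
Qed.

Lemma polyfn_partials_ibp q f s : polyfn q -> test_function f ->
  \int[mu]_x (q x * partials s f x) =
  (-1) ^+ size s * \int[mu]_x (partials s q x * f x).
Proof.
move=> pq tf; elim: s q pq => [|i s IH] q pq /=; first by rewrite expr0 mul1r.
have tsf : test_function (partials s f).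
  by elim: (s) => //= j t; exact: test_function_pd.
rewrite polyfn_ibp// IH; last exact: polyfn_pd.
by rewrite pd_partials// exprS mulN1r mulNr.
Qed.

Definition mi_seq (a : 'I_d -> nat) : seq 'I_d :=
  flatten [seq nseq (a i) i | i <- enum 'I_d].

Lemma size_mi_seq a : size (mi_seq a) = mi_order a.
Proof.
rewrite /mi_seq size_flatten /shape -map_comp sumnE big_map /mi_order big_enum/=.
by apply: eq_bigr => i _; rewrite size_nseq.
Qed.

Lemma polyfn_weak_deriv q a : polyfn q -> weak_deriv a q (mpartial a q).
Proof.
move=> pq; split; first exact/polyfn_L2/polyfn_partials.
by move=> f tf; rewrite polyfn_partials_ibp// -[flatten _]/(mi_seq a) size_mi_seq.
Qed.

End polynomial_functions.

(** * Density of the polynomials in L^2 *)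

Lemma bernoulli_ge (R : realDomainType) (x : R) n : -1 <= x -> 1 + n%:R * x <= (1 + x) ^+ n.
Proof.
move=> x1; have x0 : 0 <= 1 + x by rewrite -lerBlDl sub0r.
elim: n => [|n IH]; first by rewrite mul0r addr0 expr0.
rewrite exprS; apply: le_trans (ler_wpM2l x0 IH).
have -> : (1 + x) * (1 + n%:R * x) = 1 + n.+1%:R * x + n%:R * x ^+ 2.
  by rewrite -addn1 natrD; ring.
by rewrite lerDl mulr_ge0// sqr_ge0.
Qed.

(** Writing [z = y^2], Bernoulli's inequality for [1 / y] bounds [n y^n], and the other factor [y^n]
    tends to 0. *)
Lemma cvg_natM_expr (R : realType) (z : R) : 0 <= z -> z < 1 ->
  n%:R * z ^+ n @[n --> \oo] --> (0 : R).
Proof.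
move=> z0 z1; have [->|zn0] := eqVneq z 0.
  apply: cvg_near_cst; exists 1%N => // n /= n0.
  by rewrite expr0n; case: n n0 => // n _; rewrite mulr0.
pose y : R := Num.sqrt z.
have y0 : 0 < y by rewrite sqrtr_gt0 lt_neqAle eq_sym zn0.
have yz : y ^+ 2 = z by rewrite sqr_sqrtr.
have y1 : y < 1 by rewrite -[1]sqrtr1 ltr_sqrt.
pose C := (y^-1 - 1)^-1.
have C0 : 0 < y^-1 - 1 by rewrite subr_gt0 invf_gt1.
have bnd n : n%:R * z ^+ n <= C * y ^+ n.
  rewrite -yz -exprM mul2n -addnn exprD mulrA ler_wpM2r ?exprn_ge0 ?(ltW y0)//.
  rewrite -ler_pdivlMr ?exprn_gt0// /C mulrC -exprVn ler_pdivlMr// mulrC [_ * n%:R]mulrC.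
  have := @bernoulli_ge _ (y^-1 - 1) n; rewrite subrKC => h.
  apply: le_trans (h _); first by rewrite lerDr.
  by rewrite (le_trans _ (ltW C0))// lerN10.
apply: (@squeeze_cvgr _ _ _ _ (fun=> 0) (fun n => C * y ^+ n)).
- by apply: nearW => n; rewrite mulr_ge0 ?exprn_ge0//= bnd.
- exact: cvg_cst.
- by apply: cvg_geometric; rewrite ger0_norm// ltW.
Qed.

(* The polynomials [(1 - s ^ n) ^ (n 2 ^ n)] tend to the indicator of [s < 1/2]
   pointwise on [0, 1]; the extra factor [n] in the exponent makes this true at
   [s = 1/2] as well. *)
Lemma cvg_step_polynomial (R : realType) (s : R) : 0 <= s -> s <= 1 ->
  (1 - s ^+ n) ^+ (n * 2 ^ n)%N @[n --> \oo] --> ((s < 2^-1)%R%:R : R).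
Proof.
move=> s0 s1.
have e01 n : 0 <= 1 - s ^+ n <= 1.
  by rewrite subr_ge0 exprn_ile1//= gerBl exprn_ge0.
case: ltP => s2.
  apply: (@squeeze_cvgr _ _ _ _ (fun n => 1 - n%:R * (2 * s) ^+ n) (fun=> 1)).
  - apply: nearW => n; have /andP[e0 e1] := e01 n; rewrite exprn_ile1// andbT.
    have := @bernoulli_ge _ (- s ^+ n) (n * 2 ^ n)%N.
    rewrite lerN2 exprn_ile1// => /(_ isT); apply: le_trans.
    by rewrite natrM natrX mulrN exprMn !mulrA.
  - rewrite -[X in _ --> X]subr0; apply: cvgB; first exact: cvg_cst.
    apply: cvg_natM_expr; first by rewrite mulr_ge0.
    by rewrite -ltr_pdivlMl// mulr1.
  - exact: cvg_cst.
apply: (@squeeze_cvgr _ _ _ _ (fun=> 0) (fun n => 2^-1 ^+ n)).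
- apply: nearW => n; have /andP[e0 e1] := e01 n; rewrite exprn_ge0//=.
  pose h : R := 2^-1 ^+ n.
  have h0 : 0 < h by rewrite exprn_gt0.
  have h1 : h <= 1 by rewrite exprn_ile1// invf_le1// ler1n.
  have hs : 1 - s ^+ n <= 1 - h by rewrite lerD2l lerN2 lerXn2r// nnegrE.
  apply: (@le_trans _ _ ((1 - h) ^+ (n * 2 ^ n)%N)).
    by rewrite lerXn2r// nnegrE// subr_ge0.
  rewrite mulnC exprM lerXn2r ?nnegrE// ?exprn_ge0 ?subr_ge0//.
  have hM : (2 ^ n)%N%:R * h = 1.
    by rewrite natrX /h -exprMn divff ?expr1n.
  (* [(1 - h)^(2^n) <= 1/2], because its product with [(1 + h)^(2^n) >= 2] is
     [(1 - h^2)^(2^n) <= 1]. *)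
  have b2 : 2 <= (1 + h) ^+ (2 ^ n)%N.
    have := @bernoulli_ge _ h (2 ^ n)%N; rewrite hM => /(_ _)/le_trans; apply => //.
    by rewrite (le_trans _ (ltW h0))// lerN10.
  rewrite -[leRHS]mul1r ler_pdivlMr//.
  apply: le_trans (ler_wpM2l _ b2) _; first by rewrite exprn_ge0// subr_ge0.
  rewrite -exprMn exprn_ile1 ?mulr_ge0 ?subr_ge0 ?addr_ge0 ?(ltW h0)//.
  by rewrite -subr_sqr expr1n gerBl sqr_ge0.
- exact: cvg_cst.
- by apply: cvg_expr; rewrite ger0_norm// invf_lt1// ltr1n.
Qed.

Section l2_density.
Variables (R : realType) (d : nat).
Local Notation mu := (ball_measure R d).
Local Notation L2 := (Lfun mu 2%:E).
Implicit Types f g u v : 'rV[R]_d -> R.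

Lemma L2B f g : f \in L2 -> g \in L2 -> (fun x => f x - g x) \in L2.
Proof.
move=> f2 g2; rewrite (_ : (fun x => _) = -1 *: g + f); first exact: Lfun_lin.
by apply/funext => x; rewrite -[RHS]/(-1 * g x + f x) mulN1r addrC.
Qed.

Lemma L2D f g : f \in L2 -> g \in L2 -> (fun x => f x + g x) \in L2.
Proof.
move=> f2 g2; rewrite (_ : (fun x => _) = 1 *: f + g); first exact: Lfun_lin.
by apply/funext => x; rewrite -[RHS]/(1 * f x + g x) mul1r.
Qed.

Lemma L2Z c f : f \in L2 -> (fun x => c * f x) \in L2.
Proof.
move=> f2; rewrite (_ : (fun x => _) = c *: f + 0); last first.
  by apply/funext => x; rewrite -[RHS]/(c * f x + 0) addr0.
exact: Lfun_lin f2 (Lfun0 R d).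
Qed.

Lemma L2_dom f g : measurable_fun setT f -> g \in L2 ->
  (forall x, eball x -> `|f x| <= g x) -> f \in L2.
Proof.
move=> mf g2 fg; have mg := L2_measurable g2.
rewrite inE; apply/andP; split; rewrite inE//=.
have sqm (h : 'rV[R]_d -> R) : measurable_fun setT h ->
    measurable_fun [set: 'rV[R]_d] (fun x => (`|(h x)%:E| `^ 2)%E).
  move=> mh; under eq_fun do rewrite abse_EFin poweR_EFin.
  apply/measurable_EFinP/(@measurableT_comp _ _ _ _ _ _ (@powR R ^~ 2)) => //.
  exact: measurableT_comp.
move: g2; rewrite inE => /andP[_]; rewrite inE/= /finite_norm.
apply: le_lt_trans; rewrite unlock gt0_ler_poweR//.
- by rewrite in_itv/= leey integral_ge0.
- by rewrite in_itv/= leey integral_ge0.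
have sf := sqm f mf; have sg := sqm g mg.
apply: ae_ge0_le_integral => //; [by move=> x _; exact: poweR_ge0|by move=> x _; exact: poweR_ge0|].
apply: filterS (ball_measure_ae R d) => x xB _.
rewrite !abse_EFin !poweR_EFin lee_fin ge0_ler_powR// ?nnegrE//.
by rewrite (le_trans (fg x xB))// ler_norm.
Qed.

Lemma l2norm_le f g : f \in L2 -> g \in L2 ->
  (forall x, eball x -> `|f x| <= `|g x|) -> l2norm f <= l2norm g.
Proof.
move=> f2 g2 fg; rewrite -(@ler_pXn2r _ 2)// ?nnegrE ?l2norm_ge0//.
rewrite !l2norm_sqr//; apply: le_Rintegral_ball.
- exact: Lfun2_integrable_sqr.
- exact: Lfun2_integrable_sqr.
- by move=> x xB; rewrite -[f x ^+ 2]real_normK ?num_real// -[g x ^+ 2]real_normK ?num_real// ler_pXn2r ?nnegrE ?fg.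
Qed.

Lemma l2norm_triangle f g h : f \in L2 -> g \in L2 -> h \in L2 ->
  l2norm (fun x => f x - h x) <= l2norm (fun x => f x - g x) + l2norm (fun x => g x - h x).
Proof.
move=> f2 g2 h2; have := l2normD (L2B f2 g2) (L2B g2 h2).
congr (l2norm _ <= _); apply/funext => x.
by rewrite -[LHS]/(f x - g x + (g x - h x)) subrKA.
Qed.

Lemma l2norm_dominated (f_ : nat -> 'rV[R]_d -> R) f g :
  (forall n, f_ n \in L2) -> f \in L2 -> g \in L2 ->
  (forall n x, eball x -> `|f_ n x - f x| <= g x) ->
  (forall x, eball x -> f_ n x @[n --> \oo] --> f x) ->
  l2norm (fun x => f_ n x - f x) @[n --> \oo] --> 0.
Proof.
move=> fn2 f2 g2 fg fcvg.
have fnB n := L2B (fn2 n) f2.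
have sqg := Lfun2_integrable_sqr g2.
have m1 n : measurable_fun [set: 'rV[R]_d] (fun x => ((f_ n x - f x) ^+ 2)%:E).
  by case/integrableP : (Lfun2_integrable_sqr (fnB n)).
have c1 : {ae mu, forall x, setT x ->
    (fun n => ((f_ n x - f x) ^+ 2)%:E) @ \oo --> (0 : \bar R)%E}.
  apply: filterS (ball_measure_ae R d) => x xB _; apply/fine_cvgP; split.
    exact: nearW.
  rewrite (_ : fine \o _ = fun n => (f_ n x - f x) * (f_ n x - f x))//.
  have fB : f_ n x - f x @[n --> \oo] --> (0 : R).
    by rewrite -(subrr (f x)); apply: cvgB; [exact: fcvg|exact: cvg_cst].
  by rewrite -[X in _ --> X](mulr0 (0 : R)); exact: (cvgM fB fB).
have d1 : {ae mu, forall x n, setT x ->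
    (`| ((f_ n x - f x) ^+ 2)%:E | <= (g x ^+ 2)%:E)%E}.
  apply: filterS (ball_measure_ae R d) => x xB n _.
  rewrite abse_EFin lee_fin normrX ler_pXn2r ?nnegrE//; first exact: fg.
  exact: le_trans (fg n x xB).
have [_ _] := dominated_convergence measurableT m1 (measurable_cst 0%E) c1 sqg d1.
rewrite integral_cst// mul0e => /fine_cvgP[_ cvg0].
have -> : (fun n => l2norm (fun x => f_ n x - f x)) =
    (fun n => Num.sqrt (\int[mu]_x ((f_ n x - f x) ^+ 2))).
  by apply/funext => n; rewrite -l2norm_sqr// sqrtr_sqr ger0_norm ?l2norm_ge0.
rewrite -[X in _ --> X]sqrtr0; apply: continuous_cvg; first exact: sqrt_continuous.
exact: cvg0.
Qed.

Definition polyfn_approx v := forall eps : R, 0 < eps ->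
  exists2 q, polyfn q & l2norm (fun x => v x - q x) <= eps.

Lemma polyfn_approx_limit (f_ : nat -> 'rV[R]_d -> R) f g :
  (forall n, f_ n \in L2) -> f \in L2 -> g \in L2 ->
  (forall n x, eball x -> `|f_ n x - f x| <= g x) ->
  (forall x, eball x -> f_ n x @[n --> \oo] --> f x) ->
  (forall n, polyfn_approx (f_ n)) -> polyfn_approx f.
Proof.
move=> fn2 f2 g2 fg fcvg fa eps eps0.
have /cvgrPdist_le/(_ (eps / 2)) := l2norm_dominated fn2 f2 g2 fg fcvg.
rewrite divr_gt0// => /(_ isT)[N _ /(_ N (leqnn _))] /=.
rewrite sub0r normrN ger0_norm ?l2norm_ge0// => fN.
have [q pq fq] := fa N (eps / 2) (divr_gt0 eps0 (ltr0Sn _ 1)).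
exists q => //; apply: le_trans (l2norm_triangle f2 (fn2 N) (polyfn_L2 pq)) _.
rewrite [eps]splitr lerD// (le_trans _ fN)//.
by apply: l2norm_le; [exact: L2B|exact: L2B|move=> x _; rewrite distrC].
Qed.

Lemma polyfn_approx_ext u v : u \in L2 -> v \in L2 ->
  (forall x, eball x -> u x = v x) -> polyfn_approx u -> polyfn_approx v.
Proof.
move=> u2 v2 uv ua eps /ua[q pq uq]; exists q => //.
apply: le_trans uq; apply: l2norm_le.
- exact: L2B v2 (polyfn_L2 pq).
- exact: L2B u2 (polyfn_L2 pq).
- by move=> x /uv ->.
Qed.

Lemma polyfn_approx_polyfn q : polyfn q -> polyfn_approx q.
Proof.
move=> pq eps eps0; exists q => //; rewrite (_ : l2norm _ = 0) ?ltW//.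
rewrite (_ : (fun x => _) = 0); last by apply/funext => x; rewrite subrr.
by have := l2normZ 0 (Lfun0 R d); rewrite scale0r normr0 mul0r.
Qed.

Lemma polyfn_approxD u v : u \in L2 -> v \in L2 ->
  polyfn_approx u -> polyfn_approx v -> polyfn_approx (fun x => u x + v x).
Proof.
move=> u2 v2 ua va eps eps0.
have [q pq uq] := ua (eps / 2) (divr_gt0 eps0 (ltr0Sn _ 1)).
have [r pr vr] := va (eps / 2) (divr_gt0 eps0 (ltr0Sn _ 1)).
exists (fun x => q x + r x); first exact: polyfnD.
rewrite [eps]splitr (le_trans _ (lerD uq vr))//.
apply: le_trans (l2normD (L2B u2 (polyfn_L2 pq)) (L2B v2 (polyfn_L2 pr))).
rewrite le_eqVlt; apply/orP; left; apply/eqP; congr l2norm; apply/funext => x.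
by rewrite -[RHS]/((u x - q x) + (v x - r x)) opprD addrACA.
Qed.

Lemma polyfn_approxZ c u : u \in L2 -> polyfn_approx u -> polyfn_approx (fun x => c * u x).
Proof.
move=> u2 ua eps eps0.
have c0 : 0 < `|c| + 1 by rewrite ltr_wpDl.
have [q pq uq] := ua (eps / (`|c| + 1)) (divr_gt0 eps0 c0).
exists (fun x => c * q x); first exact: polyfnM (polyfn_cst _ c) pq.
have -> : (fun x => c * u x - c * q x) = c *: (fun x => u x - q x).
  by apply/funext => x; rewrite -mulrBr.
rewrite l2normZ; last exact: L2B u2 (polyfn_L2 pq).
apply: le_trans (ler_wpM2l (normr_ge0 _) uq) _.
by rewrite mulrCA ler_piMr ?(ltW eps0)// ler_pdivrMr// mul1r lerDl.
Qed.

Let indic01 (A : set 'rV[R]_d) x : 0 <= (\1_A x : R) <= 1.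
Proof. by rewrite indicE; case: (x \in A); rewrite /= ?lexx ?ler01. Qed.

Let indic_L2 (A : set 'rV[R]_d) : measurable A -> (\1_A : 'rV[R]_d -> R) \in L2.
Proof.
move=> mA; apply: (@bounded_L2 _ _ _ 1); first exact: measurable_indic.
by move=> x _; have /andP[h0 h1] := indic01 A x; rewrite ger0_norm.
Qed.

(** These sets form a sigma-algebra and contain the half-spaces, which generate the measurable sets;
    simple functions then lead to all of L^2. *)
Definition approx_set (A : set 'rV[R]_d) := measurable A /\ polyfn_approx \1_A.

Lemma approx_setC A : approx_set A -> approx_set (~` A).
Proof.
move=> [mA aA]; split; first exact: measurableC.
have -> : \1_(~` A) = (fun x => 1 + (-1) * \1_A x) :> ('rV[R]_d -> R).
  by apply/funext => x; rewrite !indicE in_setC; case: (_ \in _); rewrite /= ?mulr1 ?mulr0 ?addr0 ?subrr.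
apply: polyfn_approxD.
- exact/polyfn_L2/polyfn_cst.
- exact: L2Z (indic_L2 mA).
- exact/polyfn_approx_polyfn/polyfn_cst.
- exact: polyfn_approxZ (indic_L2 mA) aA.
Qed.

Lemma approx_setI A B : approx_set A -> approx_set B -> approx_set (A `&` B).
Proof.
move=> [mA aA] [mB aB]; split; first exact: measurableI.
move=> eps eps0; have e2 : 0 < eps / 2 by rewrite divr_gt0.
have [p pp Ap] := aA _ e2.
have [M pM] : exists M : R, forall x, eball x -> `|p x| <= M.
  exact: continuous_eball_bounded (polyfn_continuous pp).
have M0 : 0 < `|M| + 1 by rewrite ltr_wpDl.
(* [\1_B] is approximated after [p], at an accuracy divided by a bound of [p] on the ball, because
   the error [\1_B - q] gets multiplied by [p]. *)
have [q pq Bq] := aB (eps / 2 / (`|M| + 1)) (divr_gt0 e2 M0).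
exists (fun x => p x * q x); first exact: polyfnM.
have A2 := indic_L2 mA; have B2 := indic_L2 mB.
have ApL2 := L2B A2 (polyfn_L2 pp); have BqL2 := L2B B2 (polyfn_L2 pq).
have pB2 : (fun x => p x * \1_B x) \in L2.
  apply: (@bounded_L2 _ _ _ `|M|).
    apply: measurable_funM; first exact: (L2_measurable (polyfn_L2 pp)).
    exact: measurable_indic.
  move=> x xB; have /andP[h0 h1] := indic01 B x.
  apply: (@le_trans _ _ `|p x|); last by rewrite (le_trans (pM x xB))// ler_norm.
  by rewrite normrM [`|\1_B x|]ger0_norm// ler_piMr.
have AB2 := indic_L2 (measurableI _ _ mA mB).
apply: le_trans (l2norm_triangle AB2 pB2 (polyfn_L2 (polyfnM pp pq))) _.
rewrite [eps]splitr lerD//.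
  apply: le_trans Ap; apply: l2norm_le => //; first exact: L2B.
  move=> x _; have -> : \1_(A `&` B) x = \1_A x * \1_B x :> R by rewrite indicI.
  rewrite -mulrBl normrM.
  have /andP[h0 h1] := indic01 B x.
  by rewrite [`|\1_B x|]ger0_norm// ler_piMr.
have -> : eps / 2 = (`|M| + 1) * (eps / 2 / (`|M| + 1)).
  by rewrite [RHS]mulrC divfK// gt_eqF.
apply: le_trans (ler_wpM2l (ltW M0) Bq).
rewrite -[X in X * _](ger0_norm (ltW M0)) -(l2normZ (`|M| + 1) BqL2).
apply: l2norm_le; [exact: L2B pB2 (polyfn_L2 (polyfnM pp pq))|exact: L2Z|].
move=> x xB; rewrite -mulrBr -[X in _ <= `|X|]/((`|M| + 1) * (\1_B x - q x)) !normrM.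
rewrite ler_wpM2r// (le_trans (pM x xB))// ger0_norm ?(ltW M0)//.
by rewrite (le_trans (ler_norm M))// lerDl.
Qed.

Lemma approx_set_sigma_algebra : sigma_algebra setT approx_set.
Proof.
have a0 : approx_set set0.
  split; first exact: measurable0.
  by rewrite indic0; exact/polyfn_approx_polyfn/polyfn_cst.
split=> // [A aA|F aF]; first by rewrite setTD; exact: approx_setC.
have aU n : approx_set (\bigcup_(k < n) F k).
  elim: n => [|n IH]; first by rewrite bigcup_mkord big_ord0.
  rewrite bigcup_mkord big_ord_recr /= -bigcup_mkord -[X in approx_set X]setCK setCU.
  by apply/approx_setC/approx_setI; exact: approx_setC.
have mF : measurable (\bigcup_k F k) by apply: bigcupT_measurable => k; case: (aF k).
split=> //; apply: (@polyfn_approx_limit (fun n => \1_(\bigcup_(k < n) F k)) _ (fun=> 1)).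
- by move=> n; apply: indic_L2; case: (aU n).
- exact: indic_L2.
- exact/polyfn_L2/polyfn_cst.
- move=> n x _; have /andP[h0 h1] := indic01 (\bigcup_(k < n) F k) x.
  have /andP[h2 h3] := indic01 (\bigcup_k F k) x.
  by rewrite ler_norml; apply/andP; split; lra.
- move=> x _; apply: cvg_near_cst; have [[k _ Fkx]|nF] := pselect ((\bigcup_k F k) x).
    exists k.+1 => // n /= kn; rewrite !indicE !mem_set//; first by exists k.
    by exists k.
  apply: nearW => n; rewrite !indicE !memNset// => -[k _ Fkx]; apply: nF; by exists k.
- by move=> n; case: (aU n).
Qed.

Lemma approx_set_halfspace i c : approx_set [set x | x ord0 i < c].
Proof.
have mA : measurable [set x : 'rV[R]_d | x ord0 i < c].
  rewrite (_ : [set x | _] = setT `&` (fun x : 'rV[R]_d => x ord0 i) @^-1` `]-oo, c[).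
    by apply: measurable_coord => //; exact: measurable_itv.
  by rewrite setTI; apply/seteqP; split=> x /=; rewrite in_itv.
split => //; have A2 := indic_L2 mA.
have [c1|c1] := ltP 1 c.
  apply: (@polyfn_approx_ext (fun=> 1)) => //; last exact/polyfn_approx_polyfn/polyfn_cst.
    exact/polyfn_L2/polyfn_cst.
  move=> x xB; rewrite indicE mem_set//= (le_lt_trans _ c1)//.
  by rewrite (le_trans (ler_norm _))// eball_coord.
have [c2|c2] := ltP c (-1).
  apply: (@polyfn_approx_ext (fun=> 0)) => //; last exact/polyfn_approx_polyfn/polyfn_cst.
    exact/polyfn_L2/polyfn_cst.
  move=> x xB; rewrite indicE memNset//= => xc.
  by have := eball_coord i xB; rewrite ler_norml => /andP[h _]; lra.
(* For [|c| <= 1], [x_i - c] lies in [-2, 2] on the ball, so that [s] takes the ball to [0, 1] and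
   [x_i < c] becomes [s < 1/2], as in [cvg_step_polynomial]. *)
pose s (x : 'rV[R]_d) := 4^-1 * (x ord0 i - c) + 2^-1.
have ps : polyfn s.
  apply: polyfnD; last exact: polyfn_cst.
  by apply: polyfnM; [exact: polyfn_cst|apply: polyfnB; [exact: polyfn_coord|exact: polyfn_cst]].
have s01 x : eball x -> 0 <= s x <= 1.
  move=> /eball_coord-/(_ i); rewrite ler_norml => /andP[h1 h2].
  by rewrite /s; apply/andP; split; lra.
have pq n : polyfn (fun x => (1 - s x ^+ n) ^+ (n * 2 ^ n)%N).
  by apply/polyfnX/polyfnB; [exact: polyfn_cst|exact: polyfnX].
apply: (polyfn_approx_limit (f_ := fun n x => (1 - s x ^+ n) ^+ (n * 2 ^ n)%N) (g := fun=> 1)) => //.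
- by move=> n; exact: polyfn_L2.
- exact/polyfn_L2/polyfn_cst.
- move=> n x /s01/andP[s0 s1]; have /andP[h0 h1] := indic01 [set x | x ord0 i < c] x.
  have h2 : 0 <= (1 - s x ^+ n) ^+ (n * 2 ^ n)%N by rewrite exprn_ge0// subr_ge0 exprn_ile1.
  have h3 : (1 - s x ^+ n) ^+ (n * 2 ^ n)%N <= 1.
    by rewrite exprn_ile1// ?subr_ge0 ?exprn_ile1// gerBl exprn_ge0.
  by rewrite ler_norml; apply/andP; split; lra.
- move=> x /s01/andP[s0 s1]; have := cvg_step_polynomial s0 s1.
  rewrite (_ : (s x < 2^-1) = (x ord0 i < c)); last first.
    by rewrite /s gtrDr pmulr_rlt0// subr_lt0.
  by rewrite indicE (_ : (x \in _) = (x ord0 i < c))//; apply/idP/idP; rewrite inE.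
- by move=> n; exact: polyfn_approx_polyfn.
Qed.

Lemma approx_set_measurable A : measurable A -> approx_set A.
Proof.
suff : @measurable _ 'rV[R]_d `<=` approx_set by apply.
apply: smallest_sub; first exact: approx_set_sigma_algebra.
move=> B; rewrite -bigcup_seq => -[i _] [C mC <-]; rewrite setTI.
move: C mC; rewrite -[X in forall C, X C -> _]/(@measurable _ (measurableTypeR R)).
suff : @measurable _ (measurableTypeR R) `<=`
    [set C | approx_set ((fun x : 'rV[R]_d => x ord0 i) @^-1` C)] by apply.
have -> : @measurable _ (measurableTypeR R) = <<s @RGenInftyO.G R >>.
  exact: RGenInftyO.measurableE.
apply: smallest_sub.
  have [A0 AC AU] := approx_set_sigma_algebra; split => /=.
  - by rewrite preimage_set0.
  - by move=> C aC; rewrite setTD -preimage_setC -setTD; exact: AC.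
  - by move=> F aF; rewrite preimage_bigcup; exact: AU.
move=> _ [c ->].
change (approx_set ((fun x : 'rV[R]_d => x ord0 i) @^-1` `]-oo, c[)).
apply: (eq_ind _ approx_set (approx_set_halfspace i c)).
by apply/seteqP; split => x /=; rewrite in_itv.
Qed.

Import HBNNSimple.

Lemma polyfn_approx_ge0 v : v \in L2 -> (forall x, 0 <= v x) -> polyfn_approx v.
Proof.
move=> v2 v0; have mv := L2_measurable v2.
have mE : measurable_fun setT (EFin \o v) by exact/measurable_EFinP.
pose g := nnsfun_approx measurableT mE.
have gcvg x : g n x @[n --> \oo] --> v x.
  have := @cvg_nnsfun_approx _ _ _ _ measurableT _ mE (fun x _ => v0 x) x Logic.I.
  by move=> /fine_cvgP[].
have gle n x : g n x <= v x.
  have nd : nondecreasing_seq (fun n => g n x).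
    by move=> a b ab; exact/lefP/nd_nnsfun_approx.
  have cv : cvgn (fun n => g n x) by apply/cvg_ex; exists (v x).
  by have := nondecreasing_cvgn_le nd cv n; rewrite (cvg_lim _ (gcvg x)).
have g2 n : (g n : 'rV[R]_d -> R) \in L2.
  apply: (@L2_dom _ v) => // x _; rewrite ger0_norm//; exact: fun_ge0.
apply: (polyfn_approx_limit (f_ := fun n => g n) (g := v)) => //.
  move=> n x _; rewrite distrC ger0_norm ?subr_ge0// gerBl; exact: fun_ge0.
move=> n; have [r gE] : exists r : seq R, (g n : 'rV[R]_d -> R) =
    (fun x => \sum_(y <- r) y * \1_(g n @^-1` [set y]) x).
  exists (finmap.enum_fset (fset_set (range (g n)))); apply/funext => x.
  by rewrite fimfunE fsbig_finite.
rewrite gE {gE}.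
have mset y : measurable (g n @^-1` [set y]) by [].
elim: r => [|y r IH].
  rewrite (_ : (fun x => _) = fun=> 0).
    exact/polyfn_approx_polyfn/polyfn_cst.
  by apply/funext => x; rewrite big_nil.
rewrite (_ : (fun x => _) = fun x => y * \1_(g n @^-1` [set y]) x +
    \sum_(z <- r) z * \1_(g n @^-1` [set z]) x); last first.
  by apply/funext => x; rewrite big_cons.
have sum2 (t : seq R) : (fun x => \sum_(z <- t) z * \1_(g n @^-1` [set z]) x) \in L2.
  elim: t => [|z t IHt].
    rewrite (_ : (fun x => _) = fun=> 0); first exact/polyfn_L2/polyfn_cst.
    by apply/funext => x; rewrite big_nil.
  rewrite (_ : (fun x => _) = fun x => z * \1_(g n @^-1` [set z]) x +
    \sum_(z <- t) z * \1_(g n @^-1` [set z]) x); last first.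
    by apply/funext => x; rewrite big_cons.
  by apply: L2D => //; apply: L2Z; exact: indic_L2.
apply: polyfn_approxD => //; first by apply: L2Z; exact: indic_L2.
by apply: polyfn_approxZ; [exact: indic_L2|case: (approx_set_measurable (mset y))].
Qed.

Theorem polyfn_dense v : v \in L2 -> polyfn_approx v.
Proof.
move=> v2; have mv := L2_measurable v2.
have absv2 : (fun x => `|v x|) \in L2.
  have mav : measurable_fun setT (fun x => `|v x|) by exact: measurableT_comp.
  rewrite inE; apply/andP; split; rewrite inE//=.
  move: v2; rewrite inE => /andP[_]; rewrite inE/= /finite_norm; apply: le_lt_trans.
  by rewrite -[X in (_ <= X)%E]Lnorm_abse.
have pos2 : (fun x => `|v x| + v x) \in L2 by exact: L2D.
have a1 : polyfn_approx (fun x => `|v x| + v x).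
  by apply: polyfn_approx_ge0 => // x; have := ler_norm (- v x); rewrite normrN; lra.
have a2 : polyfn_approx (fun x => -1 * `|v x|).
  by apply: polyfn_approxZ => //; apply: polyfn_approx_ge0.
have := polyfn_approxD pos2 (L2Z (-1) absv2) a1 a2.
by rewrite (_ : (fun x => _) = v)//; apply/funext => x; rewrite mulN1r addrAC subrr add0r.
Qed.

End l2_density.

(** * Test functions and uniqueness of weak derivatives *)

Section bump.
Variable R : realType.

(** The powers [t ^- j] make the family stable under derivation, so that the smoothness of
    [e^(- 1/t)] is proved for all its members at once. *)
Definition bump (j : nat) (t : R) : R := if 0 < t then t ^- j * expR (- t^-1) else 0.

Lemma bump_ge0 j t : 0 <= bump j t.
Proof.
rewrite /bump; case: ifPn => // t0.
by rewrite mulr_ge0 ?invr_ge0 ?exprn_ge0 ?expR_ge0// ltW.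
Qed.

Lemma bump0_le1 t : bump 0 t <= 1.
Proof.
rewrite /bump; case: ifPn => // t0; rewrite expr0 invr1 mul1r.
by rewrite -expR0 ler_expR oppr_le0 invr_ge0 ltW.
Qed.

(** With [m = j + 2], [e^(1/t) = (e^(1/(m t)))^m >= (m t)^(- m)]. The square on the right is what
    makes the derivative at 0 vanish. *)
Lemma bump_le_sqr j t : bump j t <= (j.+2)%:R ^+ j.+2 * t ^+ 2.
Proof.
rewrite /bump; case: ifPn => t0; last first.
  by rewrite mulr_ge0 ?sqr_ge0// exprn_ge0.
set m : R := j.+2%:R; have m0 : 0 < m by rewrite ltr0n.
have h : expR (- t^-1) <= (m * t) ^+ j.+2.
  rewrite expRN -[leRHS]invrK lef_pV2 ?posrE ?expR_gt0 ?invr_gt0 ?exprn_gt0 ?mulr_gt0//.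
  have -> : t^-1 = j.+2%:R * (m * t)^-1.
    by rewrite invfM mulrA divff ?mul1r// gt_eqF.
  rewrite expRM_natl -exprVn lerXn2r// ?nnegrE ?expR_ge0//.
    by rewrite invr_ge0 mulr_ge0 ?ltW.
  by apply: le_trans (expR_ge1Dx _); rewrite lerDr.
apply: le_trans (ler_wpM2l _ h) _; first by rewrite invr_ge0 exprn_ge0// ltW.
rewrite exprMn mulrCA ler_wpM2l ?exprn_ge0 ?(ltW m0)//.
by rewrite -addn2 exprD mulKf// expf_neq0// gt_eqF.
Qed.

Lemma is_derive_bump j t :
  is_derive t (1 : R) (bump j) (bump j.+2 t - j%:R * bump j.+1 t).
Proof.
have [t0|t0|->] := ltgtP t 0.
- rewrite {2 3}/bump !ltNge (ltW t0)/= mulr0 subr0.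
  have D0 := is_derive_cst (0 : R) t (1 : R); apply: near_eq_is_derive D0.
  have : nbhs t [set s : R | s < 0] by apply: open_nbhs_nbhs; split => //; exact: open_lt.
  by apply: filterS => s /= s0; rewrite /bump ifN// -leNgt ltW.
- rewrite {2 3}/bump t0.
  apply: (@near_eq_is_derive _ _ _ (fun s : R => (s^-1) ^+ j * expR (- s^-1))).
    have : nbhs t [set s : R | 0 < s] by apply: open_nbhs_nbhs; split => //; exact: open_gt.
    by apply: filterS => s /= s0; rewrite /bump ifT// exprVn.
  have tn0 : t != 0 by rewrite gt_eqF.
  have V := is_deriveV tn0 (is_derive_id t (1 : R)).
  have X := is_deriveX j V; rewrite exprfctE in X.
  have E := @is_derive1_comp _ expR (fun s => - s^-1) t _ _ (is_derive_expR (- t^-1)) (is_deriveN V).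
  have Mx := is_deriveM X E.
  have [Mx1 Mx2] := Mx; apply: DeriveDef => //; rewrite [LHS]Mx2.
  rewrite /GRing.scale /= mulr1 opprK -!exprVn.
  set e := expR _; set u := t^-1.
  case: j {X E Mx Mx1 Mx2} => [|j] /=; first by rewrite !mul0r mulr0 addr0 subr0 expr0 mul1r mulrC.
  by rewrite !exprS; ring.
- have b0 i : bump i 0 = 0 by rewrite /bump ltxx.
  rewrite !b0 mulr0 subr0.
  have q0 : h^-1 *: ((bump j \o shift 0) (h *: (1:R)) - bump j 0) @[h --> (0:R)^'] --> (0:R).
    pose C : R := j.+2%:R ^+ j.+2.
    apply/cvgrPdist_le => /= eps eps0; near=> h.
    have hn0 : h != 0 by near: h; exact: nbhs_dnbhs_neq.
    rewrite b0 subr0 sub0r normrN addr0 [h *: 1]mulr1 [_ *: _]mulrC normrM normfV.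
    rewrite ler_pdivrMr ?normr_gt0// ger0_norm ?bump_ge0//.
    apply: (le_trans (bump_le_sqr j h)); rewrite -real_normK ?num_real// expr2 mulrA.
    rewrite ler_wpM2r// -/C mulrC -ler_pdivlMr ?exprn_gt0//.
    by near: h; apply: dnbhs0_le; rewrite divr_gt0// exprn_gt0.
  by apply: DeriveDef; [apply/cvg_ex; exists 0|exact: cvg_lim q0].
Unshelve. all: by end_near. Qed.

Lemma continuous_bump j : continuous (bump j).
Proof.
move=> t; apply: differentiable_continuous; apply/derivable1_diffP.
by case: (is_derive_bump j t).
Qed.

End bump.

Section chain_rule.
Variables (R : realType) (d : nat).
Local Notation mu := (ball_measure R d).

Lemma is_derive_comp_rV (f : R -> R) (T : 'rV[R]_d -> R) (x v : 'rV[R]_d) (a b : R) :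
  is_derive (T x) (1 : R) f a -> is_derive x v T b ->
  is_derive x v (fun y => f (T y)) (a * b).
Proof.
move=> fa Tb.
have line : is_derive (0 : R) (1 : R) (fun t => T (t *: v + x)) b.
  by apply: is_derive_along Tb => t; rewrite addr0 [t *: 1]mulr1.
have fline : is_derive (0 : R) (1 : R) (fun t => f (T (t *: v + x))) (a * b).
  apply: (@is_derive1_comp _ f (fun t => T (t *: v + x)) 0 a b) => //.
  by rewrite scale0r add0r.
by apply: is_derive_along fline => t; rewrite addr0 [t *: 1]mulr1.
Qed.

Lemma polyfn_is_derive (q : 'rV[R]_d -> R) x i : polyfn q ->
  is_derive x (delta_mx ord0 i) q (pd i q x).
Proof. by move=> pq; apply: DeriveDef => //; exact: polyfn_derivable. Qed.

Section bump_functions.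
Variable T : 'rV[R]_d -> R.
Hypothesis pT : polyfn T.

(** The polynomial factors absorb the inner derivatives of [T], which makes the class stable under
    [pd]. *)
Inductive bumpfn : ('rV[R]_d -> R) -> Prop :=
| bumpfn_mul j q : polyfn q -> bumpfn (fun x => q x * bump j (T x))
| bumpfnD f g : bumpfn f -> bumpfn g -> bumpfn (fun x => f x + g x).

Lemma bumpfn_continuous f : bumpfn f -> continuous f.
Proof.
elim=> [j q pq|g h _ cg _ ch]; last exact: continuousD_fun.
apply: continuousM_fun; first exact: polyfn_continuous.
move=> x; apply: (@continuous_comp _ _ _ T (bump j)); last exact: continuous_bump.
exact: polyfn_continuous.
Qed.

Lemma bumpfn_pd f i : bumpfn f ->
  (forall x, derivable f x (delta_mx ord0 i)) /\ bumpfn (pd i f).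
Proof.
elim=> [j q pq|g h _ [dg bg] _ [dh bh]].
  have D x := is_deriveM (polyfn_is_derive x i pq)
    (is_derive_comp_rV (is_derive_bump j (T x)) (polyfn_is_derive x i pT)).
  split=> [x|]; first by case: (D x).
  have -> : pd i (fun x => q x * bump j (T x)) = fun x =>
      pd i q x * bump j (T x) + ((q x * pd i T x) * bump j.+2 (T x) +
        (- j%:R * (q x * pd i T x)) * bump j.+1 (T x)).
    apply/funext => x; case: (D x) => _ E; rewrite [LHS]E /GRing.scale/=.
    by ring.
  have pqT := polyfnM pq (polyfn_pd i pT).
  apply: bumpfnD; first exact/bumpfn_mul/polyfn_pd.
  apply: bumpfnD; first exact: bumpfn_mul.
  exact: (bumpfn_mul _ (polyfnM (polyfn_cst d (- j%:R)) pqT)).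
split=> [x|]; first exact: (derivableD (dg x) (dh x)).
rewrite (_ : pd i _ = fun x => pd i g x + pd i h x); first exact: bumpfnD.
by apply/funext => x; exact: (deriveD (dg x) (dh x)).
Qed.

Lemma bumpfn_smooth f : bumpfn f -> smooth f.
Proof.
move=> bf s; have bs : bumpfn (partials s f).
  by elim: s => //= i s /bumpfn_pd-/(_ i)[].
split; first exact: bumpfn_continuous.
by move=> x i; case: (bumpfn_pd i bs).
Qed.

Lemma bumpfn_eq0 f x : bumpfn f -> T x < 0 -> f x = 0.
Proof.
move=> bf Tx; elim: bf => [j q _|g h _ -> _ ->]; last by rewrite addr0.
by rewrite /bump ltNge (ltW Tx) mulr0.
Qed.

Lemma bumpfn_test f : (forall x, 0 <= T x -> eball x) -> bumpfn f -> test_function f.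
Proof.
move=> TB bf; split; first exact: bumpfn_smooth.
exists [set x | 0 <= T x]; split => //; last first.
  by move=> x /= /negP; rewrite -ltNge; exact: bumpfn_eq0.
have cbox : compact [set x : 'rV[R]_d | forall i, `[-1, 1]%classic (x ord0 i)].
  have := @rV_compact R d (fun=> `[-1, 1]%classic).
  by apply => i; exact: segment_compact.
apply: subclosed_compact cbox _.
  have -> : [set x | 0 <= T x] = T @^-1` [set y | 0 <= y] by [].
  apply: closed_comp; last exact: closed_ge.
  by move=> x _; exact: polyfn_continuous.
by move=> x /TB xB i /=; rewrite in_itv/= -ler_norml eball_coord.
Qed.

End bump_functions.

Definition nsq (x : 'rV[R]_d) : R := \sum_(i < d) x ord0 i ^+ 2.

Lemma polyfn_nsq : polyfn nsq.
Proof. by apply: polyfn_sum => i; apply: polyfnX; exact: polyfn_coord. Qed.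

Lemma nsq_ge0 x : 0 <= nsq x.
Proof. by apply: sumr_ge0 => i _; exact: sqr_ge0. Qed.

Lemma enorm_sqr x : enorm x ^+ 2 = nsq x.
Proof. by rewrite sqr_sqrtr// nsq_ge0. Qed.

Lemma eballE x : eball x <-> nsq x < 1.
Proof. by rewrite /eball /= /enorm -[X in _ < X]sqrtr1 ltr_sqrt. Qed.

Lemma L2_mul_bounded (u h : 'rV[R]_d -> R) (M : R) : u \in Lfun mu 2%:E ->
  measurable_fun setT h -> (forall x, `|h x| <= M) ->
  (fun x => u x * h x) \in Lfun mu 2%:E.
Proof.
move=> u2 mh hM; have mu_ := L2_measurable u2.
have absu2 : (fun x => M * `|u x|) \in Lfun mu 2%:E.
  apply: L2Z; have mav : measurable_fun setT (fun x => `|u x|) by exact: measurableT_comp.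
  rewrite inE; apply/andP; split; rewrite inE//=.
  move: u2; rewrite inE => /andP[_]; rewrite inE/= /finite_norm; apply: le_lt_trans.
  by rewrite -[X in (_ <= X)%E]Lnorm_abse.
apply: L2_dom absu2 _ => [|x _]; first exact: measurable_funM.
by rewrite normrM mulrC ler_wpM2r.
Qed.

(** Orthogonality to [q] gives [|w| <= |w - q|], and the right-hand side can be made arbitrarily
    small. *)
Lemma L2_ortho_polyfn_eq0 (w : 'rV[R]_d -> R) : w \in Lfun mu 2%:E ->
  (forall q, polyfn q -> \int[mu]_x (w x * q x) = 0) -> {ae mu, forall x, w x = 0}.
Proof.
move=> w2 wq; apply: l2norm_eq0 => //; apply/eqP.
rewrite eq_le l2norm_ge0 andbT; apply/ler_addgt0Pr => eps eps0; rewrite add0r.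
have [q pq wqe] := polyfn_dense w2 eps0; apply: le_trans wqe.
have q2 := polyfn_L2 pq.
rewrite -(@ler_pXn2r _ 2)// ?nnegrE ?l2norm_ge0// !l2norm_sqr//; last exact: L2B.
have -> : \int[mu]_x (w x - q x) ^+ 2 =
    \int[mu]_x (w x ^+ 2) + (\int[mu]_x (q x ^+ 2) - 2 * \int[mu]_x (w x * q x)).
  have iq := Lfun2_integrable_sqr q2; have iw := Lfun2_integrable_sqr w2.
  have iwq := L2_mul_integrable w2 q2.
  rewrite -RintegralZl// -RintegralB//; last exact: (integrableZl measurableT 2 iwq).
  rewrite -RintegralD//; last first.
    exact: (integrableB measurableT iq (integrableZl measurableT 2 iwq)).
  by apply: eq_Rintegral => x _; ring.
rewrite wq// mulr0 subr0 lerDl.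
by apply: Rintegral_ge0 => x _; exact: sqr_ge0.
Qed.

(** [v] times a cut-off is orthogonal to every polynomial [q], because [q] times the cut-off is a
    test function; hence it vanishes. The cut-offs [bump 0 (T n)] are positive on balls that exhaust
    the unit ball. *)
Lemma L2_ortho_test_eq0 (v : 'rV[R]_d -> R) : v \in Lfun mu 2%:E ->
  (forall f, test_function f -> \int[mu]_x (v x * f x) = 0) ->
  {ae mu, forall x, v x = 0}.
Proof.
move=> v2 vf.
pose T n (x : 'rV[R]_d) : R := (1 - n.+1%:R^-1) - nsq x.
have pT n : polyfn (T n) by apply: polyfnB; [exact: polyfn_cst|exact: polyfn_nsq].
have TB n x : 0 <= T n x -> eball x.
  rewrite /T subr_ge0 => h; apply/eballE; apply: le_lt_trans h _.
  by rewrite gtrBl invr_gt0.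
have w0 n : {ae mu, forall x, v x * bump 0 (T n x) = 0}.
  have mb : measurable_fun setT (fun x => bump 0 (T n x)).
    apply: continuous_measurable_rV => x.
    apply: (@continuous_comp _ _ _ (T n) (bump 0)); last exact: continuous_bump.
    exact: polyfn_continuous.
  apply: L2_ortho_polyfn_eq0.
    apply: (L2_mul_bounded v2 mb (M := 1)) => x.
    by rewrite ger0_norm ?bump_ge0// bump0_le1.
  move=> q pq; rewrite -[RHS](vf (fun x => q x * bump 0 (T n x))).
    by apply: eq_Rintegral => x _; rewrite -mulrA [bump _ _ * _]mulrC.
  by apply: (bumpfn_test (pT n)); [exact: TB|exact: bumpfn_mul].
have := ae_foralln w0; apply: filterS2 (ball_measure_ae R d) => x /eballE xB vx.
have xB1 : 0 < 1 - nsq x by rewrite subr_gt0.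
have [N _ hN] := near_infty_natSinv_lt (PosNum xB1).
have /eqP := vx N; rewrite mulf_eq0 => /orP[/eqP//|].
have TN : 0 < T N x.
  have h : N.+1%:R^-1 < 1 - nsq x := hN N (leqnn N).
  by rewrite /T subr_gt0 ltrBrDl -ltrBrDr.
by rewrite /bump TN mulf_eq0 (gt_eqF (expR_gt0 _)) orbF expr0 invr1 oner_eq0.
Qed.

Lemma weak_deriv_uniq a (u v w : 'rV[R]_d -> R) :
  weak_deriv a u v -> weak_deriv a u w -> {ae mu, forall x, v x = w x}.
Proof.
move=> [v2 uv] [w2 uw].
have : {ae mu, forall x, v x - w x = 0}.
  apply: L2_ortho_test_eq0; first exact: L2B.
  move=> f tf; have f2 : f \in Lfun mu 2%:E.
    by apply: continuous_L2; have [sf _] := tf; case: (sf [::]).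
  have := uv f tf; rewrite uw// => /(congr1 (fun z => (-1) ^+ mi_order a * z)).
  rewrite !mulrA -exprMn mulrNN mulr1 expr1n !mul1r => wv.
  under eq_Rintegral do rewrite mulrBl.
  by rewrite RintegralB//; [rewrite wv subrr|exact: L2_mul_integrable|exact: L2_mul_integrable].
by apply: filterS => x /eqP; rewrite subr_eq0 => /eqP.
Qed.

Lemma wderiv_polyfn a (u q : 'rV[R]_d -> R) : polyfn q -> u \in Lfun mu 2%:E ->
  {ae mu, forall x, u x = q x} -> {ae mu, forall x, wderiv a u x = mpartial a q x}.
Proof.
move=> pq u2 uq; have uqW : weak_deriv a u (mpartial a q).
  apply: weak_deriv_ae (polyfn_weak_deriv a pq) => //; first exact: polyfn_L2.
  by apply: filterS uq => x ->.
apply: (@weak_deriv_uniq a u) => //.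
have /(xgetPex 0) : exists v, weak_deriv a u v by exists (mpartial a q).
by [].
Qed.

Lemma sobolev_norm_jet m (u : 'rV[R]_d -> R) v : jet m u v ->
  sobolev_norm m u = jet_norm m v.
Proof.
move=> uv; rewrite /sobolev_norm.
have -> : [set jet_norm m w | w in jet m u] = [set jet_norm m v].
  apply/seteqP; split => [_ [w uw <-]|_ ->]; last by exists v.
  congr Num.sqrt; apply: eq_bigr => a am; congr (_ ^+ 2).
  have wa := uw.2 _ am; have va := uv.2 _ am.
  apply: l2norm_ae; [by case: wa|by case: va|exact: weak_deriv_uniq wa va].
exact: inf1.
Qed.

Lemma l2norm_jet_le m (u : 'rV[R]_d -> R) v a : jet m u v -> (mi_order a <= m)%N ->
  l2norm (v a) <= sobolev_norm m u.
Proof.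
move=> uv am; rewrite (sobolev_norm_jet uv) /jet_norm.
have aS (i : 'I_d) : (a i < m.+1)%N.
  by rewrite ltnS (leq_trans _ am)// /mi_order (bigD1 i)//= leq_addr.
rewrite (bigD1 [ffun i => Ordinal (aS i)])/=; last first.
  rewrite (_ : mi_order _ = mi_order a)//.
  by apply: eq_bigr => i _; rewrite ffunE.
rewrite (_ : (fun i => _) = a); last by apply/funext => i; rewrite ffunE.
rewrite -[leLHS]ger0_norm ?l2norm_ge0// -sqrtr_sqr ler_sqrt.
  by rewrite lerDl sumr_ge0// => b _; exact: sqr_ge0.
by rewrite addr_ge0 ?sqr_ge0// sumr_ge0// => b _; exact: sqr_ge0.
Qed.

End chain_rule.

(** * Dissipativity *)

Section divergence.
Variables (R : realType) (d : nat).
Local Notation mu := (ball_measure R d).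
Local Notation pcst := (polyfn_cst d).
Implicit Types f g q : 'rV[R]_d -> R.

Lemma is_derive_pos_sqr (t : R) :
  is_derive t (1 : R) (fun s : R => Num.max 0 s ^+ 2) (2 * Num.max 0 t).
Proof.
have [t0|t0|->] := ltgtP t 0.
- rewrite mulr0; have D0 := is_derive_cst (0 : R) t (1 : R); apply: near_eq_is_derive D0.
  have : nbhs t [set s : R | s < 0] by apply: open_nbhs_nbhs; split => //; exact: open_lt.
  by apply: filterS => s /= s0; rewrite max_l ?(ltW s0)// expr0n.
- have D0 := is_deriveX 2 (is_derive_id t (1 : R)).
  have D1 : is_derive t (1 : R) (fun s : R => s ^+ 2) (2 * t).
    have [D2 D3] := D0; rewrite exprfctE in D2 D3; apply: DeriveDef => //.
    by rewrite [LHS]D3 [_ *: _]mulr1 expr1.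
  apply: near_eq_is_derive D1.
  have : nbhs t [set s : R | 0 < s] by apply: open_nbhs_nbhs; split => //; exact: open_gt.
  by apply: filterS => s /= s0; rewrite max_r ?(ltW s0).
- rewrite mulr0.
  pose w (s : R) := Num.max 0 s ^+ 2.
  have q0 : h^-1 *: ((w \o shift 0) (h *: (1:R)) - w 0) @[h --> (0:R)^'] --> (0:R).
    apply/cvgrPdist_le => /= eps eps0; near=> h.
    have hn0 : h != 0 by near: h; exact: nbhs_dnbhs_neq.
    rewrite /w maxxx expr0n/= subr0 sub0r normrN addr0 [h *: 1]mulr1.
    rewrite [_ *: _]mulrC normrM normfV ler_pdivrMr ?normr_gt0// normrX.
    have maxh : `|Num.max 0 h| <= `|h|.
      by rewrite /Num.max; case: ifP => // _; rewrite normr0.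
    apply: (@le_trans _ _ (`|h| ^+ 2)); first by rewrite lerXn2r// nnegrE.
    by rewrite expr2 ler_wpM2r//; near: h; exact: dnbhs0_le.
  by apply: DeriveDef; [apply/cvg_ex; exists 0|exact: cvg_lim q0].
Unshelve. all: by end_near. Qed.

Lemma pd_nsq i : pd i (@nsq R d) = fun x => 2 * x ord0 i.
Proof.
rewrite /nsq (pd_sum _ _ i (fun j => polyfnX 2 (polyfn_coord R j))).
apply/funext => x; rewrite (bigD1 i)//= big1 ?addr0 => [|j ji].
  under [X in pd i X]eq_fun do rewrite expr2.
  by rewrite (pdM i (polyfn_coord R i) (polyfn_coord R i)) pd_coord eqxx mul1r mulr1 mulr_natl.
under [X in pd i X]eq_fun do rewrite expr2.
by rewrite (pdM i (polyfn_coord R j) (polyfn_coord R j)) pd_coord eq_sym (negbTE ji) mul0r mulr0 addr0.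
Qed.

Lemma pdX f n i : polyfn f ->
  pd i (fun x => f x ^+ n) = fun x => n%:R * f x ^+ n.-1 * pd i f x.
Proof.
move=> pf; elim: n => [|n IH].
  under [X in pd i X]eq_fun do rewrite expr0.
  by rewrite pd_cst; apply/funext => x; rewrite !mul0r.
under [X in pd i X]eq_fun do rewrite exprS.
rewrite (pdM i pf (polyfnX n pf)) IH; apply/funext => x /=.
case: n {IH} => [|n] /=; first by rewrite expr0; ring.
by rewrite -[n.+2]addn1 natrD exprS; ring.
Qed.

(** On the ball, [1 - nsq] is its own positive part, and the square of the positive part is of class
    C^1 on the whole space. The exponent 2 serves this extension by zero. *)
Lemma integral_pd_vanishing i g : polyfn g ->
  \int[mu]_x pd i (fun x => (1 - nsq x) ^+ 2 * g x) x = 0.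
Proof.
move=> pg.
pose T (x : 'rV[R]_d) := 1 - nsq x.
have pT : polyfn T by apply: polyfnB; [exact: pcst|exact: polyfn_nsq].
have pTi : pd i T = fun x => - (2 * x ord0 i).
  rewrite /T (pdB i (pcst 1) (@polyfn_nsq R d)) pd_cst pd_nsq.
  by apply/funext => x; rewrite sub0r.
pose h x := Num.max 0 (T x) ^+ 2 * g x.
pose dh x := Num.max 0 (T x) ^+ 2 * pd i g x + g x * (2 * Num.max 0 (T x) * - (2 * x ord0 i)).
have hD x : is_derive x (delta_mx ord0 i) h (dh x).
  have DT := polyfn_is_derive x i pT; rewrite pTi in DT.
  exact: (is_deriveM (is_derive_comp_rV (is_derive_pos_sqr (T x)) DT) (polyfn_is_derive x i pg)).
have cT : continuous (fun x => Num.max 0 (T x)).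
  have cm : continuous (fun y : R => Num.max 0 y).
    by move=> y; apply: continuous_max; [exact: cvg_cst|exact: cvg_id].
  move=> x; apply: (@continuous_comp _ _ _ T (fun y => Num.max 0 y)); last exact: cm.
  exact: polyfn_continuous.
have cdh : continuous dh.
  apply: continuousD_fun; apply: continuousM_fun.
  - by under eq_fun do rewrite expr2; exact: continuousM_fun.
  - exact/polyfn_continuous/polyfn_pd.
  - exact: polyfn_continuous.
  - apply: continuousM_fun; first by apply: continuousM_fun => //; exact: continuous_cst_fun.
    apply: polyfn_continuous; apply: polyfnN; apply: polyfnM; [exact: pcst|exact: polyfn_coord].
have out x : ~ eball x -> Num.max 0 (T x) = 0.
  by move=> xB; apply/max_l; rewrite subr_le0 leNgt; apply/negP => /eballE.
rewrite -[RHS](integral_derive_ball hD cdh); last 2 first.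
- by move=> x /out; rewrite /h => ->; rewrite expr0n mul0r.
- by move=> x /out; rewrite /dh => ->; rewrite expr0n/= mulr0 mul0r mulr0 mul0r addr0.
apply: eq_Rintegral_ball.
- exact/polyfn_integrable/polyfn_pd/polyfnM/pg/polyfnX.
- exact/L2_integrable/continuous_L2.
move=> x /eballE xB; rewrite (pdM i (polyfnX 2 pT) pg) (pdX 2 i pT) pTi /dh.
have -> : Num.max 0 (T x) = T x by apply/max_r; rewrite subr_ge0 ltW.
by rewrite expr1 addrC [g x * _]mulrC.
Qed.

Lemma polyfn_Rintegral_cvg (f_ : nat -> 'rV[R]_d -> R) f (M : R) :
  (forall n, polyfn (f_ n)) -> polyfn f ->
  (forall n x, eball x -> `|f_ n x| <= M) ->
  (forall x, eball x -> f_ n x @[n --> \oo] --> f x) ->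
  \int[mu]_x f_ n x @[n --> \oo] --> \int[mu]_x f x.
Proof.
move=> pf_ pf fM fcvg.
have m1 n : measurable_fun [set: 'rV[R]_d] (EFin \o f_ n).
  by apply/measurable_EFinP; exact: (L2_measurable (polyfn_L2 (pf_ n))).
have m2 : measurable_fun [set: 'rV[R]_d] (EFin \o f).
  by apply/measurable_EFinP; exact: (L2_measurable (polyfn_L2 pf)).
have c1 : {ae mu, forall x, setT x -> (fun n => (f_ n x)%:E) @ \oo --> (f x)%:E}.
  apply: filterS (ball_measure_ae R d) => x xB _; apply/fine_cvgP; split.
    exact: nearW.
  exact: fcvg.
have d1 : {ae mu, forall x n, setT x -> (`| (f_ n x)%:E | <= (cst M x)%:E)%E}.
  by apply: filterS (ball_measure_ae R d) => x xB n _; rewrite abse_EFin lee_fin fM.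
have iM := polyfn_integrable (pcst M).
have fin : (\int[mu]_x (EFin \o f) x)%E \is a fin_num.
  exact/integrable_fin_num/polyfn_integrable.
have [_ _] := dominated_convergence measurableT m1 m2 c1 iM d1.
by rewrite -(fineK fin) => /fine_cvgP[_].
Qed.

(* The cut-offs [(1 - r ^ (2n)) ^ 2] are polynomials vanishing to second order on the
   sphere and tending to [1] inside, so no surface integral is needed: their
   gradient is [- 4n r ^ (2n-2) (1 - r ^ (2n)) x], whose contribution has a sign up
   to an error bounded by [n r ^ (2n-2) (1 - r ^ 2)]. *)
Lemma integral_div_le0 (F : 'I_d -> 'rV[R]_d -> R) (C : R) :
  (forall i, polyfn (F i)) -> 0 <= C ->
  (forall x, eball x -> \sum_i x ord0 i * F i x <= C * (1 - nsq x)) ->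
  \int[mu]_x (\sum_i pd i (F i) x) <= 0.
Proof.
move=> pF C0 FC.
pose chi n (x : 'rV[R]_d) := (1 - nsq x ^+ n) ^+ 2.
pose G n (x : 'rV[R]_d) := (\sum_(j < n) nsq x ^+ j) ^+ 2.
pose DF x := \sum_i pd i (F i) x.
have pDF : polyfn DF by apply: polyfn_sum => i; exact: polyfn_pd.
have pns n : polyfn (fun x : 'rV[R]_d => nsq x ^+ n) by apply: polyfnX; exact: polyfn_nsq.
have p1n n : polyfn (fun x : 'rV[R]_d => 1 - nsq x ^+ n) by apply: polyfnB => //; exact: pcst.
have pchi n : polyfn (chi n) by exact: polyfnX.
have pG n : polyfn (G n) by apply: polyfnX; exact: polyfn_sum.
(* The cut-offs are divisible by [(1 - nsq x) ^+ 2], so that [integral_pd_vanishing] applies to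
   them. *)
have chiG n x : chi n x = (1 - nsq x) ^+ 2 * G n x.
  by rewrite /chi /G -exprMn -[in LHS](expr1n R n) subrXX; under eq_bigr do rewrite expr1n mul1r.
have pdchi n i : pd i (chi n) = fun x =>
    - (4 * n%:R * nsq x ^+ n.-1 * (1 - nsq x ^+ n)) * x ord0 i.
  rewrite /chi (pdX 2 i (p1n n)) (pdB i (pcst 1) (pns n)) pd_cst.
  rewrite (pdX n i (@polyfn_nsq R d)) pd_nsq; apply/funext => x.
  by rewrite sub0r expr1; ring.
have E n : \int[mu]_x (chi n x * DF x) =
    \int[mu]_x (4 * n%:R * nsq x ^+ n.-1 * (1 - nsq x ^+ n) * (\sum_i x ord0 i * F i x)).
  have z : \int[mu]_x (\sum_i pd i (fun x => chi n x * F i x) x) = 0.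
    have pcF i : polyfn (fun x => chi n x * F i x) by exact: polyfnM.
    have ii i : mu.-integrable setT (EFin \o pd i (fun x => chi n x * F i x)).
      exact/polyfn_integrable/polyfn_pd.
    elim: (index_enum _) => [|i r IH].
      under eq_Rintegral do rewrite big_nil.
      by rewrite Rintegral_cst// mul0r.
    under eq_Rintegral do rewrite big_cons.
    rewrite RintegralD//; last by apply/polyfn_integrable/polyfn_sum => j; exact: polyfn_pd.
    rewrite IH addr0; have := integral_pd_vanishing i (polyfnM (pG n) (pF i)).
    by rewrite (_ : (fun x => _) = (fun x => chi n x * F i x))//; apply/funext => x; rewrite chiG mulrA.
  apply/eqP; rewrite -subr_eq0 -RintegralB//; last 2 first.
  - exact/polyfn_integrable/polyfnM.
  - apply/polyfn_integrable/polyfnM; last by apply: polyfn_sum => i; apply: polyfnM => //; exact: polyfn_coord.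
    by do 2 (apply: polyfnM => //); exact: pcst.
  rewrite -[X in _ == X]z; apply/eqP/eq_Rintegral => x _.
  rewrite /DF !mulr_sumr -sumrB; apply: eq_bigr => i _.
  by rewrite (pdM i (pchi n) (pF i)) pdchi; ring.
have t01 (x : 'rV[R]_d) : eball x -> 0 <= (nsq x : R) < 1 by move=> /eballE ->; rewrite nsq_ge0.
have c1 : \int[mu]_x (chi n x * DF x) @[n --> \oo] --> \int[mu]_x DF x.
  have [M hM] : exists M : R, forall x, eball x -> `|DF x| <= M.
    exact: continuous_eball_bounded (polyfn_continuous pDF).
  apply: (@polyfn_Rintegral_cvg _ _ M) => // [n|n x xB|x xB]; first exact: polyfnM.
    rewrite normrM; apply: le_trans (hM x xB); rewrite ler_piMl//.
    have /andP[t0 t1] := t01 x xB.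
    rewrite ger0_norm ?sqr_ge0// exprn_ile1 ?subr_ge0 ?exprn_ile1 ?(ltW t1)//.
    by rewrite gerBl exprn_ge0.
  have /andP[t0 t1] := t01 x xB.
  have chi1 : chi n x @[n --> \oo] --> (1 : R).
    have c0 : 1 - nsq x ^+ n @[n --> \oo] --> (1 : R).
      rewrite -[X in _ --> X]subr0; apply: cvgB; first exact: cvg_cst.
      by apply: cvg_expr; rewrite ger0_norm.
    by rewrite -[X in _ --> X](mulr1 (1:R)); exact: (cvgM c0 c0).
  by rewrite -[X in _ --> X]mul1r; apply: cvgM => //; exact: cvg_cst.
pose e n (x : 'rV[R]_d) : R := n%:R * nsq x ^+ n.-1 * (1 - nsq x).
have pe n : polyfn (e n).
  apply: polyfnM; first by apply: polyfnM => //; exact: pcst.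
  by apply: polyfnB; [exact: pcst|exact: polyfn_nsq].
have c2 : 4 * C * \int[mu]_x e n x @[n --> \oo] --> (0 : R).
  rewrite -[X in _ --> X](mulr0 (4 * C)); apply: cvgMl_tmp.
  have -> : (0 : R) = \int[mu]_x (cst 0 x) by rewrite Rintegral_cst// mul0r.
  apply: (@polyfn_Rintegral_cvg e (cst 0) 1) => //; first exact: pcst.
    move=> n x /t01 /andP[t0 t1]; rewrite /e ger0_norm ?mulr_ge0 ?exprn_ge0 ?subr_ge0 ?(ltW t1)//.
    (* With [t = nsq x], [t^(n-1)] is the least of the powers [t^j], [j < n], whose sum times
       [1 - t] is [1 - t^n]: the error terms are bounded by 1, as dominated convergence asks. *)
    apply: (@le_trans _ _ ((1 - nsq x) * \sum_(j < n) nsq x ^+ j)).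
      rewrite mulrC ler_wpM2l ?subr_ge0 ?(ltW t1)// mulr_natl.
      rewrite -[n in _ *+ n]card_ord -sumr_const; apply: ler_sum => j _.
      by apply: ler_wiXn2l; rewrite ?(ltW t1)//; case: (n) j => [[]//|m j]; rewrite -ltnS ltn_ord.
    have -> : (1 - nsq x) * \sum_(j < n) nsq x ^+ j = 1 - nsq x ^+ n.
      by rewrite -[in RHS](expr1n R n) subrXX; under [in RHS]eq_bigr do rewrite expr1n mul1r.
    by rewrite gerBl exprn_ge0.
  move=> x /t01 /andP[t0 t1].
  have [tx0|tn0] := eqVneq (nsq x : R) 0.
    apply: cvg_near_cst; exists 2%N => // n /= n2; rewrite /e /cst tx0.
    by case: n n2 => [|[|n]]// _; rewrite /= expr0n mulr0 mul0r.
  have eE n : n%:R * nsq x ^+ n * ((nsq x)^-1 * (1 - nsq x)) = e n x.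
    rewrite /e mulrA; congr (_ * _).
    case: n => [|n] /=; first by rewrite !mul0r.
    by rewrite exprSr mulrA mulfK.
  have lim0 : n%:R * nsq x ^+ n * ((nsq x)^-1 * (1 - nsq x)) @[n --> \oo] --> (0 : R).
    rewrite -[X in _ --> X](mul0r ((nsq x)^-1 * (1 - nsq x))).
    by apply: cvgMr_tmp; exact: cvg_natM_expr.
  by apply: cvg_near_eq lim0; exact: nearW.
rewrite -(cvg_lim _ c1)// -(cvg_lim _ c2)//; apply: ler_lim.
- by apply/cvg_ex; eexists; exact: c1.
- by apply/cvg_ex; eexists; exact: c2.
apply: nearW => n; rewrite E -RintegralZl//; last exact: polyfn_integrable.
apply: le_Rintegral_ball.
- apply/polyfn_integrable/polyfnM; last by apply: polyfn_sum => i; apply: polyfnM => //; exact: polyfn_coord.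
  by do 2 (apply: polyfnM => //); exact: pcst.
- by apply/polyfn_integrable/polyfnM => //; exact: pcst.
move=> x xB; have /andP[t0 t1] := t01 x xB.
have a0 : 0 <= 4 * n%:R * nsq x ^+ n.-1 * (1 - nsq x ^+ n) :> R.
  by rewrite !mulr_ge0 ?exprn_ge0// subr_ge0 exprn_ile1// ltW.
apply: le_trans (ler_wpM2l a0 (FC x xB)) _.
have -> : 4 * C * e n x = 4 * n%:R * nsq x ^+ n.-1 * (C * (1 - nsq x)).
  by rewrite /e; ring.
rewrite ler_wpM2r//; first by rewrite mulr_ge0// subr_ge0 ltW.
by rewrite ler_piMr ?mulr_ge0 ?exprn_ge0// gerBl exprn_ge0.
Qed.

Definition grad2 f (x : 'rV[R]_d) : R := \sum_i pd i f x ^+ 2.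
Definition xgrad f (x : 'rV[R]_d) : R := \sum_i x ord0 i * pd i f x.
Definition lapl f (x : 'rV[R]_d) : R := \sum_i pd i (pd i f) x.

Lemma polyfn_grad2 f : polyfn f -> polyfn (grad2 f).
Proof. by move=> pf; apply: polyfn_sum => i; exact/polyfnX/polyfn_pd. Qed.

Lemma polyfn_xgrad f : polyfn f -> polyfn (xgrad f).
Proof.
by move=> pf; apply: polyfn_sum => i; apply: polyfnM; [exact: polyfn_coord|exact: polyfn_pd].
Qed.

Lemma polyfn_lapl f : polyfn f -> polyfn (lapl f).
Proof. by move=> pf; apply: polyfn_sum => i; exact/polyfn_pd/polyfn_pd. Qed.

Lemma pd_xgrad f i : polyfn f -> pd i (xgrad f) = fun x => pd i f x + xgrad (pd i f) x.
Proof.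
move=> pf; have px j : polyfn (fun x : 'rV[R]_d => x ord0 j * pd j f x).
  by apply: polyfnM; [exact: polyfn_coord|exact: polyfn_pd].
rewrite /xgrad (pd_sum _ _ i px); apply/funext => x.
have -> : pd i f x = \sum_j (i == j)%:R * pd j f x.
  rewrite (bigD1 i)//= eqxx mul1r big1 ?addr0// => j ji.
  by rewrite eq_sym (negbTE ji) mul0r.
rewrite -big_split/=; apply: eq_bigr => j _.
by rewrite (pdM i (polyfn_coord R j) (polyfn_pd j pf)) pd_coord pdC.
Qed.

Lemma pd_lapl f i : polyfn f -> pd i (lapl f) = lapl (pd i f).
Proof.
move=> pf; rewrite /lapl (pd_sum _ _ i (fun j => polyfn_pd j (polyfn_pd j pf))).
apply/funext => x; apply: eq_bigr => j _.
by rewrite pdC; [rewrite [pd i _]pdC|exact: polyfn_pd].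
Qed.

(* The two components of the operator for [c = 2 / (p - 1)], so that
   [(p + 1) / (p - 1) = c + 1]. *)
Definition wave1 (c : R) f g x := g x - xgrad f x - c * f x.
Definition wave2 (c : R) f g x := lapl f x - xgrad g x - (c + 1) * g x.

Lemma polyfn_wave1 c f g : polyfn f -> polyfn g -> polyfn (wave1 c f g).
Proof.
move=> pf pg; apply: polyfnB; first by apply: polyfnB => //; exact: polyfn_xgrad.
exact: polyfnM (pcst c) pf.
Qed.

Lemma polyfn_wave2 c f g : polyfn f -> polyfn g -> polyfn (wave2 c f g).
Proof.
move=> pf pg; apply: polyfnB; last exact: polyfnM (pcst _) pg.
by apply: polyfnB; [exact: polyfn_lapl|exact: polyfn_xgrad].
Qed.

Lemma pd_wave1 c f g i : polyfn f -> polyfn g ->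
  pd i (wave1 c f g) = wave1 (c + 1) (pd i f) (pd i g).
Proof.
move=> pf pg; rewrite /wave1.
have pgx := polyfnB pg (polyfn_xgrad pf).
rewrite (pdB i pgx (polyfnM (pcst c) pf)) (pdB i pg (polyfn_xgrad pf)) (pdZ c i pf).
rewrite pd_xgrad//; apply/funext => x.
move: (pd i g x) (pd i f x) (xgrad _ x) => a b e; ring.
Qed.

Lemma pd_wave2 c f g i : polyfn f -> polyfn g ->
  pd i (wave2 c f g) = wave2 (c + 1) (pd i f) (pd i g).
Proof.
move=> pf pg; rewrite /wave2.
have pgx := polyfnB (polyfn_lapl pf) (polyfn_xgrad pg).
rewrite (pdB i pgx (polyfnM (pcst _) pg)) (pdB i (polyfn_lapl pf) (polyfn_xgrad pg)) (pdZ _ i pg).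
rewrite pd_lapl// pd_xgrad//; apply/funext => x.
move: (lapl _ x) (pd i g x) (xgrad _ x) => a b e; ring.
Qed.

Lemma partials_wave c f g s : polyfn f -> polyfn g ->
  partials s (wave1 c f g) = wave1 (c + (size s)%:R) (partials s f) (partials s g) /\
  partials s (wave2 c f g) = wave2 (c + (size s)%:R) (partials s f) (partials s g).
Proof.
move=> pf pg; elim: s => [|i s [IH1 IH2]]; first by rewrite addr0.
have ps1 := polyfn_partials s pf; have ps2 := polyfn_partials s pg.
have consE h : partials (i :: s) h = pd i (partials s h) by [].
have -> : (size (i :: s))%:R = (size s)%:R + 1 :> R by rewrite natr1.
rewrite !consE IH1 IH2 addrA.
by split; [exact: pd_wave1|exact: pd_wave2].
Qed.

(** The term [f * f'] completes the gradient to the H^1 inner product; the gradient alone would not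
    see the constants. *)
Definition form1 f g f' g' : R :=
  \int[mu]_x (\sum_i pd i f x * pd i f' x + g x * g' x + f x * f' x).

Let sum_split (A B C E : 'I_d -> R) (k u : R) :
  \sum_i (A i + u * B i - 2^-1 * k - (C i + u * E i)) =
  \sum_i A i + u * (\sum_i B i) - d%:R / 2 * k - (\sum_i C i + u * (\sum_i E i)).
Proof.
have -> : d%:R / 2 * k = \sum_(i < d) 2^-1 * k.
  by rewrite sumr_const card_ord -[RHS]mulr_natl mulrA.
rewrite !mulr_sumr -big_split/= -big_split/= -sumrB -sumrB.
by apply: eq_bigr.
Qed.

(** The flux is [F = g grad f - x (|grad f|^2 + g^2) / 2]. By Cauchy-Schwarz
    [x . F <= (1 - |x|^2) g^2 / 2], so that [integral_div_le0] applies. Twice the integrand is twice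
    the divergence of [F], plus [(d - 2 - 2 c) (|grad f|^2 + g^2)], plus products with [f]; for
    [c >= 0] the last two are at most [d + 2] times the energy density. *)
Lemma form1_dissipative (c : R) f g : 0 <= c -> polyfn f -> polyfn g ->
  2 * form1 (wave1 c f g) (wave2 c f g) f g <= (d%:R + 2) * form1 f g f g.
Proof.
move=> c0 pf pg.
pose F i x := g x * pd i f x - 2^-1 * (x ord0 i * (grad2 f x + g x ^+ 2)).
have pq : polyfn (fun x => grad2 f x + g x ^+ 2).
  by apply: polyfnD; [exact: polyfn_grad2|exact: polyfnX].
have pxq i : polyfn (fun x : 'rV[R]_d => x ord0 i * (grad2 f x + g x ^+ 2)).
  by apply: polyfnM => //; exact: polyfn_coord.
have pgf i : polyfn (fun x => g x * pd i f x) by apply: polyfnM => //; exact: polyfn_pd.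
have pF i : polyfn (F i) by apply: polyfnB => //; exact: polyfnM (pcst _) (pxq i).
have [M hM] : exists M : R, forall x, eball x -> `|g x| <= M.
  exact: continuous_eball_bounded (polyfn_continuous pg).
have cauchy x : xgrad f x ^+ 2 <= nsq x * grad2 f x.
  rewrite /xgrad /nsq /grad2; set a := \sum_i x ord0 i ^+ 2; set b := \sum_i pd i f x ^+ 2.
  have h0 (y z : R) : 0 <= \sum_i (y * x ord0 i + z * pd i f x) ^+ 2.
    by apply: sumr_ge0 => i _; exact: sqr_ge0.
  have hE (y z : R) : \sum_i (y * x ord0 i + z * pd i f x) ^+ 2 =
      y ^+ 2 * a + 2 * y * z * (\sum_i x ord0 i * pd i f x) + z ^+ 2 * b.
    rewrite !mulr_sumr -!big_split/=; apply: eq_bigr => i _.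
    by move: (pd i f x) => u; ring.
  set t := \sum_i x ord0 i * pd i f x in hE *.
  have a0 : 0 <= a by apply: sumr_ge0 => i _; exact: sqr_ge0.
  have [az|an0] := eqVneq a 0.
    have x0 i : x ord0 i = 0.
      have /psumr_eq0P : a = 0 := az.
      by move=> /(_ (fun i _ => sqr_ge0 _) i isT)/eqP; rewrite sqrf_eq0 => /eqP.
    by rewrite /t big1 ?expr0n ?az ?mul0r// => i _; rewrite x0 mul0r.
  have := h0 (- t) a; rewrite hE => h.
  have ap : 0 < a by rewrite lt_neqAle eq_sym an0.
  rewrite -subr_ge0 -(pmulr_rge0 _ ap); apply: le_trans h _.
  by rewrite le_eqVlt; apply/orP; left; apply/eqP; ring.
have div0 : \int[mu]_x (\sum_i pd i (F i) x) <= 0.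
  apply: (@integral_div_le0 F (M ^+ 2)) => //; first exact: sqr_ge0.
  move=> x xB; have -> : \sum_i x ord0 i * F i x =
      g x * xgrad f x - 2^-1 * nsq x * (grad2 f x + g x ^+ 2).
    rewrite /F /xgrad /nsq; move: (grad2 f x + _) => q.
    rewrite !mulr_sumr mulr_suml -sumrB; apply: eq_bigr => i _.
    by move: (pd i f x) (g x) => u v; ring.
  have := cauchy x; have := sqr_ge0 (g x - xgrad f x).
  have gM : g x ^+ 2 <= M ^+ 2.
    rewrite -real_normK ?num_real// lerXn2r ?nnegrE//; last exact: hM.
    by rewrite (le_trans _ (hM x xB)).
  have /eballE/ltW := xB; have := nsq_ge0 x.
  move: (nsq x) (grad2 f x) (xgrad f x) (g x) gM => t G2 X v gM t0 t1 h1 h2.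
  have : v ^+ 2 * (1 - t) <= M ^+ 2 * (1 - t) by rewrite ler_wpM2r// subr_ge0.
  have : 0 <= v ^+ 2 * (1 - t) by rewrite mulr_ge0 ?sqr_ge0// subr_ge0.
  have vE : (v - X) ^+ 2 = v ^+ 2 + X ^+ 2 - 2 * (v * X) by ring.
  rewrite vE in h1; nra.
have pw1 := polyfn_wave1 c pf pg; have pw2 := polyfn_wave2 c pf pg.
have pform f' g' f'' g'' : polyfn f' -> polyfn g' -> polyfn f'' -> polyfn g'' ->
    polyfn (fun x => \sum_i pd i f' x * pd i f'' x + g' x * g'' x + f' x * f'' x).
  move=> ? ? ? ?; apply: polyfnD; last exact: polyfnM.
  apply: polyfnD; last exact: polyfnM.
  by apply: polyfn_sum => i; apply: polyfnM; exact: polyfn_pd.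
have pdiv : polyfn (fun x => \sum_i pd i (F i) x) by apply: polyfn_sum => i; exact: polyfn_pd.
rewrite /form1 -RintegralZl//; last exact/polyfn_integrable/pform.
rewrite -RintegralZl//; last exact/polyfn_integrable/pform.
apply: (@le_trans _ _ (\int[mu]_x (2 * (\sum_i pd i (F i) x) + (d%:R + 2) *
    (\sum_i pd i f x * pd i f x + g x * g x + f x * f x)))); last first.
  rewrite RintegralD//; last 2 first.
  - exact: (polyfn_integrable (polyfnM (pcst 2) pdiv)).
  - exact: (polyfn_integrable (polyfnM (pcst _) (pform _ _ _ _ pf pg pf pg))).
  rewrite RintegralZl//; last exact: polyfn_integrable.
  by rewrite gerDr pmulr_rle0.
apply: le_Rintegral_ball.
- exact: (polyfn_integrable (polyfnM (pcst 2) (pform _ _ _ _ pw1 pw2 pf pg))).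
- apply: polyfn_integrable; apply: (polyfnD (polyfnM (pcst 2) pdiv)).
  exact: (polyfnM (pcst _) (pform _ _ _ _ pf pg pf pg)).
move=> x xB.
have pdF i : pd i (F i) x = pd i g x * pd i f x + g x * pd i (pd i f) x
    - 2^-1 * (grad2 f x + g x ^+ 2)
    - (x ord0 i * \sum_j pd j f x * pd i (pd j f) x + g x * (x ord0 i * pd i g x)).
  rewrite /F (pdB i (pgf i) (polyfnM (pcst _) (pxq i))) (pdZ _ i (pxq i)).
  rewrite (pdM i pg (polyfn_pd i pf)) (pdM i (polyfn_coord R i) pq) pd_coord eqxx mul1r.
  rewrite (pdD i (polyfn_grad2 pf) (polyfnX 2 pg)) (pdX 2 i pg).
  have -> : pd i (grad2 f) = fun x => 2 * \sum_j pd j f x * pd i (pd j f) x.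
    rewrite /grad2 (pd_sum _ _ i (fun j => polyfnX 2 (polyfn_pd j pf))).
    apply/funext => y; rewrite mulr_sumr; apply: eq_bigr => j _.
    by rewrite (pdX 2 i (polyfn_pd j pf)) expr1 mulrA.
  rewrite expr1; move: (\sum_j _) (pd i (pd i f) x) (pd i f x) (pd i g x) (grad2 f x) (g x) => *.
  by field.
have w1E i : pd i (wave1 c f g) x = pd i g x - (pd i f x + xgrad (pd i f) x) - c * pd i f x.
  by rewrite pd_wave1// /wave1 mulrDl mul1r; move: (xgrad _ x) (pd i f x) (pd i g x) => *; ring.
(* In [d / 2 - 1 - c], the term [d / 2] undoes the divergence of [x / 2] in [F], and [- 1 - c] comes
   from the commutator of [pd i] with [xgrad] in the first component and from the coefficient
   [c + 1] in the second. *)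
have sumE : \sum_i pd i (wave1 c f g) x * pd i f x + wave2 c f g x * g x =
    \sum_i pd i (F i) x + (d%:R / 2 - 1 - c) * grad2 f x + (d%:R / 2 - 1 - c) * g x ^+ 2.
  under eq_bigr do rewrite w1E.
  under [in RHS]eq_bigr do rewrite pdF.
  have cross : \sum_i xgrad (pd i f) x * pd i f x =
      \sum_i x ord0 i * \sum_j pd j f x * pd i (pd j f) x.
    under eq_bigr do rewrite /xgrad mulr_suml.
    rewrite exchange_big/=; apply: eq_bigr => j _; rewrite mulr_sumr.
    by apply: eq_bigr => i _; rewrite mulrAC mulrA.
  have s1 : \sum_i (pd i g x - (pd i f x + xgrad (pd i f) x) - c * pd i f x) * pd i f x =
      \sum_i pd i g x * pd i f x - (c + 1) * grad2 f x - \sum_i xgrad (pd i f) x * pd i f x.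
    rewrite /grad2 !mulr_sumr -!sumrB; apply: eq_bigr => i _.
    by move: (xgrad _ x) (pd i f x) (pd i g x) => *; ring.
  have s2 : \sum_i (pd i g x * pd i f x + g x * pd i (pd i f) x
      - 2^-1 * (grad2 f x + g x ^+ 2)
      - (x ord0 i * \sum_j pd j f x * pd i (pd j f) x + g x * (x ord0 i * pd i g x))) =
    \sum_i pd i g x * pd i f x + g x * lapl f x - d%:R / 2 * (grad2 f x + g x ^+ 2)
      - (\sum_i x ord0 i * \sum_j pd j f x * pd i (pd j f) x + g x * xgrad g x).
    exact: sum_split.
  rewrite s1 s2 cross /wave2.
  move: (\sum_i x ord0 i * _) (\sum_i pd i g x * _) (lapl f x) (xgrad g x) (grad2 f x) (g x) => *.
  by field.
have -> : 2 * (\sum_i pd i (wave1 c f g) x * pd i f x + wave2 c f g x * g x + wave1 c f g x * f x) =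
    2 * (\sum_i pd i (F i) x) + (d%:R - 2 - 2 * c) * (grad2 f x + g x ^+ 2) +
    2 * (f x * (g x - xgrad f x - c * f x)).
  rewrite sumE /wave1; move: (\sum_i _) (grad2 f x) (xgrad f x) (f x) (g x) => *.
  by field.
rewrite -addrA lerD2l.
have -> : \sum_i pd i f x * pd i f x = grad2 f x by apply: eq_bigr => i _; rewrite expr2.
have := cauchy x; have := sqr_ge0 (g x - f x); have := sqr_ge0 (f x + xgrad f x).
have g20 : 0 <= grad2 f x by apply: sumr_ge0 => i _; exact: sqr_ge0.
have /eballE/ltW t1 := xB.
have tg : nsq x * grad2 f x <= grad2 f x by rewrite ler_piMl.
have d0 : 0 <= d%:R :> R by [].
have ff := sqr_ge0 (f x); have gg := sqr_ge0 (g x).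
move: (nsq x * grad2 f x) tg => tG tg.
move: (grad2 f x) (xgrad f x) (f x) (g x) tg g20 ff gg => G2 X u v tg g20 ff gg h1 h2 h3.
have e1 : 0 <= c * G2 by rewrite mulr_ge0.
have e2 : 0 <= c * v ^+ 2 by rewrite mulr_ge0.
have e3 : 0 <= c * u ^+ 2 by rewrite mulr_ge0.
have e4 : 0 <= d%:R * u ^+ 2 by rewrite mulr_ge0.
rewrite !expr2 in h1 h2 h3 e2 e3 e4 ff gg *.
nra.
Qed.

End divergence.

(** * Polynomial approximation of a function with its derivatives *)

Section weierstrass.
Variable R : realType.
Implicit Types (F : nat -> R -> R) (f g : R -> R) (u v : nat -> R) (x t L M : R).

(* The Bernstein polynomial [\sum_k 'C(n, k) u_k X^k (1 - X)^(n - k)], i.e. the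
   expectation of [u] under the binomial law, generated by conditioning on the
   first trial. *)
Fixpoint bernstein n u : {poly R} :=
  if n is n'.+1 then 'X * bernstein n' (u \o S) + (1 - 'X) * bernstein n' u
  else (u 0%N)%:P.

Lemma bernsteinS n u x : (bernstein n.+1 u).[x] =
  x * (bernstein n (u \o S)).[x] + (1 - x) * (bernstein n u).[x].
Proof. by rewrite /= !hornerE. Qed.

Lemma le_bernstein n u v x : 0 <= x -> x <= 1 ->
  (forall k, (k <= n)%N -> u k <= v k) -> (bernstein n u).[x] <= (bernstein n v).[x].
Proof.
move=> x0 x1; elim: n u v => [|n IH] u v uv; first by rewrite /= !hornerC uv.
rewrite !bernsteinS; apply: lerD; rewrite ler_wpM2l ?subr_ge0//; apply: IH => k kn.
  by apply: uv; rewrite ltnS.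
by apply: uv; exact: leqW.
Qed.

(** The variance [n x (1 - x)] of the binomial law. The centre [c] is arbitrary because conditioning
    on the first trial shifts it by one. *)
Lemma bernstein_affine_sqr n (a b c x : R) :
  (bernstein n (fun k => a + b * (k%:R - c) ^+ 2)).[x] =
  a + b * (n%:R * x * (1 - x) + (n%:R * x - c) ^+ 2).
Proof.
elim: n c => [|n IH] c; first by rewrite /= hornerC; ring.
rewrite bernsteinS IH.
have -> : (fun k => a + b * (k%:R - c) ^+ 2) \o S = fun k => a + b * (k%:R - (c - 1)) ^+ 2.
  by apply/funext => k /=; rewrite -[k.+1%:R]natr1; congr (_ + _ * _ ^+ 2); ring.
by rewrite IH -[n.+1%:R]natr1; ring.
Qed.

Lemma lipschitz_bernstein f M : (forall x y, 0 <= x -> x <= 1 -> 0 <= y -> y <= 1 ->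
    `|f x - f y| <= M * `|x - y|) -> forall eps : R, 0 < eps ->
  exists q : {poly R}, forall x, 0 <= x -> x <= 1 -> `|f x - q.[x]| <= eps.
Proof.
move=> fM eps eps0.
have M0 : 0 <= M.
  have := fM 0 1 (lexx _) ler01 ler01 (lexx _); rewrite sub0r normrN normr1 mulr1.
  exact: le_trans.
pose M1 := M + 1; have M10 : 0 < M1 by rewrite ltr_wpDl.
pose eta := eps / (2 * M1); have eta0 : 0 < eta by rewrite divr_gt0// mulr_gt0.
have [n nlt] : exists n : nat, 2 * M1 / (eta * eps) < n.+1%:R :> R.
  exists (Num.truncn (2 * M1 / (eta * eps))); apply: truncnS_gt.
have n0 : 0 < n.+1%:R :> R by [].
exists (bernstein n.+1 (fun k => f (k%:R / n.+1%:R))) => x x0 x1.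
(* [z <= eta + z ^+ 2 / eta] replaces the distance by a quadratic function, whose binomial
   expectation is known. *)
have err k : (k <= n.+1)%N -> `|f x - f (k%:R / n.+1%:R)| <=
    M1 * eta + M1 / eta / n.+1%:R ^+ 2 * (k%:R - n.+1%:R * x) ^+ 2.
  move=> kn; have y0 : 0 <= k%:R / n.+1%:R :> R by rewrite divr_ge0.
  have y1 : k%:R / n.+1%:R <= 1 :> R by rewrite ler_pdivrMr// mul1r ler_nat.
  apply: (le_trans (fM _ _ x0 x1 y0 y1)).
  have -> : M1 / eta / n.+1%:R ^+ 2 * (k%:R - n.+1%:R * x) ^+ 2 =
      M1 * (`|x - k%:R / n.+1%:R| ^+ 2 / eta).
    rewrite real_normK ?num_real//.
    by field; rewrite -/n.+1 [1 + n%:R]addrC natr1 !gt_eqF.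
  rewrite -mulrDr; set z := `|_ - _|; have z0 : 0 <= z := normr_ge0 _.
  apply: ler_pM => //; first by rewrite lerDl.
  have := sqr_ge0 (z - eta); rewrite -subr_ge0.
  have -> : eta + z ^+ 2 / eta - z = ((z - eta) ^+ 2 + z * eta) / eta by field; rewrite gt_eqF.
  by move=> h; rewrite divr_ge0 ?(ltW eta0)// addr_ge0// mulr_ge0// ltW.
have E0 : M1 * eta = eps / 2 by rewrite /eta; field; rewrite !gt_eqF.
have small : M1 / eta / n.+1%:R ^+ 2 * (n.+1%:R * x * (1 - x)) <= eps / 2.
  have -> : M1 / eta / n.+1%:R ^+ 2 * (n.+1%:R * x * (1 - x)) =
      M1 / eta / n.+1%:R * (x * (1 - x)).
    by field; rewrite [1 + n%:R]addrC natr1 !gt_eqF.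
  apply: (@le_trans _ _ (M1 / eta / n.+1%:R)).
    by rewrite ler_piMr ?divr_ge0 ?(ltW M10) ?(ltW eta0)//; nra.
  rewrite ler_pdivrMr// ltW//; move: nlt.
  rewrite ltr_pdivrMr; last exact: mulr_gt0.
  rewrite ltr_pdivrMr// => h.
  by move: h; lra.
rewrite ler_norml; apply/andP; split.
- rewrite lerNl opprB lerBlDr.
  apply: (@le_trans _ _ ((bernstein n.+1 (fun k => (f x + M1 * eta) +
    M1 / eta / n.+1%:R ^+ 2 * (k%:R - n.+1%:R * x) ^+ 2)).[x])).
    apply: le_bernstein => // k /err; rewrite ler_norml => /andP[+ _].
    by set s := _ * _ ^+ 2; lra.
  rewrite bernstein_affine_sqr subrr expr0n addr0 E0.
  by move: small; set s := _ * _ => h; rewrite -addrA addrC lerD2r; lra.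
- rewrite lerBlDr -lerBlDl.
  apply: (@le_trans _ _ ((bernstein n.+1 (fun k => (f x - M1 * eta) +
    - (M1 / eta / n.+1%:R ^+ 2) * (k%:R - n.+1%:R * x) ^+ 2)).[x])); last first.
    apply: le_bernstein => // k /err; rewrite ler_norml => /andP[_].
    by rewrite mulNr; set s := _ * _ ^+ 2; lra.
  rewrite bernstein_affine_sqr subrr expr0n addr0 E0 mulNr.
  by move: small; set s := _ * _ => h; lra.
Qed.

Definition tower F := forall j t, is_derive t (1 : R) (F j) (F j.+1 t).

Lemma tower_continuous F j : tower F -> continuous (F j).
Proof.
move=> TF t; apply: differentiable_continuous; apply/derivable1_diffP.
by case: (TF j t).
Qed.

Lemma is_derive_poly (q : {poly R}) t : is_derive t (1 : R) (fun s => q.[s]) q^`().[t].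
Proof.
elim/poly_ind: q => [|q c IH].
  rewrite deriv0 horner0 (_ : (fun s => _) = cst 0); first exact: is_derive_cst.
  by apply/funext => s; rewrite horner0.
rewrite derivMXaddC !hornerE (_ : (fun s => _) = (fun s => q.[s] * s + c)); last first.
  by apply/funext => s; rewrite !hornerE.
have := is_deriveD (is_deriveM IH (is_derive_id t (1 : R))) (is_derive_cst c t (1 : R)).
by move=> [D1 D2]; apply: DeriveDef => //; rewrite [LHS]D2 /GRing.scale/=; ring.
Qed.

Lemma mean_value_le (f df : R -> R) (M a b : R) :
  (forall t, is_derive t (1 : R) f (df t)) -> a <= b ->
  (forall t, a <= t -> t <= b -> `|df t| <= M) -> `|f b - f a| <= M * (b - a).
Proof.
move=> fD ab dM.
have fc : {within `[a, b], continuous f}.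
  apply: continuous_subspaceT => t; apply: differentiable_continuous.
  by apply/derivable1_diffP; case: (fD t).
have [c] := MVT_segment ab (fun t _ => fD t) fc.
rewrite in_itv/= => /andP[ac cb] ->.
by rewrite normrM [`|b - a|]ger0_norm ?subr_ge0// ler_wpM2r ?subr_ge0// dM.
Qed.

Lemma continuous_bounded_segment f (a b : R) : continuous f ->
  exists M : R, 0 <= M /\ forall t, a <= t -> t <= b -> `|f t| <= M.
Proof.
move=> cf.
have : compact (f @` `[a, b]).
  by apply: continuous_compact; [exact: continuous_subspaceT|exact: segment_compact].
move=> /compact_bounded[M [_ /(_ (`|M| + 1))]].
have -> : M < `|M| + 1 by rewrite (le_lt_trans (ler_norm _))// ltrDl.
move=> /(_ isT) hM; exists (`|M| + 1); split=> [|t ta tb]; first by rewrite addr_ge0.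
by apply: hM; exists t => //=; rewrite in_itv/= ta tb.
Qed.

Definition antideriv (q : {poly R}) : {poly R} :=
  \poly_(i < (size q).+1) (q`_i.-1 / i%:R).

Lemma deriv_antideriv q : (antideriv q)^`() = q.
Proof.
apply/polyP => i; rewrite /antideriv coef_deriv coef_poly ltnS.
case: ltnP => iq /=; last by rewrite mul0rn nth_default.
by rewrite -[LHS]mulr_natr mulfVK// pnatr_eq0.
Qed.

(** Only the top derivative is approximated directly, by a Bernstein polynomial. The lower ones
    follow by taking antiderivatives with the right value at 0, each of which multiplies the error
    by at most [L]. *)
Lemma tower_approx N F L (eps : R) : tower F -> 0 < L -> 0 < eps ->
  exists q : {poly R}, forall j t, (j <= N)%N -> 0 <= t -> t <= L ->
    `|F j t - q^`(j).[t]| <= eps.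
Proof.
move=> TF L0; elim: N F eps TF => [|N IH] F eps TF eps0.
  have [M [M0 FM]] := continuous_bounded_segment 0 L (tower_continuous (j := 1%N) TF).
  have lip x y : 0 <= x -> x <= 1 -> 0 <= y -> y <= 1 ->
      `|F 0%N (L * x) - F 0%N (L * y)| <= L * M * `|x - y|.
    move=> x0 x1 y0 y1; wlog xy : x y x0 x1 y0 y1 / y <= x.
      by move=> H; have [/H|/ltW/H] := leP y x; [apply|rewrite distrC [`|x - y|]distrC; apply].
    rewrite [`|x - y|]ger0_norm ?subr_ge0//.
    have -> : L * M * (x - y) = M * (L * x - L * y) by ring.
    apply: (mean_value_le (TF 0%N)); first by rewrite ler_pM2l.
    move=> t t1 t2; apply: FM; first by apply: le_trans t1; rewrite mulr_ge0// ltW.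
    by apply: (le_trans t2); rewrite ler_piMr// ltW.
  have [q qP] := lipschitz_bernstein lip eps0.
  exists (q \Po (L^-1 *: 'X)) => j t; rewrite leqn0 => /eqP -> t0 tL.
  rewrite derivn0 horner_comp hornerZ hornerX.
  have := qP (L^-1 * t); rewrite mulVKf ?gt_eqF//; apply.
    by rewrite mulr_ge0// invr_ge0 ltW.
  by rewrite ler_pdivrMl// mulr1.
pose e := eps / (L + 1); have L1 : 0 < L + 1 by rewrite addr_gt0.
have [q qP] := IH (fun j => F j.+1) e (fun j => TF j.+1) (divr_gt0 eps0 L1).
have e_le : e <= eps by rewrite /e ler_pdivrMr// ler_pMr// lerDr ltW.
have Le : L * e <= eps.
  by rewrite /e mulrA ler_pdivrMr// mulrC ler_pM2l// lerDl.
exists (antideriv q + (F 0%N 0 - (antideriv q).[0])%:P) => -[|j] t jN t0 tL; last first.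
  rewrite derivSn derivD derivC addr0 deriv_antideriv.
  by apply: le_trans e_le; exact: qP.
rewrite derivn0 hornerD hornerC.
pose G s := F 0%N s - (antideriv q).[s].
have GD s : is_derive s (1 : R) G (F 1%N s - q.[s]).
  by have := is_deriveB (TF 0%N s) (is_derive_poly (antideriv q) s); rewrite deriv_antideriv.
have -> : F 0%N t - ((antideriv q).[t] + (F 0%N 0 - (antideriv q).[0])) = G t - G 0.
  by rewrite /G; ring.
apply: (le_trans (mean_value_le GD t0 _)).
  move=> s s0 st; have := qP 0%N s (leq0n _) s0 (le_trans st tL).
  by rewrite derivn0; apply.
rewrite subr0 mulrC; apply: le_trans Le; rewrite ler_wpM2r//.
by rewrite divr_ge0// ltW.
Qed.

End weierstrass.

(** * Density of the radial polynomials *)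

Section radial_kernels.
Variables (R : realType) (d : nat).
Local Notation mu := (ball_measure R d).
Local Notation L2 := (Lfun mu 2%:E).
Local Notation pcst := (polyfn_cst d).
Implicit Types (f g q u : 'rV[R]_d -> R) (F : nat -> R -> R).

Lemma pd_shift f (w : 'rV[R]_d) i : pd i (fun y => f (y + w)) = fun y => pd i f (y + w).
Proof.
apply/funext => y; rewrite /pd /derive.
have -> : (fun h : R => h^-1 *: (((fun y0 => f (y0 + w)) \o shift y) (h *: delta_mx ord0 i) -
    f (y + w))) = (fun h => h^-1 *: ((f \o shift (y + w)) (h *: delta_mx ord0 i) - f (y + w))).
  by apply/funext => h; rewrite /= addrA.
by [].
Qed.

Lemma partials_shift f (w : 'rV[R]_d) s : partials s (fun y : 'rV[R]_d => f (y + w)) = fun y => partials s f (y + w).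
Proof.
elim: s => [//|i s IH]; have consE h : partials (i :: s) h = pd i (partials s h) by [].
by rewrite !consE IH pd_shift.
Qed.

Lemma polyfn_affine q w c : polyfn q -> polyfn (fun x => q (w + c *: x)).
Proof.
elim=> [a|i|f g _ pf _ pg|f g _ pf _ pg]; first exact: polyfn_cst.
- under eq_fun do rewrite !mxE.
  by apply: polyfnD; [exact: polyfn_cst|apply: polyfnM; [exact: polyfn_cst|exact: polyfn_coord]].
- exact: polyfnD.
- exact: polyfnM.
Qed.

Lemma pd_affine q w c i : polyfn q ->
  pd i (fun x => q (w + c *: x)) = fun x => c * pd i q (w + c *: x).
Proof.
move=> pq; elim: q / pq => [a|j|f g pf IHf pg IHg|f g pf IHf pg IHg].
- by rewrite !pd_cst; apply/funext => x; rewrite mulr0.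
- have -> : (fun x : 'rV[R]_d => (w + c *: x) ord0 j) = (fun x => w ord0 j + c * x ord0 j).
    by apply/funext => x; rewrite !mxE.
  rewrite (pdD i (pcst (w ord0 j)) (polyfnM (pcst c) (polyfn_coord R j))) pd_cst.
  rewrite (pdZ c i (polyfn_coord R j)) !pd_coord.
  by apply/funext => x; rewrite add0r.
- rewrite (pdD i (polyfn_affine w c pf) (polyfn_affine w c pg)) IHf IHg (pdD i pf pg).
  by apply/funext => x; rewrite mulrDr.
- rewrite (pdM i (polyfn_affine w c pf) (polyfn_affine w c pg)) IHf IHg (pdM i pf pg).
  by apply/funext => x; ring.
Qed.

Lemma polyfn_horner (q : {poly R}) f : polyfn f -> polyfn (fun x => q.[f x]).
Proof.
move=> pf; elim/poly_ind: q => [|q c IH].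
  by under eq_fun do rewrite horner0; exact: polyfn_cst.
under eq_fun do rewrite !hornerE.
by apply: polyfnD; [exact: polyfnM|exact: polyfn_cst].
Qed.

Lemma is_derive_sum_ord (V : normedModType R) n (h : nat -> V -> R) (dh : nat -> R) (x v : V) :
  (forall j, is_derive x v (h j) (dh j)) ->
  is_derive x v (fun y => \sum_(j < n) h j y) (\sum_(j < n) dh j).
Proof.
move=> hD; elim: n => [|n IH].
  rewrite big_ord0 (_ : (fun y => _) = cst 0); first exact: is_derive_cst.
  by apply/funext => y; rewrite big_ord0.
rewrite big_ord_recr (_ : (fun y => _) = (fun y => \sum_(j < n) h j y) + h n).
  exact: is_deriveD.
by apply/funext => y; rewrite big_ord_recr.
Qed.

(* The polynomials [p] do not depend on the profile [F 0]: this turns [C^m] approximation of the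
   profile into uniform approximation of the derivatives of the radial function. *)
Lemma partials_radial s : exists p : nat -> 'rV[R]_d -> R, (forall j, polyfn (p j)) /\
  forall F, tower F -> partials s (fun z => F 0%N (nsq z)) =
    fun z => \sum_(j < (size s).+1) p j z * F j (nsq z).
Proof.
elim: s => [|i s [p [pp pE]]].
  exists (fun=> fun=> 1); split=> [j|F TF]; first exact: polyfn_cst.
  by apply/funext => z; rewrite big_ord_recl big_ord0 addr0 mul1r.
have consE h : partials (i :: s) h = pd i (partials s h) by [].
exists (fun j z => (if (j <= size s)%N then pd i (p j) z else 0) +
  (if j is j'.+1 then p j' z * (2 * z ord0 i) else 0)); split=> [j|F TF].
  apply: polyfnD.
    by case: (j <= size s)%N; [exact: polyfn_pd|exact: polyfn_cst].
  case: j => [|j]; first exact: polyfn_cst.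
  by apply: polyfnM => //; apply: polyfnM; [exact: polyfn_cst|exact: polyfn_coord].
rewrite consE pE//; apply/funext => z.
have D j := is_deriveM (polyfn_is_derive z i (pp j))
  (is_derive_comp_rV (TF j (nsq z)) (polyfn_is_derive z i (@polyfn_nsq R d))).
have [_ E] := @is_derive_sum_ord _ (size s).+1 _ _ z (delta_mx ord0 i) D.
rewrite [LHS]E /GRing.scale/= pd_nsq [in RHS](eq_bigr (fun j : 'I__ =>
   (if (j <= size s)%N then pd i (p j) z else 0) * F j (nsq z) +
   (if val j is j'.+1 then p j' z * (2 * z ord0 i) else 0) * F j (nsq z))); last first.
  by move=> j _; rewrite mulrDl.
rewrite [RHS]big_split/=.
rewrite [in RHS]big_ord_recr/= ltnn mul0r addr0 [X in _ + X]big_ord_recl/= mul0r add0r addrC.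
rewrite big_split/=; congr (_ + _); apply: eq_bigr => j _; last first.
  by rewrite -ltnS ltn_ord mulrC.
by rewrite -[RHS]mulrA; congr (_ * _); exact: mulrC.
Qed.

(** For finite sums of products, derivation under the integral sign is mere linearity. By
    [separable_affine], a polynomial in [y + c *: x] is of this kind. *)
Inductive separable : ('rV[R]_d -> 'rV[R]_d -> R) -> Prop :=
| separable_mul f g : polyfn f -> polyfn g -> separable (fun x y => f x * g y)
| separableD H K : separable H -> separable K -> separable (fun x y => H x y + K x y).

Lemma separableM H K : separable H -> separable K -> separable (fun x y => H x y * K x y).
Proof.
elim=> [f g pf pg sK|H1 H2 _ IH1 _ IH2 sK]; last first.
  rewrite (_ : (fun x y => _) = (fun x y => H1 x y * K x y + H2 x y * K x y)).
    by apply: separableD; [exact: IH1|exact: IH2].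
  by apply/funext => x; apply/funext => y; rewrite mulrDl.
elim: sK => [f' g' pf' pg'|K1 K2 _ IH1 _ IH2].
  rewrite (_ : (fun x y => _) = (fun x y => (f x * f' x) * (g y * g' y))).
    by apply: separable_mul; exact: polyfnM.
  by apply/funext => x; apply/funext => y; rewrite mulrACA.
rewrite (_ : (fun x y => _) = (fun x y => f x * g y * K1 x y + f x * g y * K2 x y)).
  exact: separableD.
by apply/funext => x; apply/funext => y; rewrite mulrDr.
Qed.

Lemma separable_affine q c : polyfn q -> separable (fun x y => q (y + c *: x)).
Proof.
elim=> [a|i|f g _ pf _ pg|f g _ pf _ pg].
- rewrite (_ : (fun x y => _) = (fun x y => a * 1)).
    by apply: (separable_mul (f := fun=> a) (g := fun=> 1)); exact: polyfn_cst.
  by apply/funext => x; apply/funext => y; rewrite mulr1.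
- rewrite (_ : (fun x y => _) = (fun x y : 'rV[R]_d => 1 * y ord0 i + x ord0 i * c)).
    apply: separableD; first by apply: (separable_mul (f := fun=> 1)); [exact: polyfn_cst|exact: polyfn_coord].
    by apply: (separable_mul (g := fun=> c)); [exact: polyfn_coord|exact: polyfn_cst].
  by apply/funext => x; apply/funext => y; rewrite !mxE mul1r mulrC.
- exact: separableD.
- exact: separableM.
Qed.

Lemma separable_polyfn1 K y : separable K -> polyfn (K^~ y).
Proof.
elim=> [f g pf pg|H1 H2 _ p1 _ p2]; last exact: polyfnD.
by apply: polyfnM => //; exact: polyfn_cst.
Qed.

Lemma separable_polyfn2 K x : separable K -> polyfn (K x).
Proof.
elim=> [f g pf pg|H1 H2 _ p1 _ p2]; last exact: polyfnD.
by apply: polyfnM => //; exact: polyfn_cst.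
Qed.

Lemma separable_pd K i : separable K -> separable (fun x y => pd i (K^~ y) x).
Proof.
elim=> [f g pf pg|H1 H2 s1 p1 s2 p2].
  rewrite (_ : (fun x y => _) = (fun x y => pd i f x * g y)).
    by apply: separable_mul => //; exact: polyfn_pd.
  apply/funext => x; apply/funext => y.
  rewrite (pdM i pf (pcst (g y))) pd_cst mulr0 addr0 //.
rewrite (_ : (fun x y => _) = (fun x y => pd i (H1^~ y) x + pd i (H2^~ y) x)).
  exact: separableD.
apply/funext => x; apply/funext => y.
by rewrite (pdD i (separable_polyfn1 y s1) (separable_polyfn1 y s2)).
Qed.

Let integrable_sep u K x : u \in L2 -> separable K ->
  mu.-integrable setT (EFin \o (fun y => u y * K x y)).
Proof.
move=> u2 sK; apply: integrable_mul_continuous => //.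
exact/polyfn_continuous/separable_polyfn2.
Qed.

Lemma integral_separable u K : u \in L2 -> separable K ->
  polyfn (fun x => \int[mu]_y (u y * K x y)) /\ forall i,
  pd i (fun x => \int[mu]_y (u y * K x y)) = fun x => \int[mu]_y (u y * pd i (K^~ y) x).
Proof.
move=> u2; elim=> [f g pf pg|H1 H2 s1 [p1 d1] s2 [p2 d2]].
  have ug : mu.-integrable setT (EFin \o (fun y => u y * g y)).
    by apply: integrable_mul_continuous => //; exact: polyfn_continuous.
  have E h : (fun x => \int[mu]_y (u y * (h x * g y))) = fun x => (\int[mu]_y (u y * g y)) * h x.
    apply/funext => x; rewrite mulrC -RintegralZl//.
    by apply: eq_Rintegral => y _; rewrite mulrCA.
  rewrite E; split=> [|i]; first by apply: polyfnM => //; exact: polyfn_cst.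
  rewrite (pdZ _ i pf) -E; apply/funext => x; apply: eq_Rintegral => y _.
  by rewrite (pdM i pf (pcst (g y))) pd_cst mulr0 addr0.
have E K1 K2 (sK1 : separable K1) (sK2 : separable K2) :
    (fun x => \int[mu]_y (u y * (K1 x y + K2 x y))) =
    fun x => \int[mu]_y (u y * K1 x y) + \int[mu]_y (u y * K2 x y).
  apply/funext => x; rewrite -RintegralD//; [|exact: integrable_sep|exact: integrable_sep].
  by apply: eq_Rintegral => y _; rewrite mulrDr.
rewrite (E H1 H2 s1 s2); split=> [|i]; first exact: polyfnD.
rewrite (pdD i p1 p2) d1 d2.
rewrite -(E _ _ (separable_pd i s1) (separable_pd i s2)).
apply/funext => x; apply: eq_Rintegral => y _.
by rewrite (pdD i (separable_polyfn1 y s1) (separable_polyfn1 y s2)).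
Qed.

Lemma polyfn_convolution u q c : u \in L2 -> polyfn q ->
  polyfn (fun x => \int[mu]_y (u y * q (y + c *: x))).
Proof. by move=> u2 /(separable_affine c)/(integral_separable u2)[]. Qed.

Lemma partials_convolution u q c s : u \in L2 -> polyfn q ->
  partials s (fun x => \int[mu]_y (u y * q (y + c *: x))) =
  fun x => c ^+ size s * \int[mu]_y (u y * partials s q (y + c *: x)).
Proof.
move=> u2 pq; elim: s => [|i s IH]; first by apply/funext => x; rewrite expr0 mul1r.
have consE h : partials (i :: s) h = pd i (partials s h) by [].
have ps := polyfn_partials s pq.
rewrite consE IH (pdZ _ i (polyfn_convolution c u2 ps)).
rewrite (integral_separable u2 (separable_affine c ps)).2; apply/funext => x.
rewrite exprSr -mulrA; congr (_ * _).
have iu : mu.-integrable setT (EFin \o (fun y => u y * pd i (partials s q) (y + c *: x))).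
  apply: (integrable_sep (K := fun x y => pd i (partials s q) (y + c *: x))) => //.
  exact/separable_affine/polyfn_pd.
rewrite -RintegralZl//; apply: eq_Rintegral => y _.
by rewrite (pd_affine y c i ps) consE; ring.
Qed.

End radial_kernels.

(** * Mollification on the ball *)

Section mollifier.
Variables (R : realType) (d : nat).
Local Notation mu := (ball_measure R d).
Local Notation lam := (lebesgue_rV R d).
Local Notation L2 := (Lfun mu 2%:E).
Local Notation pcst := (polyfn_cst d).
Implicit Types (x y z : 'rV[R]_d) (k l : R).

Definition kernel k z : R := bump 0 (1 - nsq z / k ^+ 2).

Lemma kernel_ge0 k z : 0 <= kernel k z. Proof. exact: bump_ge0. Qed.

Lemma kernel_le1 k z : kernel k z <= 1. Proof. exact: bump0_le1. Qed.

Lemma nsqZ c z : nsq (c *: z) = c ^+ 2 * nsq z.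
Proof. by rewrite /nsq mulr_sumr; apply: eq_bigr => i _; rewrite mxE exprMn. Qed.

Lemma kernel_supp k z : 0 < k -> kernel k z != 0 -> nsq z < k ^+ 2.
Proof.
move=> k0; apply: contra_neqT; rewrite -leNgt => kz; rewrite /kernel /bump ifN//.
by rewrite -leNgt subr_le0 ler_pdivlMr ?exprn_gt0// mul1r.
Qed.

Lemma continuous_kernel k : continuous (kernel k).
Proof.
pose T z := 1 - nsq z / k ^+ 2.
have pT : polyfn T.
  apply: polyfnB; first exact: polyfn_cst.
  by apply: polyfnM; [exact: polyfn_nsq|exact: polyfn_cst].
move=> z; apply: (@continuous_comp _ _ _ T (bump 0)); last exact: continuous_bump.
exact: polyfn_continuous.
Qed.

Lemma measurable_kernel k : measurable_fun setT (kernel k).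
Proof. by apply: continuous_measurable_rV; exact: continuous_kernel. Qed.

Lemma measurable_kernel_affine k z c : measurable_fun setT (fun x => kernel k (z + c *: x)).
Proof.
apply: measurableT_comp; first exact: measurable_kernel.
apply: measurable_rowP => i; under eq_fun do rewrite !mxE.
by apply: measurable_funD => //; apply: measurable_funM => //; exact: measurable_coord.
Qed.

Lemma lebesgue_rV_setT_gt0 n : (0 < lebesgue_rV R n setT)%E.
Proof.
elim: n => [|n IH] /=; first by rewrite diracT lte_fin.
rewrite /lebesgue_step /pushforward preimage_setT -setXTT product_measure1E//.
rewrite mule_gt0//; have l1 := lebesgue_measure_itv (`[0, 1]%R : interval R).
rewrite /= lte_fin ltr01 sube0 in l1.
apply: (@lt_le_trans _ _ (lebesgue_measure (`[0%R, 1%R]%classic : set R))).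
  by rewrite [X in (_ < X)%E]l1.
by apply: le_measure; rewrite ?inE.
Qed.

Definition kernel_mass k : \bar R := (\int[lam]_z (kernel k z)%:E)%E.

Lemma kernel_mass_scale k c : 0 < k -> 0 < c ->
  kernel_mass (c * k) = ((c ^+ d)%:E * kernel_mass k)%E.
Proof.
move=> k0 c0; rewrite /kernel_mass (@ge0_integral_affine R d (fun z => (kernel (c * k) z)%:E) 0 c c0).
- congr (_ * _)%E; apply: eq_integral => z _; congr EFin.
  rewrite /kernel add0r nsqZ; congr bump; congr (_ - _).
  by field; rewrite !gt_eqF.
- by apply/measurable_EFinP; exact: measurable_kernel.
- by move=> z; rewrite lee_fin kernel_ge0.
Qed.

Lemma kernel_mass_fin k : 0 < k -> kernel_mass k \is a fin_num.
Proof.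
move=> k0; rewrite -[k]mulr1 kernel_mass_scale// fin_numM//.
apply: integrable_fin_num => //; apply: (@bounded_eball_integrable _ _ _ 1).
- exact: measurable_kernel.
- by move=> z; rewrite ger0_norm ?kernel_ge0// kernel_le1.
- move=> z zB; apply/eqP/negPn/negP => /(kernel_supp ltr01); rewrite expr1n.
  by move=> /eballE.
Qed.

(** By [kernel_mass_scale], zero mass at one radius means zero mass at all the radii [n.+1%:R * k].
    These kernels would vanish almost everywhere; but at every point one of them is positive, and
    the whole space is not a null set. *)
Lemma kernel_mass_gt0 k : 0 < k -> 0 < fine (kernel_mass k).
Proof.
move=> k0; rewrite fine_gt0//; apply/andP; split; last first.
  by rewrite -ge0_fin_numE ?kernel_mass_fin//; apply: integral_ge0 => z _; rewrite lee_fin kernel_ge0.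
rewrite lt_neqAle; apply/andP; split; last first.
  by apply: integral_ge0 => z _; rewrite lee_fin kernel_ge0.
apply/eqP => m0.
have z0 n : {ae lam, forall z, kernel (n.+1%:R * k) z = 0}.
  have : (\int[lam]_z `|(kernel (n.+1%:R * k) z)%:E| = 0)%E.
    under eq_integral do rewrite abse_EFin ger0_norm ?kernel_ge0//.
    by rewrite -/(kernel_mass _) kernel_mass_scale// -m0 mule0.
  move/(ae_eq_integral_abs _ measurableT).
  have : measurable_fun setT (fun z => (kernel (n.+1%:R * k) z)%:E).
    by apply/measurable_EFinP; exact: measurable_kernel.
  by move=> mf /(_ mf); apply: filterS => z /(_ Logic.I) [].
have : {ae lam, forall z, forall n, kernel (n.+1%:R * k) z = 0} by apply: ae_foralln.
move=> [N [mN N0 sub]]; have NT : N = setT.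
  apply/seteqP; split => // z _; apply: sub => /= h.
  have [n hn] : exists n : nat, nsq z / k ^+ 2 < n.+1%:R.
    by exists (Num.truncn (nsq z / k ^+ 2)); exact: truncnS_gt.
  have := h n; rewrite /kernel /bump ifT ?expr0 ?invr1 ?mul1r; last first.
    rewrite subr_gt0 ltr_pdivrMr ?exprn_gt0 ?mulr_gt0// mul1r exprMn.
    rewrite -ltr_pdivrMr ?exprn_gt0//; apply: (lt_le_trans hn).
    by rewrite -natrX ler_nat leq_pmull.
  by move=> /eqP; rewrite gt_eqF// expR_gt0.
by have := lebesgue_rV_setT_gt0 d; rewrite -NT N0 ltxx.
Qed.

Lemma kernel_mass_affine1 k l y : 0 < k -> 0 < l ->
  (\int[lam]_x (kernel k (y - l *: x))%:E = (l ^- d)%:E * kernel_mass k)%E.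
Proof.
move=> k0 l0; have kE x : kernel k (y - l *: x) = kernel k (- y + l *: x).
  have -> : - y + l *: x = -1 *: (y - l *: x) by rewrite scaleN1r opprB addrC.
  by rewrite /kernel nsqZ sqrrN expr1n mul1r.
under eq_integral do rewrite kE.
rewrite /kernel_mass (@ge0_integral_affine R d (fun z => (kernel k z)%:E) (- y) l l0).
- rewrite muleA -EFinM mulVf ?mul1e// expf_neq0// gt_eqF//.
- by apply/measurable_EFinP; exact: measurable_kernel.
- by move=> z; rewrite lee_fin kernel_ge0.
Qed.

Lemma nsq_convex k l x y : 0 <= k -> 0 <= l -> k + l = 1 ->
  nsq (k *: x + l *: y) <= k * nsq x + l * nsq y.
Proof.
move=> k0 l0 kl; rewrite /nsq !mulr_sumr -big_split/=; apply: ler_sum => i _.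
rewrite !mxE; have -> : l = 1 - k by lra.
have := mulr_ge0 (mulr_ge0 k0 l0) (sqr_ge0 (x ord0 i - y ord0 i)).
have -> : l = 1 - k by lra.
by move: (x ord0 i) (y ord0 i) => a b; nra.
Qed.

(** Since [k + l = 1], [y] is a convex combination of [x], which is inside the ball, and of
    [k^-1 *: (y - l *: x)], which is in the closed ball. *)
Lemma kernel_inside k l x y : 0 < k -> 0 < l -> k + l = 1 -> eball x ->
  nsq (y - l *: x) <= k ^+ 2 -> eball y.
Proof.
move=> k0 l0 kl /eballE xB yk; apply/eballE.
have -> : y = k *: (k^-1 *: (y - l *: x)) + l *: x.
  by rewrite scalerA divff ?gt_eqF// scale1r subrK.
apply: (le_lt_trans (nsq_convex _ _ (ltW k0) (ltW l0) kl)).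
have h : nsq (k^-1 *: (y - l *: x)) <= 1.
  by rewrite nsqZ exprVn mulrC ler_pdivrMr ?exprn_gt0// mul1r.
by nra.
Qed.

Lemma kernel_mass_ball k l x : 0 < k -> 0 < l -> k + l = 1 -> eball x ->
  (\int[mu]_y (kernel k (y - l *: x))%:E = kernel_mass k)%E.
Proof.
move=> k0 l0 kl xB.
have mk : measurable_fun setT (fun y => (kernel k (y - l *: x))%:E).
  apply/measurable_EFinP; have := measurable_kernel_affine k (- (l *: x)) 1.
  by under eq_fun do rewrite scale1r addrC.
have E : (\int[lam]_y (kernel k (y - l *: x))%:E = kernel_mass k)%E.
  rewrite (@ge0_integral_affine R d _ (l *: x) 1 ltr01 mk).
    rewrite expr1n mul1e; apply: eq_integral => y _.
    by rewrite scale1r addrC addKr.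
  by move=> y; rewrite lee_fin kernel_ge0.
rewrite -E (integral_ball_measure mk) integral_mkcond.
apply: eq_integral => y _; rewrite /patch; case: ifPn => // /negP yB.
apply/esym; congr EFin; apply/eqP/negPn/negP => /(kernel_supp k0)/ltW h'.
by apply: yB; apply/mem_set; exact: (kernel_inside k0 l0 kl xB h').
Qed.

End mollifier.

Section mollification.
Variables (R : realType) (d : nat).
Local Notation mu := (ball_measure R d).
Local Notation lam := (lebesgue_rV R d).
Local Notation L2 := (Lfun mu 2%:E).
Implicit Types (x y z : 'rV[R]_d) (v w : 'rV[R]_d -> R).

Lemma measurable_kernel_sub (k l : R) x : measurable_fun setT (fun y => kernel k (y - l *: x)).
Proof.
have := measurable_kernel_affine k (- (l *: x)) 1.
by under eq_fun do rewrite scale1r addrC.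
Qed.

Lemma L2_mul_kernel (k l : R) x w : w \in L2 -> (fun y => w y * kernel k (y - l *: x)) \in L2.
Proof.
move=> w2; apply: (@L2_mul_bounded _ _ _ _ 1) => //; first exact: measurable_kernel_sub.
by move=> y; rewrite ger0_norm ?kernel_ge0// kernel_le1.
Qed.

Variables (k l : R).
Hypotheses (k0 : 0 < k) (l0 : 0 < l) (kl : k + l = 1).
Let m : R := fine (@kernel_mass R d k).
Let m0 : 0 < m. Proof. exact: kernel_mass_gt0. Qed.

Definition mollify w x : R := (fine (@kernel_mass R d k))^-1 *
  \int[mu]_y (w y * kernel k (y - l *: x)).

Let int_kernel x w : w \in L2 ->
  mu.-integrable setT (EFin \o (fun y => w y * kernel k (y - l *: x))).
Proof. by move=> w2; apply/L2_integrable/L2_mul_kernel. Qed.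

Let int1 x : mu.-integrable setT (EFin \o (fun y => kernel k (y - l *: x))).
Proof.
have := int_kernel x (polyfn_L2 (polyfn_cst d (1 : R))).
by under [X in EFin \o X]eq_fun do rewrite mul1r.
Qed.

Let mass1 x : eball x -> \int[mu]_y kernel k (y - l *: x) = m.
Proof. by move=> xB; rewrite /Rintegral (kernel_mass_ball k0 l0 kl xB). Qed.

Lemma mollifyB v w x : v \in L2 -> w \in L2 ->
  mollify (fun y => v y - w y) x = mollify v x - mollify w x.
Proof.
move=> v2 w2; rewrite /mollify -mulrBr -RintegralB//; [|exact: int_kernel|exact: int_kernel].
by congr (_ * _); apply: eq_Rintegral => y _; rewrite mulrBl.
Qed.

(** Jensen's inequality for the kernel divided by its mass, obtained by expanding the integral of
    [(w - a)^2] against the kernel, where [a] is the average. *)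
Lemma mollify_sqr_le w x : w \in L2 -> eball x -> mollify w x ^+ 2 <= mollify (fun y => w y ^+ 2) x.
Proof.
move=> w2 xB; set a := mollify w x.
have i2 : mu.-integrable setT (EFin \o (fun y => w y ^+ 2 * kernel k (y - l *: x))).
  have := L2_mul_integrable w2 (L2_mul_kernel k l x w2).
  by under [X in EFin \o X]eq_fun do rewrite mulrA -expr2.
have ia : mu.-integrable setT (EFin \o (fun y => 2 * a * (w y * kernel k (y - l *: x)))).
  by have := integrableZl measurableT (2 * a) (int_kernel x w2).
have ib : mu.-integrable setT (EFin \o (fun y => a ^+ 2 * kernel k (y - l *: x))).
  by have := integrableZl measurableT (a ^+ 2) (int1 x).
have h : 0 <= \int[mu]_y ((w y - a) ^+ 2 * kernel k (y - l *: x)).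
  by apply: Rintegral_ge0 => y _; rewrite mulr_ge0 ?sqr_ge0 ?kernel_ge0.
have E : \int[mu]_y ((w y - a) ^+ 2 * kernel k (y - l *: x)) =
    m * mollify (fun y => w y ^+ 2) x - a ^+ 2 * m.
  rewrite /mollify -/m mulrA divff ?gt_eqF// mul1r.
  transitivity (\int[mu]_y (w y ^+ 2 * kernel k (y - l *: x) -
      2 * a * (w y * kernel k (y - l *: x)) + a ^+ 2 * kernel k (y - l *: x))).
    by apply: eq_Rintegral => y _; ring.
  rewrite RintegralD//; last by have := integrableB measurableT i2 ia.
  rewrite RintegralB// RintegralZl//; last exact: int_kernel.
  rewrite RintegralZl// mass1//.
  have -> : \int[mu]_y (w y * kernel k (y - l *: x)) = m * a.
    by rewrite /a /mollify -/m mulrA divff ?gt_eqF// mul1r.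
  by ring.
move: h; rewrite E mulrC -mulrBl pmulr_lge0// subr_ge0 //.
Qed.

Let F (g : 'rV[R]_d -> R) (p : 'rV[R]_d * 'rV[R]_d) : \bar R :=
  (g p.2 * kernel k (p.2 - l *: p.1))%:E.

Let mF g : measurable_fun setT g -> measurable_fun setT (F g).
Proof.
move=> mg; apply/measurable_EFinP; apply: measurable_funM.
  exact: measurableT_comp mg measurable_snd.
apply: measurableT_comp; first exact: measurable_kernel.
apply: measurable_rowP => i; under eq_fun do rewrite !mxE.
apply: measurable_funB.
  exact: (measurableT_comp (measurable_coord i) measurable_snd).
by apply: measurable_funM => //; exact: (measurableT_comp (measurable_coord i) measurable_fst).
Qed.

(** Kept in the extended reals, so that Tonelli applies before finiteness is known. *)
Definition sqr_avg w x : \bar R := (\int[mu]_y (w y ^+ 2 * kernel k (y - l *: x))%:E)%E.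

Let g w y : R := w y ^+ 2 * \1_(@eball R d) y.

Let mg w : measurable_fun setT w -> measurable_fun setT (g w).
Proof.
move=> mw; apply: measurable_funM; first exact: measurable_funX.
by apply: measurable_indic; exact: measurable_eball.
Qed.

Let gF w x : measurable_fun setT w -> (sqr_avg w x = \int[lam]_y F (g w) (x, y))%E.
Proof.
move=> mw; rewrite /sqr_avg integral_ball_measure; last first.
  apply/measurable_EFinP; apply: measurable_funM; first exact: measurable_funX.
  exact: measurable_kernel_sub.
rewrite integral_mkcond; apply: eq_integral => y _; rewrite /patch /F /g indicE/=.
by case: ifP => _; rewrite ?mulr1// mulr0 mul0r.
Qed.

Let F_ge0 w p : (0 <= F (g w) p)%E.
Proof. by rewrite lee_fin mulr_ge0 ?kernel_ge0// mulr_ge0 ?sqr_ge0// indicE. Qed.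

Lemma measurable_sqr_avg w : measurable_fun setT w -> measurable_fun setT (sqr_avg w).
Proof.
move=> mw; rewrite (_ : sqr_avg w = fun x => (\int[lam]_y F (g w) (x, y))%E).
  by apply: measurable_fun_fubini_tonelli_F => //; exact: mF (mg mw).
by apply/funext => x; exact: gF.
Qed.

(** Schur's test: Tonelli exchanges the integrals, and the kernel integrated in [x] instead of [y]
    has mass [l ^- d * m]. With [mollify_sqr_le], [mollify] multiplies the squared L^2 norm by at
    most [l ^- d]. *)
Lemma sqr_avg_schur w : w \in L2 ->
  (\int[mu]_x sqr_avg w x <= (l ^- d * m * l2norm w ^+ 2)%:E)%E.
Proof.
move=> w2; have mw := L2_measurable w2.
apply: (@le_trans _ _ (\int[lam]_x sqr_avg w x)%E).
  rewrite integral_ball_measure; last exact: measurable_sqr_avg.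
  apply: ge0_subset_integral => //; [exact: measurable_eball|exact: measurable_sqr_avg|].
  move=> x _; apply: integral_ge0 => y _.
  by rewrite lee_fin mulr_ge0 ?sqr_ge0 ?kernel_ge0.
under eq_integral do rewrite gF//.
rewrite (fubini_tonelli (F (g w)))//; last exact: mF (mg mw).
rewrite (_ : (\int[lam]_y _)%E = (\int[lam]_y ((l ^- d * m)%:E * (g w y)%:E))%E); last first.
  apply: eq_integral => y _; rewrite /F/=.
  transitivity ((g w y)%:E * \int[lam]_x (kernel k (y - l *: x))%:E)%E.
    rewrite -ge0_integralZl//.
    - apply/measurable_EFinP; have := measurable_kernel_affine k y (- l).
      by under eq_fun do rewrite scaleNr.
    - by move=> x _; rewrite lee_fin kernel_ge0.
    - by rewrite lee_fin mulr_ge0 ?sqr_ge0// indicE.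
  rewrite kernel_mass_affine1// -[@kernel_mass R d k]fineK ?kernel_mass_fin//.
  by rewrite -!EFinM mulrC.
rewrite ge0_integralZl//; last 3 first.
- by apply/measurable_EFinP; exact: mg.
- by move=> y _; rewrite lee_fin mulr_ge0 ?sqr_ge0// indicE.
- by rewrite lee_fin ltW// mulr_gt0// invr_gt0 exprn_gt0.
rewrite [leRHS]EFinM lee_pmul2l ?lte_fin ?mulr_gt0 ?invr_gt0 ?exprn_gt0//.
rewrite l2norm_sqr// /Rintegral fineK; last first.
  apply: integrable_fin_num => //.
  by have := L2_mul_integrable w2 w2; under [X in EFin \o X]eq_fun do rewrite -expr2.
rewrite integral_ball_measure; last by apply/measurable_EFinP; exact: measurable_funX.
rewrite [leRHS]integral_mkcond le_eqVlt; apply/orP; left; apply/eqP.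
apply: eq_integral => y _; rewrite /patch /g indicE.
by case: ifP => _; rewrite ?mulr1// mulr0.
Qed.

Lemma kernel_close x y i : eball x -> kernel k (y - l *: x) != 0 ->
  `|x ord0 i - y ord0 i| <= 2 * k.
Proof.
move=> xB /(kernel_supp k0) yk.
have h1 : `|(y - l *: x) ord0 i| <= k.
  rewrite -(ler_pXn2r (n := 2))// ?nnegrE ?(ltW k0)// real_normK ?num_real//.
  apply/ltW/(le_lt_trans _ yk); rewrite /nsq (bigD1 i)//= lerDl sumr_ge0// => j _.
  exact: sqr_ge0.
have h2 := eball_coord i xB; rewrite !mxE in h1.
have -> : x ord0 i - y ord0 i = k * x ord0 i - (y ord0 i - l * x ord0 i).
  by have -> : l = 1 - k; [rewrite -kl addrAC subrr add0r|ring].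
rewrite (le_trans (ler_normB _ _))// normrM (gtr0_norm k0).
have : k * `|x ord0 i| <= k by rewrite ler_piMr// ltW.
by lra.
Qed.

Lemma polyfn_lipschitz q : polyfn q -> exists C : R, 0 <= C /\
  forall x y, eball x -> eball y -> forall e : R, (forall i, `|x ord0 i - y ord0 i| <= e) ->
  0 <= e -> `|q x - q y| <= C * e.
Proof.
elim=> [a|i|f h pf [C1 [C10 f1]] ph [C2 [C20 h2]]|f h pf [C1 [C10 f1]] ph [C2 [C20 h2]]].
- by exists 0; split=> // x y _ _ e _ _; rewrite subrr normr0 mul0r.
- by exists 1; split=> // x y _ _ e xy _; rewrite mul1r.
- exists (C1 + C2); split=> [|x y xB yB e xy e0]; first exact: addr_ge0.
  by rewrite opprD addrACA mulrDl (le_trans (ler_normD _ _))// lerD ?f1 ?h2.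
- have [M1 M1P] : exists M : R, forall x, eball x -> `|f x| <= M.
    exact: continuous_eball_bounded (polyfn_continuous pf).
  have [M2 M2P] : exists M : R, forall x, eball x -> `|h x| <= M.
    exact: continuous_eball_bounded (polyfn_continuous ph).
  exists (`|M1| * C2 + `|M2| * C1); split=> [|x y xB yB e xy e0].
    by rewrite addr_ge0// mulr_ge0.
  have -> : f x * h x - f y * h y = f x * (h x - h y) + h y * (f x - f y) by ring.
  rewrite (le_trans (ler_normD _ _))// !normrM mulrDl -!mulrA lerD// ler_pM ?h2 ?f1//.
    by rewrite (le_trans (M1P x xB))// ler_norm.
  by rewrite (le_trans (M2P y yB))// ler_norm.
Qed.

Lemma mollify_polyfn_le q (C : R) x : polyfn q ->
  (forall x y, eball x -> eball y -> forall e : R, (forall i, `|x ord0 i - y ord0 i| <= e) ->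
  0 <= e -> `|q x - q y| <= C * e) -> eball x -> `|q x - mollify q x| <= C * (2 * k).
Proof.
move=> pq qC xB; have q2 := polyfn_L2 pq.
have pqx : polyfn (fun y => q x - q y) by apply: polyfnB => //; exact: polyfn_cst.
have E : q x - mollify q x = m^-1 * \int[mu]_y ((q x - q y) * kernel k (y - l *: x)).
  rewrite /mollify -/m -{1}[q x]mul1r -(mulVf (x := m)) ?gt_eqF// -mulrA -mulrBr; congr (_ * _).
  have iq : mu.-integrable setT (EFin \o (fun y => q x * kernel k (y - l *: x))).
    by have := integrableZl measurableT (q x) (int1 x).
  rewrite -(mass1 xB) mulrC -RintegralZl// -RintegralB//; last exact: int_kernel.
  by apply: eq_Rintegral => y _; rewrite mulrBl.
rewrite E normrM normfV (gtr0_norm m0) ler_pdivrMl//.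
have ii := int_kernel x (polyfn_L2 pqx).
apply: (le_trans (le_normr_Rintegral measurableT ii)).
have -> : m * (C * (2 * k)) = \int[mu]_y (C * (2 * k) * kernel k (y - l *: x)).
  by rewrite RintegralZl// mass1// mulrC.
apply: le_Rintegral_ball.
- by have := integrable_norm ii.
- by have := integrableZl measurableT (C * (2 * k)) (int1 x).
move=> y yB /=; rewrite normrM (ger0_norm (kernel_ge0 _ _)).
have [->|kn0] := eqVneq (kernel k (y - l *: x)) 0; first by rewrite !mulr0.
rewrite ler_wpM2r ?kernel_ge0//; apply: qC => // [i|]; first exact: kernel_close.
by rewrite mulr_ge0// ltW.
Qed.

(** With [w = v - q], the difference [v - P] is [w - l ^+ n * mollify w] plus a remainder bounded on
    the ball by the base of the last square. The 3 comes from the square of a sum of three terms,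
    and [1 + l ^- d] from [sqr_avg_schur]. The factor [l ^+ n] is the one that [n] derivatives in
    [x] produce when the kernel is centred at [l *: x]. *)
Lemma mollify_error v q P (n : nat) (M C e : R) : v \in L2 -> polyfn q -> polyfn P ->
  (forall x, eball x -> `|q x| <= M) ->
  (forall x y, eball x -> eball y -> forall e : R, (forall i, `|x ord0 i - y ord0 i| <= e) ->
  0 <= e -> `|q x - q y| <= C * e) ->
  (forall x, eball x -> `|P x - l ^+ n * mollify v x| <= e) ->
  l2norm (fun x => v x - P x) ^+ 2 <= 3 * (l2norm (fun x => v x - q x) ^+ 2 * (1 + l ^- d) +
    ((1 - l ^+ n) * M + C * (2 * k) + e) ^+ 2 * fine (mu setT)).
Proof.
move=> v2 pq pP qM qC Pe; set B := (1 - _) * M + _ + _.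
have q2 := polyfn_L2 pq; pose w x := v x - q x.
have w2 : w \in L2 by exact: L2B.
have l1 : l <= 1 by rewrite -kl lerDr ltW.
have vP2 : (fun x => v x - P x) \in L2 by apply: L2B => //; exact: polyfn_L2.
have mw := L2_measurable w2.
pose H x : \bar R := (3%:E * ((w x ^+ 2 + B ^+ 2)%:E + m^-1%:E * sqr_avg w x))%E.
have avgE x : eball x -> (m^-1%:E * sqr_avg w x = (mollify (fun y => w y ^+ 2) x)%:E)%E.
  move=> xB; rewrite /mollify EFinM /Rintegral fineK// integrable_fin_num//.
  have := L2_mul_integrable w2 (L2_mul_kernel k l x w2).
  by under [X in EFin \o X]eq_fun do rewrite mulrA -expr2.
have pt x : eball x -> (((v x - P x) ^+ 2)%:E <= H x)%E.
  move=> xB; rewrite /H avgE// -EFinD -EFinM lee_fin.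
  have := mollify_sqr_le w2 xB; set h := mollify (fun y => w y ^+ 2) x; set a := mollify w x => ah.
  have ha : mollify v x = a + mollify q x by rewrite /a mollifyB// subrK.
  have ln0 : 0 <= l ^+ n by rewrite exprn_ge0// ltW.
  have ln1 : l ^+ n <= 1 by rewrite exprn_ile1// ltW.
  have b : `|(v x - P x) - w x + l ^+ n * a| <= B.
    have -> : (v x - P x) - w x + l ^+ n * a = (1 - l ^+ n) * q x +
      l ^+ n * (q x - mollify q x) - (P x - l ^+ n * mollify v x).
      by rewrite ha /w; ring.
    rewrite (le_trans (ler_normB _ _))// lerD ?Pe// (le_trans (ler_normD _ _))// lerD//.
      by rewrite normrM ger0_norm ?subr_ge0// ler_wpM2l ?subr_ge0// qM.
    rewrite normrM ger0_norm//; apply: (le_trans _ (mollify_polyfn_le pq qC xB)).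
    by rewrite ler_piMl.
  have b2 : ((v x - P x) - w x + l ^+ n * a) ^+ 2 <= B ^+ 2.
    by rewrite -real_normK ?num_real// lerXn2r// nnegrE// (le_trans _ b).
  have a2 : (l ^+ n * a) ^+ 2 <= h.
    by apply: le_trans ah; rewrite exprMn ler_piMl ?sqr_ge0// exprn_ile1.
  move: b2 a2; set s := l ^+ n * a; set t := v x - P x; set u := w x => b2 a2.
  (* With [r = t - u + s], the three squares add up to [3 (u^2 + s^2 + r^2) - (u - s + r)^2]. *)
  have := sqr_ge0 (t - u + s - u); have := sqr_ge0 (t - u + s + s); have := sqr_ge0 (u + s).
  by nra.
have msa := measurable_sqr_avg mw.
have sa0 x : (0 <= sqr_avg w x)%E.
  by apply: integral_ge0 => y _; rewrite lee_fin mulr_ge0 ?sqr_ge0 ?kernel_ge0.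
have mw2 : measurable_fun setT (fun x => (w x ^+ 2 + B ^+ 2)%:E).
  by apply/measurable_EFinP; apply: measurable_funD => //; exact: measurable_funX.
have mH : measurable_fun setT H.
  apply: measurable_funeM; apply: emeasurable_funD => //; exact: measurable_funeM.
have step : (\int[mu]_x ((v x - P x) ^+ 2)%:E <= \int[mu]_x H x)%E.
  apply: ae_ge0_le_integral => //.
  - by move=> x _; rewrite lee_fin sqr_ge0.
  - by apply/measurable_EFinP/measurable_funX; exact: L2_measurable.
  - move=> x _; rewrite /H mule_ge0// adde_ge0// ?lee_fin ?addr_ge0 ?sqr_ge0//.
    by rewrite mule_ge0// lee_fin invr_ge0 ltW.
  - by apply: filterS (ball_measure_ae R d) => x xB _; exact: pt.
have iw2 : mu.-integrable setT (EFin \o (fun x => w x ^+ 2)).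
  by have := L2_mul_integrable w2 w2; under [X in EFin \o X]eq_fun do rewrite -expr2.
have HE : (\int[mu]_x H x <= (3 * (l2norm w ^+ 2 + B ^+ 2 * fine (mu setT) +
    m^-1 * (l ^- d * m * l2norm w ^+ 2)))%:E)%E.
  rewrite ge0_integralZl//; last 2 first.
  - by apply: emeasurable_funD => //; exact: measurable_funeM.
  - move=> x _; rewrite adde_ge0// ?lee_fin ?addr_ge0 ?sqr_ge0//.
    by rewrite mule_ge0// lee_fin invr_ge0 ltW.
  rewrite EFinM lee_pmul2l//; rewrite ge0_integralD//; last 3 first.
  - by move=> x _; rewrite lee_fin addr_ge0 ?sqr_ge0.
  - by move=> x _; rewrite mule_ge0// lee_fin invr_ge0 ltW.
  - exact: measurable_funeM.
  rewrite EFinD; apply: leeD.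
    under eq_integral do rewrite EFinD.
    rewrite integralD//; last exact: (polyfn_integrable (polyfn_cst d (B ^+ 2))).
    rewrite EFinD l2norm_sqr// /Rintegral fineK ?integrable_fin_num//.
    rewrite [(B ^+ 2 * _)%:E]EFinM (fineK (ball_measure_fin R d)) leeD2l//.
    by rewrite (integral_cst mu measurableT (B ^+ 2)%:E).
  rewrite ge0_integralZl//; last by rewrite lee_fin invr_ge0 ltW.
  by rewrite [leRHS]EFinM lee_pmul2l ?lte_fin ?invr_gt0//; exact: sqr_avg_schur.
have iv : (\int[mu]_x ((v x - P x) ^+ 2)%:E)%E \is a fin_num.
  apply: integrable_fin_num => //.
  by have := L2_mul_integrable vP2 vP2; under [X in EFin \o X]eq_fun do rewrite -expr2.
have := le_trans step HE; rewrite (l2norm_sqr vP2) /Rintegral -[X in (X <= _)%E]fineK// lee_fin.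
move=> /le_trans; apply; rewrite le_eqVlt; apply/orP; left; apply/eqP.
by rewrite -/w; field; rewrite !gt_eqF ?exprn_gt0.
Qed.

End mollification.

(** * Simultaneous polynomial approximation of a function and its weak derivatives *)

Section towers.
Variable R : realType.

(** A class stable under derivation that contains the profile of [kernel k] as a function of the
    squared norm, so that derivatives can be chosen again and again to form a tower. *)
Inductive bump_comb (k : R) : (R -> R) -> Prop :=
| bump_comb_mul (a : R) j : bump_comb k (fun t => a * bump j (1 - t / k ^+ 2))
| bump_combD f g : bump_comb k f -> bump_comb k g -> bump_comb k (fun t => f t + g t).

Lemma bump_comb_derive k f : bump_comb k f ->
  exists g, bump_comb k g /\ forall t, is_derive t (1 : R) f (g t).
Proof.
elim=> [a j|f1 f2 _ [g1 [b1 d1]] _ [g2 [b2 d2]]]; last first.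
  exists (fun t => g1 t + g2 t); split=> [|t]; first exact: bump_combD.
  exact: is_deriveD.
exists (fun t => (- a / k ^+ 2) * bump j.+2 (1 - t / k ^+ 2) +
  (a / k ^+ 2 * j%:R) * bump j.+1 (1 - t / k ^+ 2)).
split=> [|t]; first by apply: bump_combD; exact: bump_comb_mul.
have D1 : is_derive t (1 : R) (fun s : R => 1 - s / k ^+ 2) (- (k ^+ 2)^-1).
  have D0 := is_deriveB (is_derive_cst (1 : R) t (1 : R))
    (is_deriveM (is_derive_id t (1 : R)) (is_derive_cst ((k ^+ 2)^-1) t (1 : R))).
  have [D2 D3] := D0; apply: DeriveDef => //; rewrite [LHS]D3 /GRing.scale/=.
  by rewrite mulr0 !add0r mulr1.
have D2 := @is_derive1_comp _ (bump j) (fun s => 1 - s / k ^+ 2) t _ _ (is_derive_bump j _) D1.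
have [D3 D4] := is_deriveM (is_derive_cst a t (1 : R)) D2.
apply: DeriveDef => //; rewrite [LHS]D4 /GRing.scale/= mulr0 addr0.
by rewrite /cst; ring.
Qed.

Lemma bump_tower (k : R) : exists F : nat -> R -> R, tower F /\
  F 0%N = fun t => bump 0 (1 - t / k ^+ 2).
Proof.
have /choice[D DP] : forall f, exists g, bump_comb k f ->
    bump_comb k g /\ forall t, is_derive t (1 : R) f (g t).
  move=> f; have [/bump_comb_derive[g gP]|nf] := pselect (bump_comb k f); first by exists g.
  by exists f.
pose F j := iter j D (fun t => 1 * bump 0 (1 - t / k ^+ 2)).
have bF j : bump_comb k (F j).
  by elim: j => [|j IH]; [exact: bump_comb_mul|have [] := DP _ IH].
exists F; split=> [j t|]; first by have [_] := DP _ (bF j).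
by apply/funext => t; rewrite /F/= mul1r.
Qed.

Lemma poly_tower (q : {poly R}) : tower (fun j t => (q^`(j)).[t]).
Proof. by move=> j t; rewrite derivnS; exact: is_derive_poly. Qed.

End towers.

Section approximation.
Variables (R : realType) (d : nat).
Local Notation mu := (ball_measure R d).
Local Notation lam := (lebesgue_rV R d).
Local Notation L2 := (Lfun mu 2%:E).
Implicit Types (x y z : 'rV[R]_d) (u v w : 'rV[R]_d -> R) (k l : R).

(** The 4 is the bound of [nsq (y - l *: x)] for two points of the ball. On that range the universal
    polynomials of [partials_radial] are bounded, which gives [C]. *)
Lemma partials_radial_close (s : seq 'I_d) : exists C : R, 0 <= C /\
  forall F G (e : R), tower F -> tower G ->
  (forall j t, (j <= size s)%N -> 0 <= t -> t <= 4 -> `|F j t - G j t| <= e) ->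
  forall z, nsq z < 4 -> `|partials s (fun z => F 0%N (nsq z)) z -
    partials s (fun z => G 0%N (nsq z)) z| <= C * e.
Proof.
have [p [pp pE]] := partials_radial R s.
have /choice[M MP] : forall j, exists M : R, 0 <= M /\ forall z, nsq z < 4 -> `|p j z| <= M.
  move=> j; have [M hM] : exists M : R, forall x, eball x -> `|p j (0 + 2 *: x)| <= M.
    exact/continuous_eball_bounded/polyfn_continuous/polyfn_affine.
  exists `|M|; split=> // z z4; have -> : z = 0 + 2 *: (2^-1 *: z).
    by rewrite add0r scalerA divff// scale1r.
  apply: le_trans (ler_norm M); apply: hM; apply/eballE; rewrite nsqZ.
  by rewrite exprVn mulrC ltr_pdivrMr// mul1r -natrX.
exists (\sum_(j < (size s).+1) M j); split.
  by apply: sumr_ge0 => j _; have [] := MP j.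
move=> F G e TF TG FG z z4; rewrite !pE// -sumrB mulr_suml.
apply: (le_trans (ler_norm_sum _ _ _)); apply: ler_sum => j _.
rewrite -mulrBr normrM ler_pM//; first by have [_] := MP j; apply.
by apply: FG; rewrite ?nsq_ge0 ?ltW// -ltnS.
Qed.

Section fixed_scale.
Variables k l : R.
Hypotheses (k0 : 0 < k) (l0 : 0 < l) (kl : k + l = 1).

Lemma test_function_kernel x : eball x -> test_function (fun y => kernel k (y - l *: x)).
Proof.
move=> xB; pose T y := 1 - nsq (- (l *: x) + 1 *: y) / k ^+ 2.
have pT : polyfn T.
  apply: polyfnB; first exact: polyfn_cst.
  by apply: polyfnM; [exact: polyfn_affine (@polyfn_nsq R d)|exact: polyfn_cst].
have E : (fun y => kernel k (y - l *: x)) = (fun y => 1 * bump 0 (T y)).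
  by apply/funext => y; rewrite mul1r /kernel /T scale1r [- _ + y]addrC.
rewrite E; apply: (bumpfn_test pT); last exact: (bumpfn_mul T 0 (polyfn_cst d 1)).
move=> y; rewrite /T scale1r [- _ + y]addrC subr_ge0 ler_pdivrMr ?exprn_gt0// mul1r.
exact: (kernel_inside k0 l0 kl xB).
Qed.

Lemma nsq_sub_lt4 x y : eball x -> eball y -> nsq (y - l *: x) < 4.
Proof.
move=> /eballE x1 /eballE y1.
have -> : y - l *: x = 2^-1 *: (2 *: y) + 2^-1 *: ((- 2 * l) *: x).
  rewrite !scalerA mulVf// scale1r mulrA mulrN mulVf// mulN1r scaleNr//.
have h2 : 0 <= 2^-1 :> R by rewrite invr_ge0.
have h1 : 2^-1 + 2^-1 = 1 :> R by lra.
apply: (le_lt_trans (nsq_convex _ _ h2 h2 h1)); rewrite !nsqZ.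
have l1 : l <= 1 by rewrite -kl lerDr ltW.
have : l ^+ 2 <= 1 by rewrite exprn_ile1// ltW.
have -> : (- 2 * l) ^+ 2 = 4 * l ^+ 2 by ring.
have := nsq_ge0 x; move: (nsq x) (nsq y) x1 y1 (l ^+ 2) => X Y x1 y1 L X0 L1.
have : L * X <= X by rewrite ler_piMl.
have -> : 2 ^+ 2 = 4 :> R by rewrite -natrX.
lra.
Qed.

Variables (u : 'rV[R]_d -> R) (q : {poly R}).
Hypothesis u2 : u \in L2.

Definition approximant x : R := (fine (@kernel_mass R d k))^-1 *
  \int[mu]_y (u y * q.[nsq (y - l *: x)]).

Let m : R := fine (@kernel_mass R d k).
Let m0 : 0 < m. Proof. exact: kernel_mass_gt0. Qed.

Let Q (z : 'rV[R]_d) : R := q.[nsq z].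
Let pQ : polyfn Q. Proof. exact/polyfn_horner/polyfn_nsq. Qed.

Let approximantE : approximant =
  fun x => m^-1 * \int[mu]_y (u y * Q (y + (- l) *: x)).
Proof.
apply/funext => x; rewrite /approximant; congr (_ * _).
by apply: eq_Rintegral => y _; rewrite scaleNr.
Qed.

Lemma polyfn_approximant : polyfn approximant.
Proof.
rewrite approximantE; apply: polyfnM; first exact: polyfn_cst.
exact: (polyfn_convolution (- l) u2 pQ).
Qed.

(** Derivatives in [x] of the convolution are derivatives in [y] up to [(- l) ^+ mi_order a]. With
    the kernel in place of [q], which is a test function of [y], the definition of a weak derivative
    moves them onto [u] and absorbs the sign: [l ^+ mi_order a * mollify k l v] remains. *)
Lemma mpartial_approximant (a : 'I_d -> nat) v (C : R) F x : weak_deriv a u v ->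
  tower F -> F 0%N = (fun t => bump 0 (1 - t / k ^+ 2)) -> 0 <= C ->
  (forall z, nsq z < 4 -> `|partials (mi_seq a) (fun z => q.[nsq z]) z -
    partials (mi_seq a) (fun z => F 0%N (nsq z)) z| <= C) -> eball x ->
  `|mpartial a approximant x - l ^+ mi_order a * mollify k l v x| <=
    m^-1 * (C * \int[mu]_y `|u y|).
Proof.
move=> [v2 uv] TF F0 C0 close xB.
have sE : mpartial a = partials (mi_seq a) by [].
have pc := polyfn_convolution (- l) u2 pQ.
have scaleE s : partials s approximant = fun x => m^-1 * partials s
    (fun x => \int[mu]_y (u y * Q (y + (- l) *: x))) x.
  rewrite approximantE; elim: s => [//|i s IH].
  have consE h : partials (i :: s) h = pd i (partials s h) by [].
  by rewrite !consE IH (pdZ _ i (polyfn_partials s pc)).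
have K0 : kernel k = fun z => F 0%N (nsq z) by rewrite F0.
have tf := test_function_kernel xB.
have := uv _ tf; rewrite sE.
have -> : partials (mi_seq a) (fun y => kernel k (y - l *: x)) =
    fun y => partials (mi_seq a) (kernel k) (y - l *: x) by rewrite partials_shift.
move=> uvx.
rewrite scaleE (partials_convolution _ _ u2 pQ) size_mi_seq.
have molE : l ^+ mi_order a * mollify k l v x = m^-1 * ((- l) ^+ mi_order a *
    \int[mu]_y (u y * partials (mi_seq a) (kernel k) (y - l *: x))).
  rewrite uvx /mollify -/m mulrCA; congr (_ * _); rewrite mulrA -exprMn mulrN1 opprK //.
rewrite molE -mulrBr -mulrBr normrM normrM normfV (gtr0_norm m0) ler_pM2l ?invr_gt0//.
have ln1 : `|(- l) ^+ mi_order a| <= 1.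
  rewrite normrX normrN (gtr0_norm l0) exprn_ile1 ?(ltW l0)//.
  by rewrite -kl lerDr ltW.
have iQ : mu.-integrable setT (EFin \o (fun y => u y * partials (mi_seq a) Q (y + - l *: x))).
  apply: integrable_mul_continuous => //; apply: polyfn_continuous.
  have := polyfn_affine (- l *: x) 1 (polyfn_partials (mi_seq a) pQ).
  by under eq_fun do rewrite scale1r addrC.
have iK : mu.-integrable setT
    (EFin \o (fun y => u y * partials (mi_seq a) (kernel k) (y - l *: x))).
  apply: integrable_mul_continuous => //.
  have -> : (fun y => partials (mi_seq a) (kernel k) (y - l *: x)) =
    partials (mi_seq a) (fun y => kernel k (y - l *: x)) by rewrite partials_shift.
  by have [/(_ (mi_seq a))[]] := tf.
have iu : mu.-integrable setT (EFin \o (fun y => `|u y|)).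
  by have := integrable_norm (L2_integrable u2).
rewrite -RintegralB//; apply: (@le_trans _ _ (1 * (C * \int[mu]_y `|u y|))); last by rewrite mul1r.
rewrite ler_pM//.
have iB := integrableB measurableT iQ iK.
apply: (le_trans (le_normr_Rintegral measurableT iB)).
rewrite -RintegralZl//; apply: le_Rintegral_ball.
- by have := integrable_norm iB.
- by have := integrableZl measurableT C iu.
move=> y yB /=; rewrite -mulrBr normrM mulrC ler_wpM2r// K0 scaleNr.
by apply: close; exact: nsq_sub_lt4.
Qed.

End fixed_scale.

Lemma mollify_close v n (eta : R) : v \in L2 -> 0 < eta -> exists k0 : R, 0 < k0 /\
  forall k l P, 0 < k -> k <= k0 -> k <= 2^-1 -> k + l = 1 -> polyfn P ->
  (forall x, eball x -> `|P x - l ^+ n * mollify k l v x| <= eta / (6 * (fine (mu setT) + 1))) ->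
  l2norm (fun x => v x - P x) <= eta.
Proof.
move=> v2 eta0; set U := fine (mu setT) + 1.
have mu0 : 0 <= fine (mu setT) by exact: fine_ge0.
have U1 : 1 <= U by rewrite lerDr.
have U0 : 0 < U by exact: lt_le_trans U1.
(* The constants share out [eta ^+ 2]: as [l >= 1/2], [1 + l ^- d <= D], so that each of the two
   terms in [mollify_error] is at most [eta ^+ 2 / 9], and 3 times their sum is below [eta ^+ 2]. *)
pose b := eta / (6 * U); have b0 : 0 < b by rewrite divr_gt0// mulr_gt0.
pose D : R := 1 + 2 ^+ d; have D1 : 1 <= D by rewrite lerDl exprn_ge0.
have D0 : 0 < D by exact: lt_le_trans D1.
pose delta := eta / (3 * D); have delta0 : 0 < delta by rewrite divr_gt0// mulr_gt0.
have [q pq qv] := polyfn_dense v2 delta0.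
have [C [C0 qC]] := polyfn_lipschitz pq.
have [M qM] : exists M : R, forall x, eball x -> `|q x| <= M.
  exact/continuous_eball_bounded/polyfn_continuous.
pose A := n%:R * `|M| + C * 2 + 1; have A0 : 0 < A.
  by rewrite ltr_wpDl// addr_ge0// mulr_ge0.
exists (b / A); split=> [|k l P k0 kb k2 kl pP close]; first by rewrite divr_gt0.
have l0 : 0 < l by lra.
have err := mollify_error k0 l0 kl v2 pq pP qM qC close.
rewrite -(@ler_pXn2r _ 2)// ?nnegrE ?l2norm_ge0 ?(ltW eta0)//.
apply: (le_trans err); rewrite -/U -/b.
have ld : l ^- d <= 2 ^+ d.
  rewrite -exprVn lerXn2r// ?nnegrE ?invr_ge0 ?(ltW l0)//.
  by rewrite -[leRHS]invrK lef_pV2 ?posrE ?invr_gt0//; lra.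
have t1 : l2norm (fun x => v x - q x) ^+ 2 * (1 + l ^- d) <= eta ^+ 2 / 9.
  apply: (@le_trans _ _ (delta ^+ 2 * D)).
    rewrite ler_pM ?sqr_ge0//; first by rewrite addr_ge0// invr_ge0 exprn_ge0// ltW.
      by rewrite lerXn2r// ?nnegrE ?l2norm_ge0// ltW.
    by rewrite lerD2l.
  have -> : delta ^+ 2 * D = eta ^+ 2 / 9 / D by rewrite /delta; field; rewrite gt_eqF.
  by rewrite ler_pdivrMr// ler_peMr// divr_ge0// sqr_ge0.
have bern : 1 - l ^+ n <= n%:R * k.
  have : 1 + n%:R * (- k) <= (1 + - k) ^+ n by apply: bernoulli_ge; lra.
  have -> : 1 + - k = l by lra.
  by move: (l ^+ n) => Z; lra.
have B2 : (1 - l ^+ n) * M + C * (2 * k) + b <= 2 * b.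
  have h1 : (1 - l ^+ n) * M <= n%:R * k * `|M|.
    apply: (@le_trans _ _ ((1 - l ^+ n) * `|M|)).
      rewrite ler_wpM2l ?ler_norm// subr_ge0 exprn_ile1 ?(ltW l0)//; lra.
    by rewrite ler_wpM2r.
  have h2 : k * A <= b by rewrite -ler_pdivlMr.
  have h3 : k * A = n%:R * k * `|M| + C * (2 * k) + k by rewrite /A; ring.
  by rewrite h3 in h2; lra.
have M0 : 0 <= M.
  apply: (le_trans _ (qM 0 _)); first exact: normr_ge0.
  by apply/eballE; rewrite /nsq big1// => i _; rewrite mxE expr0n.
have B0 : 0 <= (1 - l ^+ n) * M + C * (2 * k) + b.
  apply: addr_ge0 (ltW b0); apply: addr_ge0; apply: mulr_ge0 => //.
    by rewrite subr_ge0 exprn_ile1 ?(ltW l0)//; lra.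
  by rewrite mulr_ge0// ltW.
have t2 : ((1 - l ^+ n) * M + C * (2 * k) + b) ^+ 2 * fine (mu setT) <= eta ^+ 2 / 9.
  apply: (@le_trans _ _ ((2 * b) ^+ 2 * U)).
    apply: ler_pM => //; [exact: sqr_ge0| |by rewrite lerDl].
    by rewrite lerXn2r// nnegrE (le_trans B0).
  have -> : (2 * b) ^+ 2 * U = eta ^+ 2 / 9 / U by rewrite /b; field; rewrite gt_eqF.
  by rewrite ler_pdivrMr// ler_peMr// divr_ge0// sqr_ge0.
move: t1 t2; set X := _ * (1 + _); set Y := _ * fine _ => t1 t2.
have := sqr_ge0 eta; lra.
Qed.

Lemma approximant_dense m u (v : ('I_d -> nat) -> 'rV[R]_d -> R) (eta : R) :
  u \in L2 -> (forall a, (mi_order a <= m)%N -> weak_deriv a u (v a)) -> 0 < eta ->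
  exists k l q, [/\ 0 < k, 0 < l, k + l = 1 &
    forall a : {ffun 'I_d -> 'I_m.+1}, (mi_order (fun i => a i) <= m)%N ->
      l2norm (fun x => v (fun i => a i) x - mpartial (fun i => a i) (approximant k l u q) x)
        <= eta].
Proof.
move=> u2 uv eta0; set U := fine (mu setT) + 1.
pose mi (a : {ffun 'I_d -> 'I_m.+1}) : 'I_d -> nat := fun i => a i.
have mu0 : 0 <= fine (mu setT) by exact: fine_ge0.
have U0 : 0 < U by rewrite ltr_wpDl.
pose b := eta / (6 * U); have b0 : 0 < b by rewrite divr_gt0// mulr_gt0.
have /choice[K KP] : forall a, exists k0 : R, 0 < k0 /\ ((mi_order (mi a) <= m)%N ->
    forall k l P, 0 < k -> k <= k0 -> k <= 2^-1 -> k + l = 1 -> polyfn P ->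
    (forall x, eball x -> `|P x - l ^+ mi_order (mi a) * mollify k l (v (mi a)) x| <= b) ->
    l2norm (fun x => v (mi a) x - P x) <= eta).
  move=> a; have [am|am] := boolP (mi_order (mi a) <= m)%N; last by exists 1.
  have [v2 _] := uv _ am.
  by have [k0 [k00 H]] := mollify_close (mi_order (mi a)) v2 eta0; exists k0.
have /choice[C CP] := fun a => partials_radial_close (mi_seq (mi a)).
(* A scale common to all multi-indices, at most 1/2 and at most each [K a]. *)
pose k := (2 + \sum_a (K a)^-1)^-1.
have S0 : 0 <= \sum_a (K a)^-1.
  by apply: sumr_ge0 => a _; rewrite invr_ge0 ltW//; have [] := KP a.
have k0 : 0 < k by rewrite invr_gt0 ltr_pwDl.
have k2 : k <= 2^-1 by rewrite lef_pV2 ?posrE ?ltr_pwDl// lerDl.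
have kK a : k <= K a.
  have [Ka _] := KP a; rewrite -[leRHS]invrK lef_pV2 ?posrE ?invr_gt0 ?ltr_pwDl//.
  rewrite (bigD1 a)//= addrCA lerDl addr_ge0// sumr_ge0// => a' _.
  by rewrite invr_ge0 ltW//; have [] := KP a'.
pose l := 1 - k; have l0 : 0 < l by rewrite /l; lra.
have kl : k + l = 1 by rewrite /l; lra.
have [F [TF F0]] := bump_tower k.
pose W := (fine (@kernel_mass R d k))^-1 * \int[mu]_y `|u y|.
have W0 : 0 <= W.
  by rewrite mulr_ge0 ?invr_ge0 ?(ltW (kernel_mass_gt0 _ _))//; apply: Rintegral_ge0.
pose CS := \sum_a C a.
have CS0 : 0 <= CS by apply: sumr_ge0 => a _; have [] := CP a.
pose e := b / ((CS + 1) * (W + 1)).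
have e0 : 0 < e by rewrite divr_gt0// mulr_gt0// ltr_wpDl.
have [q qP] := @tower_approx _ m F 4 e TF (ltr0n _ 4) e0.
exists k, l, q; split=> // a am.
have [_ H] := KP a; apply: (H am k l) => //.
  exact/polyfn_partials/polyfn_approximant.
move=> x xB; have [Ca0 cl] := CP a.
have close := cl _ _ e (poly_tower q) TF.
apply: le_trans (mpartial_approximant k0 l0 kl u2 (uv _ am) TF F0 (mulr_ge0 Ca0 (ltW e0)) (close _) xB) _.
  move=> j t js t0 t4.
  by rewrite distrC; apply: qP => //; apply: leq_trans js _; rewrite size_mi_seq.
have -> : (fine (@kernel_mass R d k))^-1 * (C a * e * \int[mu]_y `|u y|) = C a * W * e.
  by rewrite /W; ring.
apply: (@le_trans _ _ ((CS + 1) * (W + 1) * e)).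
  rewrite ler_wpM2r ?(ltW e0)// ler_pM//.
    rewrite /CS (bigD1 a)//= -addrA lerDl addr_ge0// sumr_ge0// => a' _.
    by have [] := CP a'.
  by rewrite lerDl.
by rewrite /e mulrC divfK// gt_eqF// mulr_gt0// ltr_wpDl.
Qed.

End approximation.

(** * Rotation invariance and radial polynomials *)

Section rotation.
Variables (R : realType) (d : nat).
Local Notation mu := (ball_measure R d).
Local Notation lam := (lebesgue_rV R d).
Implicit Types (x y z : 'rV[R]_d).

Variables (i j : 'I_d) (c s : R).
Hypotheses (ij : i != j) (cs : c ^+ 2 + s ^+ 2 = 1) (c1 : 0 <= c).

(** The angles are limited by [0 <= c], which keeps the denominator [1 + c] of the shears in [rotE]
    away from zero. *)
Definition rot x : 'rV[R]_d :=
  \row_k (if k == i then c * x ord0 i - s * x ord0 j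
    else if k == j then s * x ord0 i + c * x ord0 j else x ord0 k).

Let ji : (j == i) = false. Proof. by rewrite eq_sym (negbTE ij). Qed.

Lemma nsq_rot x : nsq (rot x) = nsq x.
Proof.
rewrite /nsq (bigD1 i)//= (bigD1 j) ?ji//= [RHS](bigD1 i)//= [in RHS](bigD1 j) ?ji//=.
rewrite !addrA; congr (_ + _).
  rewrite !mxE eqxx ji eqxx.
  move: (x ord0 i) (x ord0 j) => a b.
  have -> : (c * a - s * b) ^+ 2 + (s * a + c * b) ^+ 2 = (c ^+ 2 + s ^+ 2) * (a ^+ 2 + b ^+ 2) by ring.
  by rewrite cs mul1r.
by apply: eq_bigr => k /andP[ki kj]; rewrite mxE (negbTE ki) (negbTE kj).
Qed.

Lemma rotB x y : rot (x - y) = rot x - rot y.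
Proof. by apply/rowP => k; rewrite !mxE; case: ifP => _; [|case: ifP => _]; ring. Qed.

Lemma rotZ (a : R) x : rot (a *: x) = a *: rot x.
Proof. by apply/rowP => k; rewrite !mxE; case: ifP => _; [|case: ifP => _]; ring. Qed.

Let sheari (t : R) x := x + (t * x ord0 j) *: delta_mx ord0 i.
Let shearj (t : R) x := x + (t * x ord0 i) *: delta_mx ord0 j.

(* A rotation is a product of three shears, which preserve the Lebesgue measure by
   Fubini. *)
Let rotE x : rot x = sheari (- (s / (1 + c))) (shearj s (sheari (- (s / (1 + c))) x)).
Proof.
have c0 : 1 + c != 0 by rewrite gt_eqF// ltr_pwDl.
have s2 : s ^+ 2 = (1 - c) * (1 + c) by rewrite -[s ^+ 2](addKr (c ^+ 2)) cs; ring.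
apply/rowP => k; rewrite !mxE !eqxx/= ?ji ?(negbTE ij) /=.
have [->|ki] := eqVneq k i.
  rewrite (negbTE ij) /= !mulr1 !mulr0 !addr0.
  move: (x ord0 i) (x ord0 j) => a b.
  set t := s / (1 + c); have st : s * t = 1 - c by rewrite /t mulrA -expr2 s2 mulfK.
  have tc : t * (1 + c) = s by rewrite /t divfK.
  have -> : a + - t * b + - t * (b + s * (a + - t * b)) = (1 - s * t) * a - (2 - s * t) * t * b by ring.
  by rewrite st -tc; ring.
have [->|kj] := eqVneq k j.
  rewrite /= !mulr1 !mulr0 !addr0.
  move: (x ord0 i) (x ord0 j) => a b.
  set t := s / (1 + c); have st : s * t = 1 - c by rewrite /t mulrA -expr2 s2 mulfK.
  have -> : b + s * (a + - t * b) = (1 - s * t) * b + s * a by ring.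
  by rewrite st; ring.
by rewrite !mulr0 !addr0.
Qed.

Local Open Scope ereal_scope.

Let measurable_shear (a b : 'I_d) (t : R) :
  measurable_fun setT (fun x : 'rV[R]_d => x + (t * x ord0 b) *: delta_mx ord0 a)%R.
Proof.
apply: measurable_rowP => k; under eq_fun do rewrite !mxE.
apply: measurable_funD; first exact: measurable_coord.
by apply: measurable_funM => //; apply: measurable_funM => //; exact: measurable_coord.
Qed.

Let shear_inv (a b : 'I_d) (t : R) (f : 'rV[R]_d -> \bar R) : a != b ->
  measurable_fun setT f -> (forall x, 0 <= f x) ->
  \int[lam]_x f (x + (t * x ord0 b) *: delta_mx ord0 a)%R = \int[lam]_x f x.
Proof.
move=> ab mf f0; apply: (ge0_integral_shear (g := fun x => (t * x ord0 b)%R)) => //.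
  by apply: measurable_funM => //; exact: measurable_coord.
by move=> x r; rewrite !mxE [b == a]eq_sym (negbTE ab) andbF mulr0 addr0.
Qed.

Lemma measurable_rot : measurable_fun setT rot.
Proof.
have mX k : measurable_fun setT (fun x : 'rV[R]_d => x ord0 k) by exact: measurable_coord.
apply: measurable_rowP => k; under eq_fun do rewrite !mxE.
have m1 : measurable_fun setT (fun x : 'rV[R]_d => c * x ord0 i - s * x ord0 j)%R.
  by apply: measurable_funB; exact: measurable_funM.
have m2 : measurable_fun setT (fun x : 'rV[R]_d => s * x ord0 i + c * x ord0 j)%R.
  by apply: measurable_funD; exact: measurable_funM.
by case: (k == i); [exact: m1|case: (k == j); [exact: m2|exact: mX]].
Qed.

Lemma ge0_integral_rot (f : 'rV[R]_d -> \bar R) :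
  measurable_fun setT f -> (forall x, 0 <= f x) ->
  \int[lam]_x f (rot x) = \int[lam]_x f x.
Proof.
move=> mf f0; under eq_integral do rewrite rotE.
have mi t := measurable_shear i j t; have mj t := measurable_shear j i t.
have jni : j != i by rewrite ji.
rewrite (@shear_inv i j _ (fun x => f (sheari (- (s / (1 + c))) (shearj s x))))//; last first.
  exact: measurableT_comp mf (measurableT_comp (mi _) (mj _)).
rewrite (@shear_inv j i _ (fun x => f (sheari (- (s / (1 + c))) x)))//; last first.
  exact: measurableT_comp mf (mi _).
exact: shear_inv.
Qed.

Lemma eball_rot x : eball (rot x) <-> eball x.
Proof. by rewrite !eballE nsq_rot. Qed.

Let ge0_integral_ball_rot (f : 'rV[R]_d -> \bar R) :
  measurable_fun setT f -> (forall x, 0 <= f x) ->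
  \int[mu]_x f (rot x) = \int[mu]_x f x.
Proof.
move=> mf f0; rewrite !integral_ball_measure//; last exact: measurableT_comp mf measurable_rot.
rewrite [LHS]integral_mkcond [RHS]integral_mkcond.
have mp : measurable_fun setT (f \_ (@eball R d)).
  apply/(measurable_restrictT _ _).1; first exact: measurable_eball.
  exact: measurable_funS mf.
rewrite -(ge0_integral_rot mp) => [|x]; last by rewrite /patch; case: ifP.
apply: eq_integral => x _; rewrite /patch.
have -> : (rot x \in @eball R d) = (x \in @eball R d).
  by apply/idP/idP; rewrite !inE => /eball_rot.
by [].
Qed.

Lemma integral_ball_rot (f : 'rV[R]_d -> \bar R) : measurable_fun setT f ->
  \int[mu]_x f (rot x) = \int[mu]_x f x.
Proof.
move=> mf; rewrite integralE [RHS]integralE.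
rewrite -(ge0_integral_ball_rot (measurable_funepos mf))//.
rewrite -(ge0_integral_ball_rot (measurable_funeneg mf))//.
by rewrite -[X in \int[mu]_x X^\+ x]/(f \o rot) -[X in \int[mu]_x X^\- x]/(f \o rot) funepos_comp funeneg_comp.
Qed.

Lemma ae_rot (P : 'rV[R]_d -> Prop) : {ae mu, forall x, P x} -> {ae mu, forall x, P (rot x)}.
Proof.
move=> [N [mN N0 PN]]; exists (rot @^-1` N); split; last by move=> x /= nP; exact: PN.
  by rewrite -[X in measurable X]setTI; exact: measurable_rot.
have mi (A : set 'rV[R]_d) : measurable A -> mu A = \int[mu]_x (\1_A x)%:E.
  by move=> mA; rewrite integral_indic// setIT.
rewrite mi; last by rewrite -[X in measurable X]setTI; exact: measurable_rot.
rewrite -N0 mi// -[RHS]integral_ball_rot; first exact: eq_integral.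
by apply/measurable_EFinP; exact: measurable_indic.
Qed.

End rotation.

Section radial_approximant.
Variables (R : realType) (d : nat).
Local Notation mu := (ball_measure R d).
Local Notation L2 := (Lfun mu 2%:E).
Implicit Types (x y z : 'rV[R]_d) (G : 'rV[R]_d -> R).

Definition rot_invariant G := forall (i j : 'I_d) (c s : R), i != j -> c ^+ 2 + s ^+ 2 = 1 ->
  0 <= c -> forall x, G (rot i j c s x) = G x.

Lemma approximant_rot (k l : R) u (q : {poly R}) : u \in L2 -> radial u ->
  rot_invariant (approximant k l u q).
Proof.
move=> u2 [f uf] i j c s ij cs c0 x; rewrite /approximant; congr (_ * _).
have mu_ := L2_measurable u2.
have mq z : measurable_fun setT (fun y : 'rV[R]_d => q.[nsq (y - l *: z)]).
  apply: continuous_measurable_rV; apply: polyfn_continuous.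
  apply: polyfn_horner; have := polyfn_affine (- (l *: z)) 1 (@polyfn_nsq R d).
  by under eq_fun do rewrite scale1r addrC.
rewrite /Rintegral; congr fine.
rewrite -(integral_ball_rot ij cs c0); last first.
  by apply/measurable_EFinP; exact: measurable_funM.
apply: ae_eq_integral => //.
- apply/measurable_EFinP; apply: measurable_funM.
    by apply: (measurableT_comp mu_); exact: measurable_rot.
  apply: (measurableT_comp (mq _)); exact: measurable_rot.
- by apply/measurable_EFinP; exact: measurable_funM.
apply: filterS2 uf (ae_rot ij cs c0 uf) => y uy ury _ /=.
rewrite -(rotZ i j c s l x) -rotB nsq_rot// ury uy; congr (EFin (f _ * _)).
by rewrite /enorm -/(nsq _) nsq_rot.
Qed.

Lemma polyfn_line G v : polyfn G -> exists p : {poly R}, forall t : R, G (t *: v) = p.[t].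
Proof.
elim=> [a|i|f g _ [p pE] _ [q qE]|f g _ [p pE] _ [q qE]].
- by exists a%:P => t; rewrite hornerC.
- by exists ('X * (v ord0 i)%:P) => t; rewrite !hornerE mxE.
- by exists (p + q) => t; rewrite hornerD pE qE.
- by exists (p * q) => t; rewrite hornerM pE qE.
Qed.

(** Givens rotations: each coordinate in turn is rotated into the coordinate [i0], which does not
    disturb those already annihilated. *)
Lemma rot_invariant_axis G (i0 : 'I_d) (S : seq 'I_d) x : rot_invariant G -> i0 \notin S ->
  exists y, [/\ G y = G x, nsq y = nsq x & forall k, k \in S -> y ord0 k = 0].
Proof.
move=> GR; elim: S => [|k S IH]; first by move=> _; exists x.
rewrite inE negb_or => /andP[ik iS]; have [y [Gy ny y0]] := IH iS.
pose a := y ord0 i0; pose b := y ord0 k; pose r := Num.sqrt (a ^+ 2 + b ^+ 2).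
have [yk|yk] := eqVneq b 0.
  exists y; split=> // k'; rewrite inE => /orP[/eqP ->//|]; exact: y0.
have ab0 : 0 < a ^+ 2 + b ^+ 2 by rewrite ltr_wpDl ?sqr_ge0// exprn_even_gt0.
have r0 : 0 < r by rewrite sqrtr_gt0.
have r2 : r ^+ 2 = a ^+ 2 + b ^+ 2 by rewrite sqr_sqrtr// ltW.
have [c [s [c0 cs sab]]] : exists c s : R, [/\ 0 <= c, c ^+ 2 + s ^+ 2 = 1 & s * a + c * b = 0].
  have csE : (a / r) ^+ 2 + (b / r) ^+ 2 = 1.
    by rewrite !expr_div_n -mulrDl r2 divff// gt_eqF.
  (* Of the two opposite choices of [(c, s)] that annihilate the coordinate, the one with
     [0 <= c]. *)
  have [a0|a0] := leP 0 a.
    exists (a / r), (- (b / r)); split; [by rewrite divr_ge0// ltW|by rewrite sqrrN|by ring].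
  exists (- (a / r)), (b / r); split; [|by rewrite sqrrN|by ring].
  by rewrite -mulNr divr_ge0 ?(ltW r0)// oppr_ge0 ltW.
exists (rot i0 k c s y); split; first by rewrite (GR _ _ _ _ ik cs c0).
  by rewrite nsq_rot.
move=> k' k'S; rewrite mxE; have [ki|ki] := eqVneq k' i0.
  by move: k'S; rewrite ki inE (negbTE ik) (negbTE iS).
have [//|kk] := eqVneq k' k.
by apply: y0; move: k'S; rewrite inE (negbTE kk).
Qed.

(** Along an axis [G] is a polynomial in one variable. It is even, because a half turn of a plane
    containing the axis reverses it, hence a polynomial in the square; [1 < d] provides the
    plane. *)
Lemma rot_invariant_radial G : (1 < d)%N -> polyfn G -> rot_invariant G ->
  exists q : {poly R}, forall x, G x = q.[nsq x].
Proof.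
move=> d1 pG GR; pose i0 : 'I_d := Ordinal (ltnW d1); pose i1 : 'I_d := Ordinal d1.
have i01 : i0 != i1 by [].
pose e : 'rV[R]_d := delta_mx ord0 i0.
have [p pE] := polyfn_line e pG.
(* Two quarter turns are composed, since a half turn has [c = - 1]. *)
have even t : p.[- t] = p.[t].
  rewrite -!pE; pose Q := rot i0 i1 (0 : R) 1.
  have h0 : (0 : R) ^+ 2 + 1 ^+ 2 = 1 by rewrite expr0n expr1n add0r.
  rewrite -(GR i0 i1 0 1 i01 h0 (lexx _) (t *: e)) -(GR i0 i1 0 1 i01 h0 (lexx _) (rot _ _ _ _ _)).
  congr G; apply/rowP => k; rewrite !mxE !eqxx/=.
  have [_|ki] := eqVneq k i0; first by rewrite /=; ring.
  have [_|kj] := eqVneq k i1; first by rewrite /=; ring.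
  by rewrite /= !mulr0.
exists (even_poly p) => x.
pose S := [seq k <- enum 'I_d | k != i0].
have iS : i0 \notin S by rewrite mem_filter eqxx.
have [y [Gy ny y0]] := rot_invariant_axis x GR iS.
have yE : y = y ord0 i0 *: e.
  apply/rowP => k; rewrite !mxE /=; have [->|ki] := eqVneq k i0; first by rewrite mulr1.
  by rewrite mulr0 y0// mem_filter ki mem_enum.
have nE : nsq y = y ord0 i0 ^+ 2.
  rewrite {1}yE nsqZ /nsq (bigD1 i0)//= !mxE eqxx/= expr1n big1 ?addr0 ?mulr1// => k ki.
  by rewrite mxE (negbTE ki) andbF expr0n.
rewrite -Gy yE pE -ny nE; set t := y ord0 i0.
have E r : p.[r] = (even_poly p).[r ^+ 2] + (odd_poly p).[r ^+ 2] * r.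
  by rewrite -[in LHS](poly_even_odd p) !hornerE !horner_comp !hornerE.
have := even t; have := E t; rewrite (E (- t)) sqrrN => -> h; move: h.
set A := _.[_]; set B := _ * t.
have -> : (odd_poly p).[t ^+ 2] * - t = - B by rewrite mulrN.
lra.
Qed.

End radial_approximant.

(** * Radial polynomials in the Sobolev spaces *)

Section Hrad_dense.
Variables (R : realType) (d m : nat).
Local Notation mu := (ball_measure R d).
Local Notation L2 := (Lfun mu 2%:E).
Local Notation H := (@Hrad_pred R d m).
Local Open Scope quotient_scope.
Implicit Types u : 'rV[R]_d -> R.

Lemma Hrad_jet u : u \in H -> exists v, jet m u v.
Proof.
move=> /asboolP[u2 _ uw].
have /choice[v vP] : forall a, exists v, (mi_order a <= m)%N -> weak_deriv a u v.
  move=> a; have [/uw[v uv]|_] := boolP (mi_order a <= m)%N; first by exists v.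
  by exists 0.
exists (fun a => if `[< a = fun=> 0%N >] then u else v a); split.
  by apply: filterS (ball_measure_ae R d) => x _; rewrite asboolT.
move=> a am; case: asboolP => [->|_]; last exact: vP.
split=> // f _; rewrite mpartial0 /mi_order big1// expr0 mul1r.
exact: eq_Rintegral.
Qed.

Lemma jetB u P v : u \in L2 -> polyfn P -> jet m u v ->
  jet m (fun x => u x - P x) (fun a x => v a x - mpartial a P x).
Proof.
move=> u2 pP [uv vP]; split; first by apply: filterS uv => x ->; rewrite mpartial0.
move=> a am.
have := weak_deriv_lin (-1) (polyfn_L2 pP) u2 (polyfn_weak_deriv a pP) (vP a am).
have E (f g : 'rV[R]_d -> R) : -1 *: f + g = fun x => g x - f x.
  by apply/funext => x; rewrite -[LHS]/(-1 * f x + g x) mulN1r addrC.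
by rewrite !E.
Qed.

Lemma jet_norm_le (v : ('I_d -> nat) -> 'rV[R]_d -> R) (eta : R) : 0 <= eta ->
  (forall a : {ffun 'I_d -> 'I_m.+1}, (mi_order (fun i => a i) <= m)%N ->
    l2norm (v (fun i => a i)) <= eta) ->
  jet_norm m v <= #|{: {ffun 'I_d -> 'I_m.+1}}|%:R * eta.
Proof.
move=> eta0 vle; set N := #|_|.
have N0 : (0 : R) <= N%:R * eta by rewrite mulr_ge0.
rewrite -(@ler_pXn2r _ 2)// ?nnegrE ?sqrtr_ge0// sqr_sqrtr; last first.
  by apply: sumr_ge0 => a _; exact: sqr_ge0.
apply: (@le_trans _ _ (\sum_(a : {ffun 'I_d -> 'I_m.+1}) eta ^+ 2)).
  rewrite big_mkcond/=; apply: ler_sum => a _; case: ifPn => [am|_]; last exact: sqr_ge0.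
  by rewrite lerXn2r// ?nnegrE ?l2norm_ge0// vle.
rewrite sumr_const -[#|_|]/N exprMn -[leLHS]mulr_natl ler_wpM2r ?sqr_ge0// -natrX ler_nat.
by case: N {N0} => // n; rewrite expnS expn1 leq_pmulr.
Qed.

Definition radial_poly (q : {poly R}) (x : 'rV[R]_d) : R := q.[nsq x].

Lemma polyfn_radial_poly q : polyfn (radial_poly q).
Proof. exact/polyfn_horner/polyfn_nsq. Qed.

Lemma radial_poly_Hrad q : radial_poly q \in H.
Proof.
apply/asboolP; split; first exact/polyfn_L2/polyfn_radial_poly.
  exists (fun r => q.[r ^+ 2]); apply: filterS (ball_measure_ae R d) => x _.
  by rewrite enorm_sqr.
by move=> a _; exists (mpartial a (radial_poly q)); exact/polyfn_weak_deriv/polyfn_radial_poly.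
Qed.

Lemma radial_poly_dense u (eps : R) : (1 < d)%N -> u \in H -> 0 < eps ->
  exists q, sobolev_norm m (fun x => u x - radial_poly q x) <= eps.
Proof.
move=> d1 uH eps0; have [v uv] := Hrad_jet uH.
have /asboolP[u2 ur _] := uH; set N := #|{: {ffun 'I_d -> 'I_m.+1}}|.
have N0 : (0 : R) < N%:R + 1 by rewrite ltr_wpDl.
have eta0 : 0 < eps / (N%:R + 1) by rewrite divr_gt0.
have [k [l [q [k0 l0 kl close]]]] := approximant_dense u2 uv.2 eta0.
have pP := @polyfn_approximant R d k l u q u2.
have [E EP] := rot_invariant_radial d1 pP (approximant_rot k l q u2 ur).
exists E; have -> : (fun x => u x - radial_poly E x) = (fun x => u x - approximant k l u q x).
  by apply/funext => x; rewrite EP.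
rewrite (sobolev_norm_jet (jetB u2 pP uv)).
apply: (le_trans (jet_norm_le (v := fun a x => v a x - _) (ltW eta0) close)).
by rewrite mulrCA ler_piMr ?(ltW eps0)// ler_pdivrMr// mul1r lerDl.
Qed.

Definition radial_class (q : {poly R}) : Hrad R d m := \pi_(Hrad R d m) (HradFun (radial_poly_Hrad q)).

Lemma Hrad_norm_pi (u : hrad_fun R d m) : `|\pi_(Hrad R d m) u : Hrad R d m| = sobolev_norm m u.
Proof. exact: sobolev_norm_ae (hrad_valP _) (hrad_valP u) (ae_reprP u). Qed.

Lemma Hrad_fun_radial_class q : {ae mu, forall x, Hrad_fun (radial_class q) x = radial_poly q x}.
Proof. exact: (ae_reprP (HradFun (radial_poly_Hrad q))). Qed.

Lemma radial_class_linear (c : R) p q :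
  radial_class (c *: p + q) = c *: radial_class p + radial_class q.
Proof.
have -> : c *: radial_class p = \pi_(Hrad R d m) (c *: HradFun (radial_poly_Hrad p)).
  exact: Hrad_scale_pi.
rewrite /radial_class.
have D (x y : hrad_fun R d m) : \pi_(Hrad R d m) x + \pi_(Hrad R d m) y = \pi_(Hrad R d m) (x + y).
  by rewrite !piE.
rewrite [RHS]D; apply: Hrad_eqP; apply: filterS (ball_measure_ae R d) => x _.
by rewrite -[RHS]/(c * radial_poly p x + radial_poly q x) /= /radial_poly !hornerE.
Qed.

Lemma radial_class_dense (u : Hrad R d m) (eps : R) : (1 < d)%N -> 0 < eps ->
  exists q, `|u - radial_class q| <= eps.
Proof.
move=> d1 eps0; have [q qP] := radial_poly_dense d1 (hrad_valP (repr u)) eps0.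
exists q; rewrite -[u]reprK /radial_class.
have B (x y : hrad_fun R d m) : \pi_(Hrad R d m) x - \pi_(Hrad R d m) y = \pi_(Hrad R d m) (x - y).
  by rewrite !piE.
by rewrite [X in `|X|]B Hrad_norm_pi.
Qed.

End Hrad_dense.

(** * Completeness *)

Section completeness.
Variables (R : realType) (d : nat).
Local Notation mu := (ball_measure R d).
Local Notation L2 := (Lfun mu 2%:E).
Implicit Types f g u v : 'rV[R]_d -> R.

Lemma L2_cauchy_schwarz f g : f \in L2 -> g \in L2 ->
  `|\int[mu]_x (f x * g x)| <= l2norm f * l2norm g.
Proof.
move=> f2 g2; have if2 := Lfun2_integrable_sqr f2; have ig2 := Lfun2_integrable_sqr g2.
have ifg := L2_mul_integrable f2 g2.
set b := \int[mu]_x (f x * g x).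
rewrite -(@ler_pXn2r _ 2)// ?nnegrE ?mulr_ge0 ?l2norm_ge0// exprMn !l2norm_sqr//.
rewrite real_normK ?num_real//.
set a := \int[mu]_x (f x ^+ 2); set c := \int[mu]_x (g x ^+ 2).
have a0 : 0 <= a by apply: Rintegral_ge0 => x _; exact: sqr_ge0.
have h (t : R) : 0 <= t ^+ 2 * a - 2 * t * b + c.
  have i1 : mu.-integrable setT (EFin \o (fun x => t ^+ 2 * f x ^+ 2)).
    by have := integrableZl measurableT (t ^+ 2) if2.
  have i2 : mu.-integrable setT (EFin \o (fun x => 2 * t * (f x * g x))).
    by have := integrableZl measurableT (2 * t) ifg.
  have : 0 <= \int[mu]_x ((t * f x - g x) ^+ 2).
    by apply: Rintegral_ge0 => x _; exact: sqr_ge0.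
  rewrite /a /b /c -!RintegralZl// -RintegralB// -RintegralD//; last first.
    by have := integrableB measurableT i1 i2.
  congr (0 <= _); apply: eq_Rintegral => x _; ring.
have [az|an0] := eqVneq a 0.
  have hb (t : R) : 2 * t * b <= c by have := h t; rewrite az; lra.
  have [->|bn0] := eqVneq b 0; first by rewrite expr0n/= az mul0r.
  have := hb ((c + 1) / (2 * b)).
  have -> : 2 * ((c + 1) / (2 * b)) * b = c + 1 by field.
  lra.
have ap : 0 < a by rewrite lt_neqAle eq_sym an0.
have := h (b / a).
have -> : (b / a) ^+ 2 * a - 2 * (b / a) * b + c = (a * c - b ^+ 2) / a by field.
by rewrite pmulr_lge0 ?invr_gt0// subr_ge0.
Qed.

Lemma sqr_integrable_L2 f : measurable_fun setT f ->
  (\int[mu]_x (f x ^+ 2)%:E < +oo)%E -> f \in L2.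
Proof.
move=> mf fin; rewrite inE; apply/andP; split; rewrite inE//= /finite_norm.
have pw : ('N[mu]_2%:E[EFin \o f] `^ 2 = \int[mu]_x (f x ^+ 2)%:E)%E.
  rewrite (@powR_Lnorm _ _ _ _ (EFin \o f) 2)//; apply: eq_integral => x _.
  by rewrite abse_EFin poweR_EFin powR_mulrn// real_normK ?num_real.
by rewrite ltey; apply/eqP => Ny; move: fin; rewrite -pw Ny poweRyr.
Qed.

Let integral_abs_le f : f \in L2 ->
  (\int[mu]_x `|f x|%:E <= (Num.sqrt (fine (mu setT)) * l2norm f)%:E)%E.
Proof.
move=> f2; have mf := L2_measurable f2.
have af2 : (fun x => `|f x|) \in L2.
  apply: sqr_integrable_L2; first exact: measurableT_comp.
  under eq_integral do rewrite real_normK ?num_real//.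
  have /integrableP[_] := Lfun2_integrable_sqr f2.
  by under eq_integral do rewrite /= ger0_norm ?sqr_ge0//.
have c2 : (fun _ : 'rV[R]_d => (1 : R)) \in L2 by exact/polyfn_L2/polyfn_cst.
have := L2_cauchy_schwarz c2 af2.
have E1 : l2norm (fun _ : 'rV[R]_d => (1 : R)) = Num.sqrt (fine (mu setT)).
  rewrite -[LHS]ger0_norm ?l2norm_ge0// -sqrtr_sqr l2norm_sqr//; congr Num.sqrt.
  by under eq_Rintegral do rewrite expr1n; rewrite Rintegral_cst// mul1r.
have E2 : l2norm (fun x => `|f x|) = l2norm f.
  by apply/eqP; rewrite eq_le !l2norm_le// => x _; rewrite normr_id.
have E3 : \int[mu]_x (1 * `|f x|) = \int[mu]_x `|f x|.
  by apply: eq_Rintegral => x _; rewrite mul1r.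
rewrite E1 E2 E3 ger0_norm; last exact: Rintegral_ge0.
rewrite -lee_fin /Rintegral fineK//.
by apply: integrable_fin_num => //; exact: L2_integrable.
Qed.

Lemma sum_half_le2 n : \sum_(0 <= k < n) (2 ^- k : R) <= 2.
Proof.
suff -> : \sum_(0 <= k < n) (2 ^- k : R) = 2 - 2 * 2 ^- n by rewrite gerBl mulr_ge0// invr_ge0 exprn_ge0.
elim: n => [|n IH]; first by rewrite big_nil expr0 invr1; lra.
rewrite big_nat_recr//= IH exprS invfM; set t := _ ^-1; lra.
Qed.

(* The limit is built as a pointwise upper limit, so that it is a function of
   [enorm x] when the terms are. *)
Lemma L2_complete (w : nat -> 'rV[R]_d -> R) : (forall n, w n \in L2) ->
  (forall eps : R, 0 < eps -> exists N, forall m n, (N <= m)%N -> (N <= n)%N ->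
    l2norm (fun x => w m x - w n x) <= eps) ->
  exists f, [/\ f \in L2, (forall n, radial (w n)) -> radial f &
    forall eps : R, 0 < eps -> exists N, forall n, (N <= n)%N ->
      l2norm (fun x => w n x - f x) <= eps].
Proof.
move=> w2 wC; have mw n := L2_measurable (w2 n).
have /choice[N NP] : forall k, exists N : nat, forall m n, (N <= m)%N -> (N <= n)%N ->
    l2norm (fun x => w m x - w n x) <= 2 ^- k.
  by move=> k; apply: wC; rewrite invr_gt0 exprn_gt0.
(* A sum, so as to be monotone in [k] and at least both [k] and [N k]. *)
pose n_ k := (\sum_(j < k.+1) (N j).+1)%N.
have nS k : (n_ k <= n_ k.+1)%N by rewrite /n_ [leqRHS]big_ord_recr leq_addr.
have nN k : (N k <= n_ k)%N by rewrite /n_ big_ord_recr/= addnS leqW// leq_addl.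
have nk k : (k <= n_ k)%N.
  by rewrite /n_; elim: k => // k IH; rewrite big_ord_recr/= addnS ltnS (leq_trans IH)// leq_addr.
pose f x : R := fine (limn_esup (fun k => (w (n_ k) x)%:E)).
(* The increments are summable in L^1 by Cauchy-Schwarz, [mu] being finite, hence absolutely
   summable at almost every point. *)
pose D k x : R := w (n_ k.+1) x - w (n_ k) x.
have D2 k : D k \in L2 by exact: L2B.
have mD k : measurable_fun setT (fun x => `|D k x|%:E).
  by apply/measurable_EFinP; apply: measurableT_comp => //; exact: L2_measurable.
pose C := Num.sqrt (fine (mu setT)).
have C0 : 0 <= C by exact: sqrtr_ge0.
have iD k : (\int[mu]_x `|D k x|%:E <= (C * 2 ^- k)%:E)%E.
  apply: (le_trans (integral_abs_le (D2 k))); rewrite lee_fin ler_wpM2l//.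
  by apply: NP => //; exact: leq_trans (nN k) (nS k).
have mS : measurable_fun setT (fun x => \sum_(k <oo) `|D k x|%:E)%E.
  by apply: ge0_emeasurable_sum => // k x _ _; rewrite lee_fin.
have iS : mu.-integrable setT (fun x => \sum_(k <oo) `|D k x|%:E)%E.
  apply/integrableP; split => //.
  under eq_integral do rewrite gee0_abs ?nneseries_ge0//.
  rewrite integral_nneseries//; apply: (@le_lt_trans _ _ (C * 2)%:E); last exact: ltry.
  apply: lime_le; first by apply: is_cvg_nneseries => k _ _; exact: integral_ge0.
  apply: nearW => k; apply: (@le_trans _ _ (\sum_(0 <= j < k) (C * 2 ^- j)%:E)%E).
    by apply: lee_sum => j _; exact: iD.
  by rewrite sumEFin lee_fin -mulr_sumr ler_wpM2l// sum_half_le2.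
have cv : {ae mu, forall x, (fun k => w (n_ k) x) @ \oo --> f x}.
  have := integrable_ae measurableT iS; apply: filterS => x /(_ Logic.I) Sfin.
  have : cvgn (fun k => w (n_ k) x).
    have cD : cvgn (series (fun k => D k x)).
      apply: normed_cvg; apply: nondecreasing_is_cvgn.
        by apply: nondecreasing_series => k _ _ /=.
      exists (fine (\sum_(k <oo) `|D k x|%:E)%E) => _ [k _ <-].
      rewrite -lee_fin fineK// /series/= -sumEFin.
      by apply: nneseries_lim_ge => j _ _; rewrite lee_fin.
    have -> : (fun k => w (n_ k) x) = (fun k => w (n_ 0%N) x + series (fun k => D k x) k).
      apply/funext => k; rewrite /series/= /D telescope_sumr//.
      by rewrite addrC subrK.
    by apply: is_cvgD => //; exact: is_cvg_cst.
  move=> /cvg_ex[l wl].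
  have : limn_esup (fun k => (w (n_ k) x)%:E) = l%:E.
    have El : (fun k => (w (n_ k) x)%:E) @ \oo --> l%:E by apply: cvg_EFin => //; exact: nearW.
    rewrite is_cvg_limn_esupE; first exact: cvg_lim El.
    by apply/cvg_ex; exists l%:E.
  by rewrite /f => ->.
have mf : measurable_fun setT f.
  apply: (measurableT_comp (fine_measurable measurableT)).
  by apply: measurable_fun_limn_esup => k; apply/measurable_EFinP.
(* Fatou's lemma along the subsequence carries the Cauchy estimate over to the limit; that [f] is in
   L^2 is then deduced from it. *)
have close (eps : R) (M : nat) : 0 <= eps -> (forall m n, (M <= m)%N -> (M <= n)%N ->
    l2norm (fun x => w m x - w n x) <= eps) -> forall m, (M <= m)%N ->
    (\int[mu]_x ((w m x - f x) ^+ 2)%:E <= (eps ^+ 2)%:E)%E.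
  move=> eps0 wM m Mm; pose h k x := ((w m x - w (n_ k) x) ^+ 2)%:E.
  have mh k : measurable_fun setT (h k).
    by apply/measurable_EFinP; apply: measurable_funX; exact: measurable_funB.
  have h0 k x : setT x -> (0 <= h k x)%E by move=> _; rewrite lee_fin sqr_ge0.
  have -> : (\int[mu]_x ((w m x - f x) ^+ 2)%:E = \int[mu]_x limn_einf (h^~ x))%E.
    apply: ae_eq_integral => //.
    - by apply/measurable_EFinP; apply: measurable_funX; exact: measurable_funB.
    - have -> : (fun x => limn_einf (h^~ x)) = (fun x => - limn_esup (fun k => - h k x))%E.
        by apply/funext => x; rewrite -[LHS]oppeK -limn_esupN.
      apply: measurableT_comp => //; apply: measurable_fun_limn_esup => k.
      exact: measurableT_comp.
    apply: filterS cv => x wf _; have hl : h^~ x @ \oo --> ((w m x - f x) ^+ 2)%:E.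
      apply: cvg_EFin; first exact: nearW.
      have c0 : w m x - w (n_ k) x @[k --> \oo] --> w m x - f x.
        by apply: cvgB => //; exact: cvg_cst.
      exact: (cvgM c0 c0).
    by have [-> _] := cvg_limn_einf_sup hl.
  apply: (le_trans (fatou mu measurableT mh h0)); rewrite limn_einf_lim.
  apply: lime_le; first exact: is_cvg_einfs.
  exists M => // k /= Mk; apply: (@le_trans _ _ (\int[mu]_x h k x)%E).
    by apply: ereal_inf_lbound; exists k => /=.
  have i2 := Lfun2_integrable_sqr (L2B (w2 m) (w2 (n_ k))).
  rewrite -[leLHS]fineK; last exact: integrable_fin_num.
  rewrite lee_fin -/(Rintegral _ _ _) -l2norm_sqr; last exact: L2B.
  rewrite lerXn2r// ?nnegrE ?l2norm_ge0//; apply: wM => //.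
  exact: leq_trans Mk (nk k).
have wfL2 (eps : R) (M : nat) : 0 <= eps -> (forall m n, (M <= m)%N -> (M <= n)%N ->
    l2norm (fun x => w m x - w n x) <= eps) -> forall m, (M <= m)%N ->
    (fun x => w m x - f x) \in L2.
  move=> eps0 wM m Mm; apply: sqr_integrable_L2; first exact: measurable_funB.
  by apply: le_lt_trans (close _ _ eps0 wM m Mm) _; exact: ltry.
exists f; split.
- have [M wM] := wC 1 ltr01.
  rewrite (_ : f = fun x => w M x - (w M x - f x)); last by apply/funext => x; rewrite subKr.
  by apply: L2B => //; exact: wfL2 ler01 wM _ (leqnn M).
- move=> /choice[g gP].
  exists (fun r => fine (limn_esup (fun k => (g (n_ k) r)%:E))).
  have := ae_foralln gP; apply: filterS => x wg; rewrite /f; congr (fine (limn_esup _)).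
  by apply/funext => k; rewrite wg.
- move=> eps eps0; have [M wM] := wC eps eps0; exists M => m Mm.
  have wf2 := wfL2 _ _ (ltW eps0) wM m Mm.
  rewrite -(@ler_pXn2r _ 2)// ?nnegrE ?l2norm_ge0 ?(ltW eps0)// l2norm_sqr// -lee_fin.
  rewrite /Rintegral fineK; first exact: close (ltW eps0) wM m Mm.
  by apply: integrable_fin_num => //; exact: Lfun2_integrable_sqr.
Qed.

End completeness.

Section Hrad_complete.
Variables (R : realType) (d m : nat).
Local Notation mu := (ball_measure R d).
Local Notation L2 := (Lfun mu 2%:E).
Local Notation H := (@Hrad_pred R d m).
Local Open Scope quotient_scope.
Implicit Types u : 'rV[R]_d -> R.

Let subE (f g : 'rV[R]_d -> R) : -1 *: f + g = fun x => g x - f x.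
Proof. by apply/funext => x; rewrite -[LHS]/(-1 * f x + g x) mulN1r addrC. Qed.

Lemma jet_sub u u' v v' : u \in L2 -> u' \in L2 -> jet m u v -> jet m u' v' ->
  jet m (fun x => u x - u' x) (fun a x => v a x - v' a x).
Proof.
move=> u2 u2' [uv vP] [uv' vP']; split; first by apply: filterS2 uv uv' => x -> ->.
move=> a am; have := weak_deriv_lin (-1) u2' u2 (vP' a am) (vP a am).
by rewrite !subE.
Qed.

(** Against a fixed test function, both sides of the integral identity are continuous for the L^2
    norm, by Cauchy-Schwarz. *)
Lemma weak_deriv_limit (a : 'I_d -> nat) (u_ v_ : nat -> 'rV[R]_d -> R) u v :
  (forall n, u_ n \in L2) -> u \in L2 -> v \in L2 ->
  (forall n, weak_deriv a (u_ n) (v_ n)) ->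
  (forall eps : R, 0 < eps -> exists N, forall n, (N <= n)%N ->
    l2norm (fun x => u_ n x - u x) <= eps) ->
  (forall eps : R, 0 < eps -> exists N, forall n, (N <= n)%N ->
    l2norm (fun x => v_ n x - v x) <= eps) ->
  weak_deriv a u v.
Proof.
move=> un2 u2 v2 uv cu cv; split=> // f tf.
have cmp : continuous (mpartial a f) by exact: mpartial_continuous.
have cf : continuous f by rewrite -(mpartial0 f); exact: mpartial_continuous.
have close (g : 'rV[R]_d -> R) w_ w : continuous g -> (forall n, w_ n \in L2) -> w \in L2 ->
    (forall eps : R, 0 < eps -> exists N, forall n, (N <= n)%N ->
      l2norm (fun x => w_ n x - w x) <= eps) ->
    \int[mu]_x (w_ n x * g x) @[n --> \oo] --> \int[mu]_x (w x * g x).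
  move=> cg wn2 w2 cw; apply/cvgrPdist_le => /= eps eps0.
  have g0 : 0 < l2norm g + 1 by rewrite ltr_wpDl// l2norm_ge0.
  have [N NP] := cw _ (divr_gt0 eps0 g0); exists N => // n /= Nn.
  have g2 := continuous_L2 cg.
  have B2 : (fun x => w_ n x - w x) \in L2 by exact: L2B.
  rewrite distrC -RintegralB//; [|exact: L2_mul_integrable|exact: L2_mul_integrable].
  rewrite (_ : \int[mu]_x _ = \int[mu]_x ((w_ n x - w x) * g x)); last first.
    by apply: eq_Rintegral => x _; rewrite mulrBl.
  apply: (le_trans (L2_cauchy_schwarz B2 g2)).
  apply: (@le_trans _ _ (eps / (l2norm g + 1) * (l2norm g + 1))); last by rewrite divfK// gt_eqF.
  by apply: ler_pM; rewrite ?l2norm_ge0// ?NP// lerDl.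
have c1 := close _ _ _ cmp un2 u2 cu.
have vn2 n : v_ n \in L2 by have [] := uv n.
have c2 := close _ _ _ cf vn2 v2 cv.
have c3 : (-1) ^+ mi_order a * \int[mu]_x (v_ n x * f x) @[n --> \oo] -->
    (-1) ^+ mi_order a * \int[mu]_x (v x * f x) by exact: cvgMl_tmp c2.
have E : (fun n => \int[mu]_x (u_ n x * mpartial a f x)) =
    (fun n => (-1) ^+ mi_order a * \int[mu]_x (v_ n x * f x)).
  by apply/funext => n; have [_ ->] := uv n.
by rewrite E in c1; exact: cvg_unique c1 c3.
Qed.

(** All the weak derivatives of order at most [m] converge in L^2, and [weak_deriv_limit] makes
    their limits a jet of the limit function. *)
Lemma Hrad_complete (u : nat -> Hrad R d m) :
  (forall eps : R, 0 < eps -> exists N, forall i j, (N <= i)%N -> (N <= j)%N ->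
    `|u i - u j| <= eps) ->
  exists l : Hrad R d m, u @ \oo --> l.
Proof.
move=> uC; pose w n := repr (u n) : hrad_fun R d m.
have wH n : (w n : 'rV[R]_d -> R) \in H := hrad_valP (w n).
have w2 n : (w n : 'rV[R]_d -> R) \in L2 by have /asboolP[] := wH n.
have wr n : radial (w n) by have /asboolP[] := wH n.
have piB (x y : hrad_fun R d m) : \pi_(Hrad R d m) x - \pi_(Hrad R d m) y = \pi_(Hrad R d m) (x - y).
  by rewrite !piE.
have uB i j : `|u i - u j| = sobolev_norm m (fun x => w i x - w j x).
  by rewrite -[u i]reprK -[u j]reprK [X in `|X|]piB Hrad_norm_pi.
have /choice[v vP] := fun n => Hrad_jet (wH n).
have v2 n a : (mi_order a <= m)%N -> v n a \in L2 by move=> am; have [] := (vP n).2 _ am.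
have vC a : (mi_order a <= m)%N -> forall eps : R, 0 < eps ->
    exists N, forall i j, (N <= i)%N -> (N <= j)%N -> l2norm (fun x => v i a x - v j a x) <= eps.
  move=> am eps eps0; have [N NP] := uC eps eps0; exists N => i j Ni Nj.
  have J := jet_sub (w2 i) (w2 j) (vP i) (vP j).
  by apply: (le_trans (l2norm_jet_le J am)); rewrite -uB NP.
have /choice[V VP] : forall a, exists V, (mi_order a <= m)%N ->
    [/\ V \in L2, (forall n, radial (v n a)) -> radial V &
    forall eps : R, 0 < eps -> exists N, forall n, (N <= n)%N ->
      l2norm (fun x => v n a x - V x) <= eps].
  move=> a; have [am|am] := boolP (mi_order a <= m)%N; last by exists 0.
  by have [V VP] := L2_complete (fun n => v2 n a am) (vC a am); exists V.
have z0 : (mi_order (fun _ : 'I_d => 0%N) <= m)%N by rewrite /mi_order big1.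
pose f := V (fun=> 0%N); have [f2 fr fc] := VP _ z0.
have fV a : (mi_order a <= m)%N -> weak_deriv a f (V a).
  move=> am; have [V2 _ Vc] := VP _ am.
  apply: (@weak_deriv_limit a (fun n => v n (fun=> 0%N)) (fun n => v n a)) => // n; first exact: v2.
  apply: (weak_deriv_ae (w2 n)); [exact: v2|by have [] := vP n|by have := (vP n).2 _ am].
have frad : radial f.
  apply: fr => n; have [g wg] := wr n; exists g.
  by apply: filterS2 wg (vP n).1 => x -> ->.
have fH : f \in H by apply/asboolP; split=> // a am; exists (V a); exact: fV.
have fJ : jet m f V by split=> //; apply: filterS (ball_measure_ae R d) => x _.
exists (\pi_(Hrad R d m) (HradFun fH)); apply/cvgrPdist_le => /= eps eps0.
set M := #|{: {ffun 'I_d -> 'I_m.+1}}|.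
have M0 : (0 : R) < M%:R + 1 by rewrite ltr_wpDl.
have eta0 : 0 < eps / (M%:R + 1) by rewrite divr_gt0.
have /choice[N NP] : forall a : {ffun 'I_d -> 'I_m.+1}, exists N,
    (mi_order (fun i => a i) <= m)%N -> forall n, (N <= n)%N ->
    l2norm (fun x => v n (fun i => a i) x - V (fun i => a i) x) <= eps / (M%:R + 1).
  move=> a; have [am|am] := boolP (mi_order (fun i => a i) <= m)%N; last by exists 0%N.
  by have [_ _ Vc] := VP _ am; have [N NP] := Vc _ eta0; exists N.
exists (\max_a N a)%N => // n /= Nn.
rewrite distrC -[u n]reprK [X in `|X|]piB Hrad_norm_pi.
have J := jet_sub (w2 n) f2 (vP n) fJ.
rewrite (sobolev_norm_jet (u := fun x => w n x - f x) J).
apply: (le_trans (jet_norm_le (v := fun a x => v n a x - V a x) (ltW eta0) _)).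
  by move=> a am; apply: NP => //; apply: leq_trans Nn; exact: leq_bigmax.
by rewrite mulrCA ler_piMr ?(ltW eps0)// ler_pdivrMr// mul1r lerDl.
Qed.

End Hrad_complete.

(** * The energy norm *)

Section energy_form.
Variables (R : realType) (d : nat).
Local Notation mu := (ball_measure R d).
Local Notation L2 := (Lfun mu 2%:E).
Implicit Types f g : 'rV[R]_d -> R.

Lemma partials_perm (s t : seq 'I_d) f : polyfn f -> perm_eq s t -> partials s f = partials t f.
Proof.
move=> pf; elim: s t => [|i s IH] t; first by move=> /perm_size/esym/size0nil ->.
move=> /[dup] st /perm_mem/(_ i); rewrite mem_head => /esym/splitPr ti.
case: t / ti st => t1 t2; rewrite perm_sym perm_catC/= perm_cons perm_catC perm_sym => st.
rewrite [LHS]/= (IH _ st) !partials_cat.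
exact/esym/pd_partials/polyfn_partials.
Qed.

Lemma partials_mpartial (s : seq 'I_d) f : polyfn f ->
  partials s f = mpartial (fun i => count_mem i s) f.
Proof.
move=> pf; apply: partials_perm => //.
apply/allP => i _ /=; rewrite count_flatten -map_comp.
rewrite (@eq_map _ _ _ (fun j => (j == i) * count_mem j s)%N); last first.
  by move=> j /=; rewrite count_nseq.
rewrite sumnE big_map (bigD1_seq i) ?mem_enum ?enum_uniq//= eqxx mul1n big1 ?addn0//.
by move=> j /negbTE ->.
Qed.

Lemma mi_order_count (s : seq 'I_d) : mi_order (fun i => count_mem i s) = size s.
Proof.
rewrite /mi_order; elim: s => [|j s IH] /=; first by rewrite big1.
rewrite big_split/= IH (bigD1 j)//= eqxx big1 ?addn0 ?add1n// => i ij.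
by rewrite eq_sym (negbTE ij).
Qed.

Lemma partials_lin (s : seq 'I_d) (c : R) f g : polyfn f -> polyfn g ->
  partials s (fun x => c * f x + g x) = fun x => c * partials s f x + partials s g x.
Proof.
move=> pf pg; elim: s => [//|i s IH].
have consE h : partials (i :: s) h = pd i (partials s h) by [].
have ps := polyfn_partials s pf; have pt := polyfn_partials s pg.
by rewrite !consE IH (pdD i (polyfnM (polyfn_cst d c) ps) pt) (pdZ c i ps).
Qed.

Let pform f g f' g' : polyfn f -> polyfn g -> polyfn f' -> polyfn g' ->
  polyfn (fun x => \sum_i pd i f x * pd i f' x + g x * g' x + f x * f' x).
Proof.
move=> pf pg pf' pg'; apply: polyfnD; last exact: polyfnM.
apply: polyfnD; last exact: polyfnM.
by apply: polyfn_sum => i; apply: polyfnM; exact: polyfn_pd.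
Qed.

Lemma form1_linl (c : R) f g f0 g0 f' g' : polyfn f -> polyfn g -> polyfn f0 -> polyfn g0 ->
  polyfn f' -> polyfn g' ->
  form1 (fun x => c * f x + f0 x) (fun x => c * g x + g0 x) f' g' =
  c * form1 f g f' g' + form1 f0 g0 f' g'.
Proof.
move=> pf pg pf0 pg0 pf' pg'; rewrite /form1.
have i1 := polyfn_integrable (pform pf pg pf' pg').
have i0 := polyfn_integrable (pform pf0 pg0 pf' pg').
rewrite -RintegralZl// -RintegralD//; last first.
  exact: (polyfn_integrable (polyfnM (polyfn_cst d c) (pform pf pg pf' pg'))).
apply: eq_Rintegral => x _.
have -> : \sum_i pd i (fun x => c * f x + f0 x) x * pd i f' x =
    c * (\sum_i pd i f x * pd i f' x) + \sum_i pd i f0 x * pd i f' x.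
  rewrite mulr_sumr -big_split/=; apply: eq_bigr => i _.
  have -> : pd i (fun x => c * f x + f0 x) x = c * pd i f x + pd i f0 x.
    exact: (congr1 (@^~ x) (partials_lin [:: i] c pf pf0)).
  by rewrite mulrDl mulrA.
by move: (\sum_i _) (\sum_i _) => *; ring.
Qed.

Lemma form1_sym f g f' g' : form1 f g f' g' = form1 f' g' f g.
Proof.
apply: eq_Rintegral => x _; congr (_ + _ + _); [|exact: mulrC|exact: mulrC].
by apply: eq_bigr => i _; exact: mulrC.
Qed.

Lemma form1_terms f g : polyfn f -> polyfn g -> form1 f g f g =
  \sum_i l2norm (pd i f) ^+ 2 + l2norm g ^+ 2 + l2norm f ^+ 2.
Proof.
move=> pf pg; have sq h : polyfn h -> l2norm h ^+ 2 = \int[mu]_x (h x * h x).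
  by move=> ph; rewrite l2norm_sqr; [apply: eq_Rintegral|exact: polyfn_L2].
have i2 h : polyfn h -> mu.-integrable setT (EFin \o (fun x => h x * h x)).
  by move=> ph; exact/polyfn_integrable/polyfnM.
rewrite /form1 RintegralD//; last 2 first.
- apply: polyfn_integrable; apply: polyfnD; last exact: polyfnM.
  by apply: polyfn_sum => i; apply: polyfnM; exact: polyfn_pd.
- exact: i2.
rewrite RintegralD//; last 2 first.
- by apply: polyfn_integrable; apply: polyfn_sum => i; apply: polyfnM; exact: polyfn_pd.
- exact: i2.
rewrite -!sq//; congr (_ + _ + _).
elim: (index_enum _) => [|i r IH].
  by rewrite big_nil; under eq_Rintegral do rewrite big_nil; rewrite Rintegral_cst// mul0r.
rewrite big_cons -IH sq; last exact: polyfn_pd.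
rewrite -RintegralD//; last 2 first.
- exact/i2/polyfn_pd.
- by apply: polyfn_integrable; apply: polyfn_sum => j; apply: polyfnM; exact: polyfn_pd.
by apply: eq_Rintegral => x _; rewrite big_cons.
Qed.

End energy_form.

Section radial_pairs.
Variables (R : realType) (d k : nat).
Local Notation mu := (ball_measure R d).
Local Notation rp := (@radial_poly R d).
Local Notation pair := ({poly R} * {poly R})%type.
Implicit Types z w : pair.

Lemma radial_poly_lin (c : R) (p q : {poly R}) : rp (c *: p + q) = fun x => c * rp p x + rp q x.
Proof. by apply/funext => x; rewrite /radial_poly !hornerE. Qed.

Lemma pd_radial_poly (q : {poly R}) i : pd i (rp q) = fun x => 2 * (rp q^`() x * x ord0 i).
Proof.
apply/funext => x.
have [_ D] := is_derive_comp_rV (is_derive_poly q (nsq x)) (polyfn_is_derive x i (@polyfn_nsq R d)).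
by rewrite [LHS]D pd_nsq /radial_poly; ring.
Qed.

Lemma xgrad_radial_poly (q : {poly R}) : xgrad (rp q) = rp (2 *: ('X * q^`())).
Proof.
apply/funext => x; rewrite /xgrad; under eq_bigr do rewrite pd_radial_poly.
rewrite /radial_poly hornerZ hornerM hornerX; move: q^`().[nsq x] => v.
by rewrite /nsq mulr_suml mulr_sumr; apply: eq_bigr => i _; ring.
Qed.

Lemma lapl_radial_poly (q : {poly R}) :
  lapl (rp q) = rp (4 *: ('X * q^`(2)) + (2 * d%:R) *: q^`()).
Proof.
apply/funext => x; rewrite /lapl.
have E i : pd i (pd i (rp q)) x = 4 * (rp q^`(2) x * x ord0 i ^+ 2) + 2 * rp q^`() x.
  rewrite pd_radial_poly; have pq := polyfn_radial_poly d q^`().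
  rewrite (pdZ 2 i (polyfnM pq (polyfn_coord R i))) (pdM i pq (polyfn_coord R i)).
  rewrite pd_radial_poly pd_coord eqxx mulr1 (derivnS q 1) derivn1.
  by ring.
under eq_bigr do rewrite E.
rewrite big_split/= -mulr_sumr -mulr_sumr -/(nsq x) sumr_const card_ord -[LHS]/(_ + _ *+ d).
rewrite /radial_poly hornerD !hornerZ hornerM hornerX -[_ *+ d]mulr_natl.
by ring.
Qed.

(** The operator read on radial profiles: in the variable [s = nsq x], the field [x . grad] sends q
    to [2 s q'], and the Laplacian sends it to [4 s q'' + 2 d q']. *)
Definition wave (c : R) z : pair :=
  (z.2 - 2 *: ('X * z.1^`()) - c *: z.1,
   4 *: ('X * z.1^`(2)) + (2 * d%:R) *: z.1^`() - 2 *: ('X * z.2^`()) - (c + 1) *: z.2).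

Lemma wave_radial1 c z : wave1 c (rp z.1) (rp z.2) = rp (wave c z).1.
Proof.
by apply/funext => x; rewrite /wave1 xgrad_radial_poly /radial_poly !hornerE.
Qed.

Lemma wave_radial2 c z : wave2 c (rp z.1) (rp z.2) = rp (wave c z).2.
Proof.
apply/funext => x; rewrite /wave2 xgrad_radial_poly lapl_radial_poly /radial_poly.
by rewrite !hornerE.
Qed.

(** Words of directions instead of multi-indices: one more derivative is one more letter, and
    [partials_wave] applies to each word. A mixed derivative is counted once per ordering, which
    only affects the constants of the norm equivalence. *)
Definition energy z w : R := \sum_(n < k.+1) \sum_(t : n.-tuple 'I_d)
  form1 (partials t (rp z.1)) (partials t (rp z.2)) (partials t (rp w.1)) (partials t (rp w.2)).

Let pp (t : seq 'I_d) (q : {poly R}) : polyfn (partials t (rp q)).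
Proof. exact/polyfn_partials/polyfn_radial_poly. Qed.

Lemma energy_linl (c : R) z z' w : energy (c *: z + z') w = c * energy z w + energy z' w.
Proof.
rewrite /energy mulr_sumr -big_split/=; apply: eq_bigr => n _.
rewrite mulr_sumr -big_split/=; apply: eq_bigr => t _.
rewrite !radial_poly_lin !partials_lin; try exact: polyfn_radial_poly.
by apply: form1_linl; exact: pp.
Qed.

Lemma energy_sym z w : energy z w = energy w z.
Proof. by apply: eq_bigr => n _; apply: eq_bigr => t _; exact: form1_sym. Qed.

Lemma energy_dissipative (c : R) z : 0 <= c ->
  2 * energy (wave c z) z <= (d%:R + 2) * energy z z.
Proof.
move=> c0; rewrite /energy !mulr_sumr; apply: ler_sum => n _.
rewrite !mulr_sumr; apply: ler_sum => t _.
rewrite -wave_radial1 -wave_radial2.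
have [-> ->] := partials_wave c t (polyfn_radial_poly d z.1) (polyfn_radial_poly d z.2).
by apply: form1_dissipative; rewrite ?addr_ge0//; exact: pp.
Qed.

Lemma energy_ge0 z : 0 <= energy z z.
Proof.
apply: sumr_ge0 => n _; apply: sumr_ge0 => t _; rewrite form1_terms; try exact: pp.
by rewrite !addr_ge0 ?sqr_ge0// sumr_ge0// => i _; exact: sqr_ge0.
Qed.

Let form1_le_energy (t : seq 'I_d) z : (size t <= k)%N ->
  form1 (partials t (rp z.1)) (partials t (rp z.2)) (partials t (rp z.1)) (partials t (rp z.2))
  <= energy z z.
Proof.
move=> tk; have f0 (s : seq 'I_d) : 0 <= form1 (partials s (rp z.1)) (partials s (rp z.2))
    (partials s (rp z.1)) (partials s (rp z.2)).
  rewrite form1_terms; try exact: pp.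
  by rewrite !addr_ge0 ?sqr_ge0// sumr_ge0// => i _; exact: sqr_ge0.
have tk1 : (size t < k.+1)%N by rewrite ltnS.
rewrite /energy (bigD1 (Ordinal tk1))//= (bigD1 (in_tuple t))//= -addrA lerDl.
by rewrite addr_ge0 ?sumr_ge0// => n _; exact: sumr_ge0.
Qed.

Lemma l2norm_partials_le1 (t : seq 'I_d) z : (size t <= k.+1)%N ->
  l2norm (partials t (rp z.1)) ^+ 2 <= energy z z.
Proof.
case: t => [_|i t]; last first.
  rewrite ltnS => tk; apply: le_trans (form1_le_energy z tk).
  rewrite form1_terms; try exact: pp.
  rewrite (bigD1 i)//= -!addrA lerDl !addr_ge0 ?sqr_ge0// sumr_ge0// => j _.
  exact: sqr_ge0.
apply: le_trans (form1_le_energy z (leq0n k : (size [::] <= k)%N)).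
rewrite form1_terms; try exact: pp.
by rewrite lerDr addr_ge0 ?sqr_ge0// sumr_ge0// => j _; exact: sqr_ge0.
Qed.

Lemma l2norm_partials_le2 (t : seq 'I_d) z : (size t <= k)%N ->
  l2norm (partials t (rp z.2)) ^+ 2 <= energy z z.
Proof.
move=> tk; apply: le_trans (form1_le_energy z tk); rewrite form1_terms; try exact: pp.
by rewrite -addrA addrCA lerDl addr_ge0 ?sqr_ge0// sumr_ge0// => j _; exact: sqr_ge0.
Qed.

Let jet_rp m q : jet m (rp q) (fun a => mpartial a (rp q)).
Proof.
split; first by apply: filterS (ball_measure_ae R d) => x _; rewrite mpartial0.
by move=> a _; apply: polyfn_weak_deriv; exact: polyfn_radial_poly.
Qed.

Variables m1 m2 : nat.
Hypotheses (m1E : m1 = k.+1) (m2E : m2 = k).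

(** [m1] and [m2] stand for the exponents of [energy_space], which are halves of [d.+1] and [d.-1].
    As variables they can be rewritten to [k.+1] and [k] inside the types. *)
Definition pair_class z : Hrad R d m1 * Hrad R d m2 :=
  (@radial_class R d m1 z.1, @radial_class R d m2 z.2).

Lemma pair_class_norm_le : exists M : R, 1 <= M /\ forall z,
  Num.max `|(pair_class z).1| `|(pair_class z).2| <= M * Num.sqrt (energy z z).
Proof.
rewrite /pair_class m1E m2E /=.
pose N1 := #|{: {ffun 'I_d -> 'I_k.+2}}|; pose N2 := #|{: {ffun 'I_d -> 'I_k.+1}}|.
exists (1 + N1%:R + N2%:R); split=> [|z]; first by rewrite -addrA lerDl addr_ge0.
have s0 : 0 <= Num.sqrt (energy z z) by exact: sqrtr_ge0.
have le_s (a : R) : 0 <= a -> a ^+ 2 <= energy z z -> a <= Num.sqrt (energy z z).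
  by move=> a0 ae; rewrite -[a]ger0_norm// -sqrtr_sqr ler_sqrt// energy_ge0.
rewrite ge_max; apply/andP; split; rewrite Hrad_norm_pi (sobolev_norm_jet (jet_rp _ _)).
- apply: (@le_trans _ _ (N1%:R * Num.sqrt (energy z z))).
    apply: jet_norm_le => // a am; apply: le_s; first exact: l2norm_ge0.
    by apply: l2norm_partials_le1; rewrite size_mi_seq.
  by rewrite ler_wpM2r// addrAC lerDr addr_ge0.
- apply: (@le_trans _ _ (N2%:R * Num.sqrt (energy z z))).
    apply: jet_norm_le => // a am; apply: le_s; first exact: l2norm_ge0.
    by apply: l2norm_partials_le2; rewrite size_mi_seq.
  by rewrite ler_wpM2r// lerDr addr_ge0.
Qed.

Lemma energy_le_pair_class : exists M : R, 0 <= M /\ forall z,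
  Num.sqrt (energy z z) <= M * Num.max `|(pair_class z).1| `|(pair_class z).2|.
Proof.
rewrite /pair_class m1E m2E /=.
(* A [form1] is the sum of [d + 2] squared L^2 norms. *)
pose K : R := \sum_(n < k.+1) \sum_(t : n.-tuple 'I_d) (d%:R + 2).
have K0 : 0 <= K by do 2 (apply: sumr_ge0 => ? _); exact: addr_ge0.
exists (Num.sqrt K); split=> [|z]; first exact: sqrtr_ge0.
set M := Num.max _ _; have M0 : 0 <= M by rewrite le_max normr_ge0.
rewrite -[M]ger0_norm// -sqrtr_sqr -sqrtrM// ler_sqrt ?mulr_ge0 ?sqr_ge0//.
have b1 (s : seq 'I_d) : (size s <= k.+1)%N -> l2norm (partials s (rp z.1)) ^+ 2 <= M ^+ 2.
  move=> sk; rewrite lerXn2r ?nnegrE ?l2norm_ge0// le_max; apply/orP; left.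
  rewrite partials_mpartial; last exact: polyfn_radial_poly.
  rewrite Hrad_norm_pi; apply: (l2norm_jet_le (jet_rp k.+1 z.1)).
  by rewrite mi_order_count.
have b2 (s : seq 'I_d) : (size s <= k)%N -> l2norm (partials s (rp z.2)) ^+ 2 <= M ^+ 2.
  move=> sk; rewrite lerXn2r ?nnegrE ?l2norm_ge0// le_max; apply/orP; right.
  rewrite partials_mpartial; last exact: polyfn_radial_poly.
  rewrite Hrad_norm_pi; apply: (l2norm_jet_le (jet_rp k z.2)).
  by rewrite mi_order_count.
rewrite /energy /K mulr_suml; apply: ler_sum => n _; rewrite mulr_suml; apply: ler_sum => t _.
have tk : (size t <= k)%N by rewrite size_tuple -ltnS.
rewrite form1_terms; try exact: pp.
have -> : (d%:R + 2) * M ^+ 2 = \sum_(i < d) M ^+ 2 + M ^+ 2 + M ^+ 2.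
  by rewrite sumr_const card_ord -[M ^+ 2 *+ d]mulr_natl; ring.
apply: lerD; first (apply: lerD; last exact: b2).
  by apply: ler_sum => i _; exact: (b1 (i :: t)).
exact/b1/leqW.
Qed.

End radial_pairs.

(** * Growth and eigenvectors *)

Section gronwall.
Variable R : realType.

(** [phi] is the energy along the explicit flow; the hypothesis says that its derivative is at most
    [W * phi], so that [e^(- W s) phi] does not increase. As [b] is a matrix, meant to be the Gram
    matrix of the eigenvectors for the energy, only finite sums of exponentials have to be
    differentiated in time. *)
Lemma gronwall_exp N (b : nat -> nat -> R) (lam c : nat -> R) (W t : R) :
  (forall m n, b m n = b n m) ->
  (forall a : nat -> R,
    2 * (\sum_(m < N) \sum_(n < N) lam m * a m * a n * b m n) <=
    W * (\sum_(m < N) \sum_(n < N) a m * a n * b m n)) -> 0 <= t ->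
  \sum_(m < N) \sum_(n < N) (c m * expR (lam m * t)) * (c n * expR (lam n * t)) * b m n <=
  expR (W * t) * (\sum_(m < N) \sum_(n < N) c m * c n * b m n).
Proof.
move=> bsym diss t0.
pose a (s : R) m := c m * expR (lam m * s).
pose phi (s : R) := \sum_(m < N) \sum_(n < N) a s m * a s n * b m n.
pose dphi (s : R) := \sum_(m < N) \sum_(n < N) (lam m + lam n) * (a s m * a s n * b m n).
have aD m s : is_derive s (1 : R) (a ^~ m) (lam m * a s m).
  have D1 : is_derive s (1 : R) (fun s : R => lam m * s) (lam m).
    have [D2 D3] := is_deriveM (is_derive_cst (lam m) s (1 : R)) (is_derive_id s (1 : R)).
    by apply: DeriveDef => //; rewrite [LHS]D3 /GRing.scale/= mulr0 addr0 mulr1.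
  have D2 := @is_derive1_comp _ expR (fun s => lam m * s) s _ _ (is_derive_expR _) D1.
  have [D3 D4] := is_deriveM (is_derive_cst (c m) s (1 : R)) D2.
  apply: DeriveDef => //; rewrite [LHS]D4 /GRing.scale/= mulr0 addr0 /a.
  by rewrite /cst; ring.
have phiD s : is_derive s (1 : R) phi (dphi s).
  apply: (@is_derive_sum_ord R R N (fun m s => \sum_(n < N) a s m * a s n * b m n)
    (fun m => \sum_(n < N) (lam m + lam n) * (a s m * a s n * b m n)) s 1) => m.
  apply: (@is_derive_sum_ord R R N (fun n s => a s m * a s n * b m n)
    (fun n => (lam m + lam n) * (a s m * a s n * b m n)) s 1) => n.
  have [D1 D2] := is_deriveM (is_deriveM (aD m s) (aD n s)) (is_derive_cst (b m n) s (1 : R)).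
  apply: DeriveDef => //; rewrite [LHS]D2 /GRing.scale/= mulr0 add0r /cst.
  by ring.
have dphi_le s : dphi s <= W * phi s.
  apply: le_trans (diss (a s)); rewrite /dphi.
  have -> : \sum_(m < N) \sum_(n < N) (lam m + lam n) * (a s m * a s n * b m n) =
      \sum_(m < N) \sum_(n < N) lam m * a s m * a s n * b m n +
      \sum_(m < N) \sum_(n < N) lam n * a s m * a s n * b m n.
    rewrite -big_split/=; apply: eq_bigr => m _; rewrite -big_split/=.
    by apply: eq_bigr => n _; ring.
  rewrite [X in _ + X](exchange_big _ _ _ _)/=.
  rewrite [X in _ + X](eq_bigr (fun m : 'I_N => \sum_(n < N) lam m * a s m * a s n * b m n)).
    by rewrite -mulr2n mulr_natl.
  by move=> m _; apply: eq_bigr => n _; rewrite bsym; ring.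
have ED (s : R) : is_derive s (1 : R) (fun s => expR (- W * s)) (- W * expR (- W * s)).
  have D1 : is_derive s (1 : R) (fun s : R => - W * s) (- W).
    have [D2 D3] := is_deriveM (is_derive_cst (- W) s (1 : R)) (is_derive_id s (1 : R)).
    by apply: DeriveDef => //; rewrite [LHS]D3 /GRing.scale/= mulr0 addr0 mulr1.
  have := @is_derive1_comp _ expR (fun s => - W * s) s _ _ (is_derive_expR _) D1.
  by rewrite mulrC.
pose psi (s : R) := expR (- W * s) * phi s.
have psiD s : is_derive s (1 : R) psi (expR (- W * s) * (dphi s - W * phi s)).
  have [D1 D2] := is_deriveM (ED s) (phiD s).
  by apply: DeriveDef => //; rewrite [LHS]D2 /GRing.scale/=; ring.
have psic : {within `[0, t], continuous psi}.
  apply: continuous_subspaceT => s; apply: differentiable_continuous.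
  by apply/derivable1_diffP; case: (psiD s).
have [xi _ E] := MVT_segment t0 (fun s _ => psiD s) psic.
have : psi t <= psi 0.
  rewrite -subr_le0 E subr0; apply: mulr_le0_ge0 => //.
  by apply: mulr_ge0_le0; rewrite ?expR_ge0// subr_le0.
rewrite /psi mulr0 expR0 mul1r => le0.
have -> : \sum_(m < N) \sum_(n < N) c m * c n * b m n = phi 0.
  by apply: eq_bigr => m _; apply: eq_bigr => n _; rewrite /a !mulr0 expR0 !mulr1.
rewrite -/(phi t) -[leLHS]mul1r -[X in X * _ <= _](mulfV (x := expR (W * t))) ?gt_eqF ?expR_gt0//.
by rewrite -mulrA ler_pM2l ?expR_gt0// -expRN -mulNr.
Qed.

End gronwall.

Section eigenpairs.
Variables (R : realType) (d : nat).
Local Notation pair := ({poly R} * {poly R})%type.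

(** The coefficient of [r^(2 j) s^(n - 2 j)] in the radial solution of [u_ss = Laplacian u] that is
    a homogeneous polynomial of degree [n] equal to [s^n] at [r = 0]. *)
Definition eig_coef (n j : nat) : R := \prod_(i < j)
  ((n%:R - 2 * i%:R) * (n%:R - 2 * i%:R - 1) / ((2 * i%:R + 2) * (2 * i%:R + d%:R))).

(* The eigenvectors for [- (c + n)], in the variable [r ^ 2]: the first equation makes
   the second component [x . grad - n] applied to the first, and the second one is
   then the recurrence of [eig_coefS]. *)
Definition eigenpair (n : nat) : pair :=
  (\poly_(j < n.+1) eig_coef n j, \poly_(j < n.+1) ((2 * j%:R - n%:R) * eig_coef n j)).

(** The factor of index [n./2] vanishes, by its first term for even [n] and by its second one for
    odd [n]. *)
Lemma eig_coef0 n j : (n < 2 * j)%N -> eig_coef n j = 0.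
Proof.
move=> nj; have hj : (n./2 < j)%N.
  by have := odd_double_half n; lia.
rewrite /eig_coef (bigD1 (Ordinal hj))//=.
have [on|en] := boolP (odd n).
  have -> : n%:R - 2 * n./2%:R - 1 = 0 :> R.
    rewrite -{1}(odd_double_half n) on add1n -natr1 -muln2 natrM; ring.
  by rewrite mulr0 !mul0r.
have -> : n%:R - 2 * n./2%:R = 0 :> R.
  rewrite -{1}(odd_double_half n) (negbTE en) add0n -muln2 natrM; ring.
by rewrite !mul0r.
Qed.

Lemma eig_coef_neq0 n j : (0 < d)%N -> (2 * j <= n)%N -> eig_coef n j != 0.
Proof.
move=> d0 jn; apply/prodf_neq0 => i _.
have i1 : (2 * i + 2 <= n)%N by have := ltn_ord i; lia.
have i2 : 2 * i%:R + 2 <= n%:R :> R by rewrite -natrM -natrD ler_nat.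
have i0 : 0 <= i%:R :> R by [].
have d1 : 0 < d%:R :> R by rewrite ltr0n.
by rewrite !mulf_neq0 ?invr_eq0 ?mulf_neq0// gt_eqF//; lra.
Qed.

Lemma eig_coefS n j : (0 < d)%N -> eig_coef n j.+1 * ((2 * j%:R + 2) * (2 * j%:R + d%:R)) =
  (n%:R - 2 * j%:R) * (n%:R - 2 * j%:R - 1) * eig_coef n j.
Proof.
move=> d0; rewrite /eig_coef big_ord_recr/= -[LHS]mulrA divfK; first exact: mulrC.
have j0 : 0 <= j%:R :> R by [].
have d1 : 0 < d%:R :> R by rewrite ltr0n.
by rewrite mulf_neq0// gt_eqF//; lra.
Qed.

Lemma coef_eigenpair1 n j : (eigenpair n).1`_j = eig_coef n j.
Proof. by rewrite coef_poly; case: ltnP => // nj; rewrite eig_coef0//; lia. Qed.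

Lemma coef_eigenpair2 n j : (eigenpair n).2`_j = (2 * j%:R - n%:R) * eig_coef n j.
Proof. by rewrite coef_poly; case: ltnP => // nj; rewrite eig_coef0 ?mulr0//; lia. Qed.

Lemma coefX_deriv (q : {poly R}) j : ('X * q^`())`_j = j%:R * q`_j.
Proof.
rewrite coefXM coef_deriv; case: j => [|j] /=; first by rewrite mul0r.
by rewrite mulr_natl.
Qed.

Lemma wave_eigenpair (c : R) n : (0 < d)%N ->
  wave d c (eigenpair n) = - (c + n%:R) *: eigenpair n.
Proof.
move=> d0; have := coef_eigenpair2 n; have := coef_eigenpair1 n.
case: (eigenpair n) => e1 e2 /= E1 E2; apply/pair_equal_spec; split; apply/polyP => j /=.
  by rewrite !coefB !coefZ coefX_deriv E1 E2; ring.
rewrite !coefB !coefD !coefZ !coefX_deriv !coef_deriv !E2 !E1.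
rewrite -[_ *+ j.+1]mulr_natl -[j.+1%:R]natr1.
have E := eig_coefS n j d0.
set A := eig_coef n j.+1 in E *; set B := eig_coef n j in E *.
have E3 : 4 * (j%:R * ((j%:R + 1) * A)) + 2 * d%:R * ((j%:R + 1) * A) =
    (n%:R - 2 * j%:R) * (n%:R - 2 * j%:R - 1) * B by rewrite -E; ring.
by rewrite E3; ring.
Qed.

Lemma wave_lin (c a : R) (z z' : pair) : wave d c (a *: z + z') = a *: wave d c z + wave d c z'.
Proof.
case: z z' => z1 z2 [z1' z2'].
rewrite /wave -[a *: (z1, z2) + (z1', z2')]/(a *: z1 + z1', a *: z2 + z2') /=.
apply/pair_equal_spec; split; apply/polyP => j.
  rewrite -[RHS]/((a *: (z2 - 2 *: ('X * z1^`()) - c *: z1) +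
    (z2' - 2 *: ('X * z1'^`()) - c *: z1'))`_j).
  rewrite !derivD !derivZ mulrDr -scalerAr !(coefD, coefN, coefZ); ring.
rewrite -[RHS]/((a *: (4 *: ('X * z1^`()^`()) + (2 * d%:R) *: z1^`() - 2 *: ('X * z2^`()) -
  (c + 1) *: z2) + (4 *: ('X * z1'^`()^`()) + (2 * d%:R) *: z1'^`() - 2 *: ('X * z2'^`()) -
  (c + 1) *: z2'))`_j).
rewrite !derivD !derivZ !mulrDr -!scalerAr !(coefD, coefN, coefZ); ring.
Qed.

End eigenpairs.

(** * The operator on the energy space *)

Section wave_on_polynomials.
Variables (R : realType) (d : nat).
Hypothesis d0 : (0 < d)%N.
Local Notation mu := (ball_measure R d).
Local Notation pair := ({poly R} * {poly R})%type.
Local Notation m1 := d.+1./2.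
Local Notation m2 := d.-1./2.
Variable c : R.

Definition pclass (z : pair) : energy_space R d := @pair_class R d m1 m2 z.

Definition eigenvector (n : nat) : energy_space R d := pclass (eigenpair R d n).

Definition eigenvalue_of (n : nat) : R := - (c + n%:R).

Local Notation lam := eigenvalue_of.
Local Notation comb := (lincomb eigenvector).

Lemma energy_norm (x : energy_space R d) : `|x| = Num.max `|x.1| `|x.2|.
Proof. by []. Qed.

Lemma pclass_lin (a : R) (z z' : pair) : pclass (a *: z + z') = a *: pclass z + pclass z'.
Proof. by apply/pair_equal_spec; split; exact: radial_class_linear. Qed.

Lemma pclass0 : pclass 0 = 0.
Proof.
have := pclass_lin (-1) 0 0; rewrite scaler0 addr0 scaleN1r => ->.
by rewrite addNr.
Qed.

Definition pcomb N (a : nat -> R) : pair := \sum_(i < N) a i *: eigenpair R d i.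

Lemma pclass_pcomb N (a : nat -> R) : \sum_(i < N) a i *: eigenvector i = pclass (pcomb N a).
Proof.
rewrite /pcomb; elim: N => [|N IH]; first by rewrite !big_ord0 pclass0.
by rewrite !big_ord_recr/= IH addrC -pclass_lin addrC.
Qed.

Lemma lincomb_coef_mul f p : comb (coef_mul f p) = pclass (pcomb (size p) (fun i => f i * p`_i)).
Proof.
rewrite (@lincomb_widen _ _ _ _ (size p)) ?size_poly// -pclass_pcomb.
by apply: eq_bigr => i _; rewrite coef_coef_mul.
Qed.

Lemma lincomb_pclass p : comb p = pclass (pcomb (size p) (fun i => p`_i)).
Proof. exact: pclass_pcomb. Qed.

Lemma wave_pcomb N (a : nat -> R) : wave d c (pcomb N a) = pcomb N (fun i => lam i * a i).
Proof.
have w0 : wave d c 0 = 0.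
  have := wave_lin d c (-1) 0 0; rewrite scaler0 addr0 scaleN1r => ->.
  by rewrite addNr.
rewrite /pcomb; elim: N => [|N IH]; first by rewrite !big_ord0 w0.
rewrite !big_ord_recr/= addrC wave_lin IH wave_eigenpair// scalerA addrC.
by rewrite [a N * _]mulrC.
Qed.

Lemma lincomb_Xn n : comb 'X^n = eigenvector n.
Proof.
rewrite (@lincomb_widen _ _ _ _ n.+1) ?size_polyXn// (bigD1 ord_max)//= coefXn eqxx scale1r.
rewrite big1 ?addr0// => i ni; rewrite coefXn (_ : (_ == _) = false) ?scale0r//.
by apply/negbTE; apply: contra ni => /eqP ni; apply/eqP/val_inj.
Qed.

(** Triangular elimination in degree [N]: the second component of the eigenpair of index [2 N] has
    coefficient zero there, that of index [2 N + 1] does not. The latter therefore removes the top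
    coefficient of [r], and the former then removes that of [q]. *)
Lemma lincomb_surj N (q r : {poly R}) : (size q <= N)%N -> (size r <= N)%N ->
  exists p, comb p = pclass (q, r).
Proof.
elim: N q r => [|N IH] q r.
  rewrite !leqn0 !size_poly_eq0 => /eqP -> /eqP ->; exists 0.
  by rewrite lincomb0; exact: (esym pclass0).
move=> qN rN.
have shrink (s : {poly R}) : (forall j, (N < j)%N -> s`_j = 0) -> s`_N = 0 -> (size s <= N)%N.
  move=> sj sN; apply/leq_sizeP => j; rewrite leq_eqVlt => /orP[/eqP <-//|]; exact: sj.
have big0 (s : {poly R}) j : (size s <= N.+1)%N -> (N < j)%N -> s`_j = 0.
  by move=> sN Nj; rewrite nth_default// (leq_trans sN).
have A0 : eig_coef R d (2 * N) N != 0 by exact: eig_coef_neq0.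
have B0 : eig_coef R d (2 * N).+1 N != 0 by apply: eig_coef_neq0 => //; exact: leqW.
pose b := - r`_N / eig_coef R d (2 * N).+1 N.
pose a := (q`_N - b * eig_coef R d (2 * N).+1 N) / eig_coef R d (2 * N) N.
pose e1 := eigenpair R d (2 * N); pose e2 := eigenpair R d (2 * N).+1.
have z1 j : (N < j)%N -> eig_coef R d (2 * N) j = 0 by move=> Nj; apply: eig_coef0; lia.
have z2 j : (N < j)%N -> eig_coef R d (2 * N).+1 j = 0 by move=> Nj; apply: eig_coef0; lia.
have q1N : (size (- a *: e1.1 + (- b *: e2.1 + q))%R <= N)%N.
  apply: shrink => [j Nj|]; rewrite !(coefD, coefZ) !coef_eigenpair1.
    by rewrite z1// z2// (big0 q)// !mulr0 !addr0.
  by rewrite /a; field.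
have r1N : (size (- a *: e1.2 + (- b *: e2.2 + r))%R <= N)%N.
  apply: shrink => [j Nj|]; rewrite !(coefD, coefZ) !coef_eigenpair2.
    by rewrite z1// z2// (big0 r)// !mulr0 !addr0.
  rewrite natrM subrr mul0r mulr0 add0r -[(2 * N).+1%:R]natr1 natrM /b.
  by field.
have [p pE] := IH _ _ q1N r1N.
exists (a *: 'X^(2 * N) + (b *: 'X^((2 * N).+1) + p)).
rewrite !lincombP !lincomb_Xn pE /eigenvector -!pclass_lin; congr pclass.
have cancel (x y z : {poly R}) : a *: x + (b *: y + (- a *: x + (- b *: y + z))) = z.
  by rewrite [- a *: x + _]addrCA [b *: y + _]addrA -scalerDl subrr scale0r add0r
    addrA -scalerDl subrr scale0r add0r.
by apply/pair_equal_spec; split; exact: cancel.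
Qed.

Lemma lincomb_dense_energy (x : energy_space R d) (eps : R) : (1 < d)%N -> 0 < eps ->
  exists p, `|x - comb p| < eps.
Proof.
move=> d1 eps0; have e2 : 0 < eps / 2 by rewrite divr_gt0.
have [q qP] := radial_class_dense x.1 d1 e2; have [r rP] := radial_class_dense x.2 d1 e2.
have [p pE] := @lincomb_surj (maxn (size q) (size r)) q r (leq_maxl _ _) (leq_maxr _ _).
exists p; rewrite pE; apply: (@le_lt_trans _ _ (eps / 2)); last by lra.
by rewrite -[leLHS]/(Num.max `|x.1 - radial_class _ _ q| `|x.2 - radial_class _ _ r|) ge_max qP rP.
Qed.

Lemma energy_space_complete (u : nat -> energy_space R d) :
  (forall eps : R, 0 < eps -> exists N, forall m n, (N <= m)%N -> (N <= n)%N ->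
    `|u m - u n| <= eps) -> exists l : energy_space R d, u @ \oo --> l.
Proof.
move=> uC.
have [l1 h1] : exists l : Hrad R d m1, (fun n => (u n).1) @ \oo --> l.
  apply: Hrad_complete => eps eps0; have [N NP] := uC eps eps0; exists N => i j Ni Nj.
  by apply: le_trans (NP i j Ni Nj); rewrite -[leRHS]/(Num.max _ _) le_max lexx.
have [l2 h2] : exists l : Hrad R d m2, (fun n => (u n).2) @ \oo --> l.
  apply: Hrad_complete => eps eps0; have [N NP] := uC eps eps0; exists N => i j Ni Nj.
  by apply: le_trans (NP i j Ni Nj); rewrite -[leRHS]/(Num.max _ _) le_max lexx orbT.
exists (l1, l2); apply/cvgrPdist_le => /= eps eps0.
move/cvgrPdist_le : h1 => /(_ _ eps0) h1; move/cvgrPdist_le : h2 => /(_ _ eps0) h2.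
apply: filterS2 h1 h2 => n h1 h2.
by rewrite energy_norm ge_max; apply/andP; split; [exact: h1|exact: h2].
Qed.

(** The weak derivatives of the chosen representatives agree almost everywhere with the classical
    derivatives of the polynomials, by [wderiv_polyfn]; only finitely many null sets are
    discarded. *)
Lemma wave_expression_pclass (p : R) (z : pair) : p != 1 -> c = 2 / (p - 1) ->
  wave_expression p (pclass z) (pclass (wave d c z)).
Proof.
move=> p1 cE.
have cE1 : (p + 1) / (p - 1) = c + 1 by rewrite cE; field; rewrite subr_eq0.
have pp q : polyfn (@radial_poly R d q) by exact: polyfn_radial_poly.
have L2f m (x : Hrad R d m) : Hrad_fun x \in Lfun mu 2%:E.
  by have /asboolP[] := hrad_valP (repr x).
have W m q (a : 'I_d -> nat) :=
    @wderiv_polyfn R d a _ _ (pp q) (L2f m _) (@Hrad_fun_radial_class R d m q).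
have mp (a : 'I_d -> nat) (s : seq 'I_d) q : (forall j, a j = count_mem j s) ->
    mpartial a (@radial_poly R d q) = partials s (@radial_poly R d q).
  by move=> as_; rewrite partials_mpartial//; congr mpartial; apply/funext.
have grad m q : {ae mu, forall x, xi_dot_grad (Hrad_fun (radial_class d m q)) x =
    xgrad (@radial_poly R d q) x}.
  have : {ae mu, forall x, forall i : 'I_d, wderiv (fun j => (j == i) : nat)
      (Hrad_fun (radial_class d m q)) x = pd i (@radial_poly R d q) x}.
    apply: filter_forall => i; apply: filterS (W m q (fun j => (j == i) : nat)) => x ->.
    by rewrite (mp _ [:: i])// => j /=; rewrite eq_sym addn0.
  by apply: filterS => x h; apply: eq_bigr => i _; rewrite h.
have lap m q : {ae mu, forall x, laplacian (Hrad_fun (radial_class d m q)) x =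
    lapl (@radial_poly R d q) x}.
  have : {ae mu, forall x, forall i : 'I_d, wderiv (fun j => (j == i).*2)
      (Hrad_fun (radial_class d m q)) x = pd i (pd i (@radial_poly R d q)) x}.
    apply: filter_forall => i; apply: filterS (W m q (fun j => (j == i).*2)) => x ->.
    by rewrite (mp _ [:: i; i])// => j /=; rewrite eq_sym addn0 addnn.
  by apply: filterS => x h; apply: eq_bigr => i _; rewrite h.
split.
  apply: filterS3 (@Hrad_fun_radial_class R d m1 (wave d c z).1) (@Hrad_fun_radial_class R d m1 z.1)
    (filterI (@Hrad_fun_radial_class R d m2 z.2) (grad m1 z.1)) => x -> e1 [e2 g].
  by rewrite /= e1 e2 g -cE -wave_radial1.
apply: filterS3 (@Hrad_fun_radial_class R d m2 (wave d c z).2) (lap m1 z.1)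
  (filterI (@Hrad_fun_radial_class R d m2 z.2) (grad m2 z.2)) => x -> e1 [e2 g].
by rewrite /= e1 e2 g cE1 -wave_radial2.
Qed.

Variable k : nat.
Hypotheses (m1E : m1 = k.+1) (m2E : m2 = k) (c0 : 0 <= c).

Let en (z w : pair) : R := energy d k z w.

Let energy_pcombl N (a : nat -> R) w : en (pcomb N a) w = \sum_(i < N) a i * en (eigenpair R d i) w.
Proof.
have e0 : en 0 w = 0.
  by have := energy_linl d k (-1) 0 0 w; rewrite scaler0 addr0 -/(en 0 w) => h; lra.
rewrite /pcomb; elim: N => [|N IH]; first by rewrite !big_ord0.
rewrite !big_ord_recr/= addrC; apply: etrans (energy_linl _ _ _ _ _ _) _.
by rewrite -/(en _ _) -[X in _ + X]/(en _ _) IH addrC.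
Qed.

Let energy_pcomb N (a b : nat -> R) : en (pcomb N a) (pcomb N b) =
  \sum_(m < N) \sum_(n < N) a m * b n * en (eigenpair R d m) (eigenpair R d n).
Proof.
rewrite energy_pcombl; apply: eq_bigr => m _.
rewrite /en energy_sym -/(en _ _) energy_pcombl mulr_sumr; apply: eq_bigr => n _.
by rewrite /en energy_sym; ring.
Qed.

(** The dissipativity constant [d + 2] rules the growth of the squared norm, hence its half in the
    exponent. The factor [M] comes from the equivalence of the energy norm with the norm of the
    space. *)
Lemma evol_bounded : exists M : R, 1 <= M /\ forall (t : R) p, 0 <= t ->
  `|comb (evol lam t p)| <= M * expR ((d%:R + 2) / 2 * t) * `|comb p|.
Proof.
have [M1 [M11 M1P]] := @pair_class_norm_le R d k _ _ m1E m2E.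
have [M2 [M20 M2P]] := @energy_le_pair_class R d k _ _ m1E m2E.
(* The summand 1 ensures [1 <= M]. *)
exists (1 + M1 * M2); split=> [|t p t0].
  by rewrite lerDl mulr_ge0// (le_trans ler01).
rewrite /evol lincomb_coef_mul lincomb_pclass; set N := size p.
set a := fun i => expR (lam i * t) * p`_i.
have gr : en (pcomb N a) (pcomb N a) <=
    expR ((d%:R + 2) * t) * en (pcomb N (fun i => p`_i)) (pcomb N (fun i => p`_i)).
  rewrite !energy_pcomb.
  pose b m n := en (eigenpair R d m) (eigenpair R d n).
  have bsym m n : b m n = b n m by exact: energy_sym.
  have diss (f : nat -> R) :
      2 * (\sum_(m < N) \sum_(n < N) lam m * f m * f n * b m n) <=
      (d%:R + 2) * (\sum_(m < N) \sum_(n < N) f m * f n * b m n).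
    have := energy_dissipative d k (pcomb N f) c0.
    by rewrite wave_pcomb -!/(en _ _) !energy_pcomb.
  apply: le_trans (gronwall_exp (fun i => p`_i) bsym diss t0).
  rewrite le_eqVlt; apply/orP; left; apply/eqP; apply: eq_bigr => m _; apply: eq_bigr => n _.
  by rewrite /a -/(b m n); ring.
rewrite energy_norm; apply: (le_trans (M1P _)).
set e := expR ((d%:R + 2) / 2 * t); set X := pcomb N (fun i => p`_i) in gr *.
have XE := M2P X; rewrite -/(pclass X) -energy_norm in XE.
have e0 : 0 <= e by exact: expR_ge0.
have sq : Num.sqrt (energy d k (pcomb N a) (pcomb N a)) <= e * Num.sqrt (energy d k X X).
  rewrite -[X in X * _]ger0_norm// -sqrtr_sqr -sqrtrM ?sqr_ge0// ler_sqrt; last first.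
    by rewrite mulr_ge0 ?sqr_ge0 ?energy_ge0.
  apply: (le_trans gr); rewrite -expRM_natl.
  by rewrite [X in expR X * _ <= _](_ : _ = 2 * ((d%:R + 2) / 2 * t))//; field.
have M10 : 0 <= M1 by exact: le_trans M11.
set x := `|pclass X| in XE *.
have -> : (1 + M1 * M2) * e * x = e * x + M1 * (e * (M2 * x)) by ring.
apply: (@le_trans _ _ (M1 * (e * (M2 * x)))); last by rewrite lerDr mulr_ge0// normr_ge0.
by rewrite ler_wpM2l// (le_trans sq)// ler_wpM2l.
Qed.

End wave_on_polynomials.

Theorem proposition1p1 (R : realType) (k d : nat) (p : R)
    (hk : (2 <= k)%N) (hd : d = (2 * k + 1)%N)
    (hp : (d%:R + 3) / (d%:R - 1) < p) :
  exists (D : set (energy_space R d)) (L0 : energy_space R d -> energy_space R d),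
    [/\ linear_operator D L0,
        dense D,
        forall psi, D psi -> wave_expression p psi (L0 psi),
        closable (op_graph D L0) &
        exists S : R -> energy_space R d -> energy_space R d,
          C0_semigroup S /\ generator S = closure (op_graph D L0)].
Proof.
have d0 : (0 < d)%N by lia.
have d1 : (1 < d)%N by lia.
have m1E : d.+1./2 = k.+1 by lia.
have m2E : d.-1./2 = k by lia.
(* [(d + 3) / (d - 1)] exceeds 1, so that [c] is nonnegative, as dissipativity requires. *)
have p1 : 1 < p.
  apply: lt_trans hp; have : (5 : R) <= d%:R by rewrite ler_nat; lia.
  by move=> d5; rewrite ltr_pdivlMr; lra.
pose c := 2 / (p - 1).
have c0 : 0 <= c by rewrite divr_ge0// subr_ge0 ltW.
have [M [M1 evolM]] := evol_bounded d0 m1E m2E c0.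
have w0 : 0 <= (d%:R + 2) / 2 :> R by rewrite divr_ge0// addr_ge0.
have lam_le n : eigenvalue_of c n <= (d%:R + 2) / 2.
  by rewrite (le_trans _ w0)// oppr_le0 addr_ge0.
have dense_comb (x : energy_space R d) (eps : R) : 0 < eps ->
    exists q, `|x - lincomb (@eigenvector R d) q| < eps.
  exact: lincomb_dense_energy.
have [linD clos C0S genS] := diag_semigroup_generation (@energy_space_complete R d)
  evolM dense_comb M1 w0 lam_le.
exists (range (lincomb (@eigenvector R d))),
  (diag_op (@eigenvector R d) (eigenvalue_of c)); split=> //.
- move=> O [x Ox] oO; have /nbhs_ballP[eps /= eps0 xO] : nbhs x O.
    exact: open_nbhs_nbhs.
  have [q qx] := dense_comb x eps eps0.
  exists (lincomb (@eigenvector R d) q); split; last by exists q.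
  by apply: xO; rewrite -ball_normE.
- move=> _ [q _ <-].
  rewrite (diag_opE (@energy_space_complete R d) evolM dense_comb M1).
  rewrite lincomb_coef_mul lincomb_pclass -wave_pcomb//.
  by apply: wave_expression_pclass => //; rewrite gt_eqF.
- by exists (semigroup (@eigenvector R d) (eigenvalue_of c)).
Qed.
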